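(* Let $D_1$ and $D_2$ be two equivalent oriented multi-virtual link diagrams with virtual crossings typed by $T$. Let $(Q,*,A_T)$ be an operator quandle. Then $\mathrm{Col}(D_1,Q,*,A_T) = \mathrm{Col}(D_2,Q,*,A_T)$.
   Context: Fix a set $T$ of types. A multi-virtual link diagram (of type $T$) is a planar link diagram in which each crossing is either classical (with over/under information) or virtual, and each virtual crossing is assigned a type from $T$. Two oriented diagrams are equivalent if one is obtained from the other by finitely many applications of planar isotopy, classical Reidemeister moves and multi-virtual detour moves, respecting orientations. A multi-virtual detour move excises a strand along which one meets a (possibly empty) consecutive sequence of crossings that are all virtual and all of the same type $\alpha$, and reconnects the endpoints by another arc meeting the rest of the diagram (and possibly itself) transversally, with all resulting crossings declared virtual of type $\alpha$; loops of virtual type $\alpha$ may be freely added to or removed from the strand. A quandle is a set $Q$ with a binary operation $*$ such that every right translation $R_x:y\mapsto y*x$ is a permutation of $Q$, $(x*y)*z=(x*z)*(y*z)$ and $x*x=x$. Write $x/y=R_y^{-1}(x)$. An operator quandle $(Q,*,A_T)$ is a quandle $(Q,* )$ with a list $A_T$ of pairwise commuting automorphisms of $(Q,* )$ (not necessarily distinct), one for each type in $T$; the automorphism assigned to type $\alpha$ is also denoted $\alpha$. An operator quandle coloring of an oriented diagram $D$ assigns an element of $Q$ to every arc of $D$ (arcs end at virtual crossings and at classical undercrossings; at a classical crossing the over-strand keeps its color), so that at each crossing, drawn with both strands oriented upward, with one strand going from bottom-left to top-right and the other from bottom-right to top-left: - Positive classical crossing (bottom-left to top-right strand is over): if the over-strand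 has color $b$ and the under-strand enters (bottom-right) with color $a$, it leaves (top-left) with color $a*b$. - Negative classical crossing (bottom-right to top-left strand is over): if the over-strand has color $a$ and the under-strand enters (bottom-left) with color $b$, it leaves (top-right) with color $b/a$. - Virtual crossing of type $\alpha$: if the bottom-left color is $b$ and the bottom-right color is $a$, then the top-left color is $\alpha(a)$ and the top-right color is $\alpha^{-1}(b)$. $\mathrm{Col}(D,Q,*,A_T)$ denotes the number of operator quandle colorings of $D$ by $(Q,*,A_T)$. *)

(* Defs.v *)
From HB Require Import structures.
From Stdlib Require Import Relation_Operators.
From mathcomp Require Import all_boot all_order all_algebra.
From mathcomp Require Import all_classical all_reals all_analysis.
Import Order.TTheory GRing.Theory Num.Theory.
Import numFieldNormedType.Exports.

Set Implicit Arguments.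
Unset Strict Implicit.
Unset Printing Implicit Defensive.

Local Open Scope classical_set_scope.
Local Open Scope ring_scope.

(* Diagrams are piecewise linear.  A [polygon] is a finite family of closed,
   oriented polygonal curves in the plane: the components are the cycles of
   [nextv], and the vertex [v] also names the oriented edge from [pos v] to
   [pos (nextv v)]. *)
Record polygon (R : realType) : Type := Polygon {
  vtx : finType;
  nextv : vtx -> vtx;
  nextv_inj : injective nextv;
  pos : vtx -> R * R }.

Arguments nextv {R p} _.
Arguments pos {R p} _.

Section Polygons.
Variable R : realType.
Implicit Type P : polygon R.

Definition det2 (u v : R * R) : R := u.1 * v.2 - u.2 * v.1.

Definition dir P (e : vtx P) : R * R := pos (nextv e) - pos e.

(* The parameters (e, s) with 0 <= s < 1 run exactly once through the curves. *)
Definition pt P (e : vtx P) (s : R) : R * R := pos e + s *: dir e.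

Definition meet_at P (e : vtx P) (s : R) (f : vtx P) (t : R) : Prop :=
  [/\ e != f, 0 <= s < 1, 0 <= t < 1 & pt e s = pt f t].

Definition cross P (e f : vtx P) : Prop := exists s t, meet_at e s f t.

(* The only multiple points are transverse double points interior to edges.
   For [e = f] the first clause also excludes degenerate edges. *)
Definition generic P : Prop :=
  (forall (e f : vtx P) (s t : R), 0 <= s < 1 -> 0 <= t < 1 ->
     pt e s = pt f t ->
     (e = f /\ s = t) \/ [/\ 0 < s, 0 < t & det2 (dir e) (dir f) != 0]) /\
  (forall (e f g : vtx P) (s t u : R), 0 <= s < 1 -> 0 <= t < 1 -> 0 <= u < 1 ->
     pt e s = pt f t -> pt f t = pt g u -> [\/ e = f, f = g | e = g]).

(* [insert a l] replaces the edge [a] of [P] by the polygonal strand from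
   [pos a] to [pos (nextv a)] with inner vertices the points of [l]; its edges
   are [inl a] and the [inr i].  No genericity of [P] is required. *)
Section Insert.
Variables (P : polygon R) (a : vtx P) (l : seq (R * R)).

Definition insert_vtx : finType := (vtx P + 'I_(size l))%type.

Definition insert_node (k : nat) : insert_vtx :=
  if insub k : option 'I_(size l) is Some i then inr i else inl (nextv a).

Definition insert_next (x : insert_vtx) : insert_vtx :=
  match x with
  | inl v => if v == a then insert_node 0 else inl (nextv v)
  | inr i => insert_node i.+1
  end.

Definition insert_pos (x : insert_vtx) : R * R :=
  match x with inl v => pos v | inr i => nth 0 l i end.

Lemma insert_next_inj : injective insert_next.
Proof.
have node_inj j k : (j <= size l)%N -> (k <= size l)%N ->
    insert_node j = insert_node k -> j = k.
  rewrite /insert_node => jl kl.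
  case: insubP => [i _ <-|]; case: insubP => [i' _ <-|] //.
    by move=> [->].
  rewrite -!leqNgt => lk lj _.
  by apply/eqP; rewrite eqn_leq (leq_trans jl lk) (leq_trans kl lj).
have node_out k v : insert_node k = inl v -> v = nextv a.
  by rewrite /insert_node; case: insubP => // _ [].
move=> [v|i] [w|j] /=.
- case: eqP => [->|va]; case: eqP => [->|wa] //.
  + by move/node_out/nextv_inj => wE; rewrite wE in wa.
  + by move/esym/node_out/nextv_inj => vE; rewrite vE in va.
  + by move=> [] /nextv_inj ->.
- case: eqP => [_ /node_inj|va].
    by move=> /(_ isT (ltn_ord j)).
  by move/esym/node_out/nextv_inj => vE; rewrite vE in va.
- case: eqP => [_ /node_inj|wa].
    by move=> /(_ (ltn_ord i) isT).
  by move/node_out/nextv_inj => wE; rewrite wE in wa.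
- by move/node_inj => /(_ (ltn_ord i) (ltn_ord j)) [] /ord_inj ->.
Qed.

Definition insert : polygon R := Polygon insert_next_inj insert_pos.

Definition on_strand (x : vtx insert) : bool :=
  match x with inl v => v == a | inr _ => true end.

End Insert.

Definition hull (l : seq (R * R)) : set (R * R) :=
  [set x | exists w : 'I_(size l) -> R,
     [/\ forall i, 0 <= w i, \sum_i w i = 1 & x = \sum_i w i *: nth 0 l i]].

(* Apart from the edge [a] itself, only the edges in [xs] enter [H]; the end
   [pos (nextv a)] of [a] is the point of parameter 0 of the edge [nextv a]. *)
Definition only_meets P (a : vtx P) (H : set (R * R)) (xs : seq (vtx P)) :=
  forall (x : vtx P) (s : R), x != a -> 0 <= s < 1 -> H (pt x s) ->
    x \in xs \/ (x = nextv a /\ s = 0).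

End Polygons.

(* How an edge passes another edge that it crosses. *)
Inductive passage (T : Type) : Type := Over | Under | Virtual of T.
Arguments Over {T}.
Arguments Under {T}.

Definition mirror T (l : passage T) : passage T :=
  match l with Over => Under | Under => Over | Virtual a => Virtual a end.

Definition classical T (l : passage T) : bool :=
  if l is Virtual _ then false else true.

(* [lab e f] tells how the edge [e] passes the edge [f]; it is only meaningful
   when the two edges cross. *)
Definition is_diagram (R : realType) (T : Type) (P : polygon R)
    (lab : vtx P -> vtx P -> passage T) : Prop :=
  generic P /\ forall e f, cross e f -> lab f e = mirror (lab e f).

Record diagram (R : realType) (T : Type) : Type := Diagram {
  poly :> polygon R;
  lab : vtx poly -> vtx poly -> passage T;
  diagramP : is_diagram lab }.

Section Moves.
Variables (R : realType) (T : Type).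
Implicit Types (P : polygon R) (D : diagram R T).

(* The vertices move continuously in the plane and the curves form a diagram
   at all times; [phi] allows for a renaming of the vertices. *)
Definition isotopic D1 D2 : Prop :=
  exists (phi : vtx D1 -> vtx D2) (p : R -> vtx D1 -> R * R),
  [/\ bijective phi /\ (forall v, phi (nextv v) = nextv (phi v)),
      forall v, {within `[0, 1], continuous (fun t => p t v)},
      p 0 = pos /\ (forall v, p 1 v = pos (phi v)),
      forall t : R, 0 <= t <= 1 ->
        @is_diagram R T (Polygon (@nextv_inj _ D1) (p t)) (@lab _ _ D1) &
      forall e f, cross e f -> lab e f = lab (phi e) (phi f)].

(* The remaining moves replace a strand, given as an edge [a] of [P] with
   inserted vertices [l1], by the strand with inserted vertices [l2]. *)
Section Strand.
Variables (P : polygon R) (a : vtx P).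

Definition labelling (l : seq (R * R)) :=
  vtx (insert a l) -> vtx (insert a l) -> passage T.

Definition same_outside l1 l2 (lab1 : labelling l1) (lab2 : labelling l2) :=
  forall x y : vtx P, x != a -> y != a -> cross x y ->
    lab1 (inl x) (inl y) = lab2 (inl x) (inl y).

(* All crossings of the new strand with the edge [x] are of the same nature as
   the crossing of the old one. *)
Definition same_passage l1 l2 (lab1 : labelling l1) (lab2 : labelling l2)
    (x : vtx P) :=
  forall (z1 : vtx (insert a l1)) (z2 : vtx (insert a l2)),
    on_strand z1 -> on_strand z2 ->
    cross z1 (inl x) -> cross z2 (inl x) -> lab1 z1 (inl x) = lab2 z2 (inl x).

Definition strand_crosses l (x : vtx P) :=
  exists2 z : vtx (insert a l), on_strand z & cross z (inl x).

Definition subdivision (p : R * R)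
    (lab1 : labelling [::]) (lab2 : labelling [:: p]) : Prop :=
  (exists2 s : R, 0 < s < 1 & p = pt a s) /\
  forall x, x != a -> same_passage lab1 lab2 x.

Definition reidemeister1 (p q : R * R) (lab2 : labelling [:: p; q]) : Prop :=
  let e1 : vtx (insert a [:: p; q]) := inl a in
  let e3 := nextv (nextv e1) in
  [/\ only_meets a (hull [:: pos a; p; q; pos (nextv a)]) [::],
      cross e1 e3 & classical (lab2 e1 e3)].

Definition reidemeister2 (p : R * R) (lab2 : labelling [:: p]) : Prop :=
  let e1 : vtx (insert a [:: p]) := inl a in
  let e2 := nextv e1 in
  exists x : vtx P,
  [/\ x != a,
      only_meets a (hull [:: pos a; p; pos (nextv a)]) [:: x],
      cross e1 (inl x) /\ cross e2 (inl x),
      classical (lab2 e1 (inl x)) &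
      lab2 e1 (inl x) = lab2 e2 (inl x)].

(* The strand passes from one side to the other of the crossing of [x] and [y].
   The three passages are all equal exactly when the strands lie cyclically
   over each other, which is not a Reidemeister move. *)
Definition reidemeister3 (p : R * R)
    (lab1 : labelling [::]) (lab2 : labelling [:: p]) : Prop :=
  let e : vtx (insert a [::]) := inl a in
  exists x y : vtx P,
  [/\ [/\ x != a, y != a &
        only_meets a (hull [:: pos a; p; pos (nextv a)]) [:: x; y]],
      exists s t, meet_at x s y t /\ hull [:: pos a; p; pos (nextv a)] (pt x s),
      forall z, z \in [:: x; y] ->
        [/\ cross e (inl z), strand_crosses [:: p] z & same_passage lab1 lab2 z],
      [/\ classical (lab1 e (inl x)), classical (lab1 (inl x) (inl y)) &
          classical (lab1 (inl y) e)] &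
      ~ (lab1 e (inl x) = lab1 (inl x) (inl y) /\
         lab1 (inl x) (inl y) = lab1 (inl y) e)].

Definition strand_virtual l (lb : labelling l) (alpha : T) : Prop :=
  forall z w : vtx (insert a l), on_strand z -> cross z w ->
    lb z w = Virtual alpha.

End Strand.

Inductive move : diagram R T -> diagram R T -> Prop :=
| PlanarIsotopy D1 D2 : isotopic D1 D2 -> move D1 D2
| Subdivision P a p lab1 lab2 ok1 ok2 :
    same_outside lab1 lab2 -> subdivision lab1 lab2 ->
    move (@Diagram R T (@insert R P a [::]) lab1 ok1)
         (@Diagram R T (@insert R P a [:: p]) lab2 ok2)
| Reidemeister1 P a p q lab1 lab2 ok1 ok2 :
    same_outside lab1 lab2 -> reidemeister1 lab2 ->
    move (@Diagram R T (@insert R P a [::]) lab1 ok1)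
         (@Diagram R T (@insert R P a [:: p; q]) lab2 ok2)
| Reidemeister2 P a p lab1 lab2 ok1 ok2 :
    same_outside lab1 lab2 -> reidemeister2 lab2 ->
    move (@Diagram R T (@insert R P a [::]) lab1 ok1)
         (@Diagram R T (@insert R P a [:: p]) lab2 ok2)
| Reidemeister3 P a p lab1 lab2 ok1 ok2 :
    same_outside lab1 lab2 -> reidemeister3 lab1 lab2 ->
    move (@Diagram R T (@insert R P a [::]) lab1 ok1)
         (@Diagram R T (@insert R P a [:: p]) lab2 ok2)
| Detour P a l1 l2 lab1 lab2 ok1 ok2 alpha :
    same_outside lab1 lab2 ->
    strand_virtual lab1 alpha -> strand_virtual lab2 alpha ->
    move (@Diagram R T (@insert R P a l1) lab1 ok1)
         (@Diagram R T (@insert R P a l2) lab2 ok2).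

Definition equivalent : diagram R T -> diagram R T -> Prop :=
  clos_refl_sym_trans (diagram R T) move.

End Moves.

(* [qdiv ^~ y] is the inverse of the right translation by [y]. *)
Record quandle : Type := Quandle {
  qcar :> Type;
  qop : qcar -> qcar -> qcar;
  qdiv : qcar -> qcar -> qcar;
  qopK : forall y, cancel (qop ^~ y) (qdiv ^~ y);
  qdivK : forall y, cancel (qdiv ^~ y) (qop ^~ y);
  qop_distr : forall x y z, qop (qop x y) z = qop (qop x z) (qop y z);
  qop_idem : forall x, qop x x = x }.

Record operator_quandle (T : Type) : Type := OperatorQuandle {
  oq :> quandle;
  aut : T -> oq -> oq;
  autV : T -> oq -> oq;
  autK : forall alpha, cancel (aut alpha) (autV alpha);
  autVK : forall alpha, cancel (autV alpha) (aut alpha);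
  autM : forall alpha x y,
    aut alpha (qop x y) = qop (aut alpha x) (aut alpha y);
  aut_comm : forall alpha beta x,
    aut alpha (aut beta x) = aut beta (aut alpha x) }.

Section Colorings.
Variables (R : realType) (T : Type) (D : diagram R T).

(* The points that are neither undercrossings nor virtual crossings. *)
Definition on_arc : set (vtx D * R) :=
  [set x | 0 <= x.2 < 1 /\
     forall f t, meet_at x.1 x.2 f t -> lab x.1 f = Over].

Definition run (x y : vtx D * R) : Prop :=
  [/\ on_arc x, on_arc y &
    [/\ x.1 = y.1, x.2 <= y.2 &
        forall r : R, x.2 <= r <= y.2 -> on_arc (x.1, r)]
    \/ (y = (nextv x.1, 0) /\ forall r : R, x.2 <= r < 1 -> on_arc (x.1, r))].

Definition arc_of (x : vtx D * R) : set (vtx D * R) :=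
  [set y | clos_refl_sym_trans _ run x y].

Definition arcs : set (set (vtx D * R)) := [set arc_of x | x in on_arc].

(* The arc [A] ends, resp. starts, at the point of parameter [s] of [e]. *)
Definition arc_in (A : set (vtx D * R)) (e : vtx D) (s : R) : Prop :=
  exists s0 : R, [/\ 0 <= s0 < s, A (e, s0) &
                 forall r : R, s0 <= r < s -> on_arc (e, r)].

Definition arc_out (A : set (vtx D * R)) (e : vtx D) (s : R) : Prop :=
  exists s0 : R, [/\ s < s0 < 1, A (e, s0) &
                 forall r : R, s < r <= s0 -> on_arc (e, r)].

Variable Q : operator_quandle T.

(* At each crossing the edges are named so that [det2 (dir e) (dir f)] is
   positive: when both are drawn upwards, [e] goes from bottom-left to
   top-right and [f] from bottom-right to top-left. *)
Definition is_coloring (c : arcs -> Q) : Prop :=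
  forall (e : vtx D) s (f : vtx D) t,
  meet_at e s f t -> 0 < det2 (dir e) (dir f) ->
  match lab e f with
  | Over => forall A B C : arcs,
      arc_in (val A) f t -> arc_out (val B) f t -> val C (e, s) ->
      c B = qop (c A) (c C)
  | Under => forall A B C : arcs,
      arc_in (val A) e s -> arc_out (val B) e s -> val C (f, t) ->
      c B = qdiv (c A) (c C)
  | Virtual alpha =>
      (forall A B : arcs, arc_in (val A) f t -> arc_out (val B) f t ->
         c B = aut alpha (c A)) /\
      (forall A B : arcs, arc_in (val A) e s -> arc_out (val B) e s ->
         c B = autV alpha (c A))
  end.

Definition Col : set (arcs -> Q) := [set c | is_coloring c].

End Colorings.

Arguments on_arc {R T} D _.
Arguments arcs {R T} D _.
Arguments Col {R T} D Q _.

(* Main.v *)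
(* A colouring of the arcs is the same thing as a colour for every point of the
   diagram that is left-continuous and locally constant along the curves away
   from the crossings and jumps at each crossing by the rule of that crossing.
   In this form colourings depend only on the oriented Gauss diagram, which a
   planar isotopy keeps: the crossings cannot appear, vanish, change sign or
   change their order along an edge without passing through a non-generic
   position.

   The other moves replace a strand.  In a Reidemeister move, only the colours on
   the strand and on short windows of the edges that it crosses change, and these
   are determined by the incoming colours; the outgoing colours agree by
   idempotence, invertibility and self-distributivity.  In a detour move of type
   alpha, let w be the winding number of the closed curve made of the new strand
   and the reversed old one.  Applying alpha^w to the colours off the strand turns
   colourings into colourings: w jumps by one exactly where alpha acts at a
   crossing with the old or the new strand, and is the same for the two edges at
   any other crossing, where the rule is compatible with alpha^w because alpha is
   an automorphism that commutes with the other operators. *)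

Require Import Defs.
From Stdlib Require Import Relation_Operators.
From mathcomp Require Import all_boot all_order all_algebra.
From mathcomp Require Import all_classical all_reals all_analysis.
From mathcomp Require Import zify ring lra.
Import Order.TTheory GRing.Theory Num.Theory.
Import numFieldNormedType.Exports.

Set Implicit Arguments.
Unset Strict Implicit.
Unset Printing Implicit Defensive.

Local Open Scope classical_set_scope.
Local Open Scope ring_scope.

(** An edge may carry any number of crossings, and with arcs as the basic objects every move would
    become a renumbering. Point colourings replace arcs by local conditions at one-sided limits;
    global consequences come from induction along a real interval, used for colours, for winding
    numbers and for the time of an isotopy alike.

    Values outside the parameter interval [[0, 1]] are arbitrary and [Q] may be infinite, so a move
    is not described by a map. It yields a relation between colourings, with partners on both sides
    and a uniqueness statement; the bijection is extracted once and for all.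

    In a detour the winding number is undefined on the strands themselves. It is therefore
    approached along the direction of an edge, by counting crossings with a horizontal ray. The
    count for a single strand also jumps when the ray passes over an end of the strand; the two
    strands share their ends, so these jumps cancel in the difference. A self-crossing of a virtual
    strand acts twice with opposite exponents, so at the end of the strand only the crossings with
    other edges matter. *)

Section OneSidedLimits.
Variable R : realType.
Implicit Types (P : R -> Prop) (s : R).

Lemma near_rightP P s :
  (\forall r \near s^'+, P r) <-> exists2 d, s < d & forall r, s < r < d -> P r.
Proof.
split=> [|[d sd Pd]].
  rewrite near_withinE => /nbhs_ballP[e /= e0 He]; exists (s + e); first lra.
  move=> r /andP[sr rd]; apply: He => //=; rewrite /ball/= ltr_norml; lra.
by near=> r; apply: Pd; apply/andP; split; near: r; [exact: nbhs_right_gt|exact: nbhs_right_lt].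
Unshelve. all: by end_near. Qed.

Lemma near_leftP P s :
  (\forall r \near s^'-, P r) <-> exists2 d, d < s & forall r, d < r < s -> P r.
Proof.
split=> [|[d sd Pd]].
  rewrite near_withinE => /nbhs_ballP[e /= e0 He]; exists (s - e); first lra.
  move=> r /andP[sr rd]; apply: He => //=; rewrite /ball/= ltr_norml; lra.
by near=> r; apply: Pd; apply/andP; split; near: r; [exact: nbhs_left_gt|exact: nbhs_left_lt].
Unshelve. all: by end_near. Qed.

(** Induction along a real interval, with a successor step to the right and a limit step from the
    left. The supremum of the initial segments on which [P] holds satisfies [P] by the limit step,
    and the successor step moves beyond it unless it is the end point. *)
Lemma real_ind P a b : P a ->
  (forall s, a <= s < b -> (forall r, a <= r <= s -> P r) -> \forall r \near s^'+, P r) ->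
  (forall s, a < s <= b -> (forall r, a <= r < s -> P r) -> P s) ->
  forall s, a <= s <= b -> P s.
Proof.
move=> Pa Pr Pl s0 /andP[as0 s0b].
pose S := [set r | a <= r <= s0 /\ forall x, a <= x <= r -> P x].
have Sa : S a.
  by split=> [|x /andP[ax xa]]; [rewrite lexx|have -> : x = a by apply/eqP; rewrite eq_le xa].
have supS : has_sup S.
  by split; [exists a|exists s0 => r [/andP[]]].
have ac : a <= sup S by apply: sup_upper_bound.
have cs0 : sup S <= s0 by apply: ge_sup; [exists a|move=> r [/andP[]]].
have Pltc x : a <= x < sup S -> P x.
  move=> /andP[ax xc]; have e0 : 0 < sup S - x by rewrite subr_gt0.
  have [r [_ Hr] rx] := sup_adherent e0 supS.
  by apply: Hr; rewrite ax /=; lra.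
have Pc x : a <= x <= sup S -> P x.
  move=> /andP[ax]; rewrite le_eqVlt => /orP[/eqP ->|xc]; last by apply: Pltc; rewrite ax.
  move: ac; rewrite le_eqVlt => /orP[/eqP <- //|ac].
  by apply: Pl => //; rewrite ac /=; lra.
move: cs0; rewrite le_eqVlt => /orP[/eqP cs0|cs0].
  by apply: Pc; rewrite as0 /=; lra.
have /Pr /(_ Pc) /near_rightP[d cd Hd] : a <= sup S < b by rewrite ac /=; lra.
(* Capped by [s0] to stay in [S], and below [d], where the successor step gives [P]. *)
pose r := Num.min s0 ((sup S + d) / 2).
have [rs0 rd cr] : [/\ r <= s0, r < d & sup S < r].
  by rewrite /r; split; rewrite ?ge_min ?gt_min ?lt_min ?lexx //=; apply/orP || apply/andP; lra.
suff Sr : S r by have := sup_upper_bound supS Sr; lra.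
split=> [|x /andP[ax xr]]; first by lra.
have [xc|cx] := leP x (sup S); first by apply: Pc; rewrite ax.
by apply: Hd; lra.
Qed.

End OneSidedLimits.

(** * Crossings of a generic polygon *)

Section Meets.
Variable R : realType.

Lemma ptE (P : polygon R) (e : vtx P) s :
  pt e s = ((pos e).1 + s * (dir e).1, (pos e).2 + s * (dir e).2).
Proof. by []. Qed.

Lemma pair_eqP (u v : R * R) : u = v <-> u.1 = v.1 /\ u.2 = v.2.
Proof. by case: u v => [u1 u2] [v1 v2]; split=> [[-> ->]|[/= -> ->]]. Qed.

Lemma pt_eq (P P' : polygon R) (e : vtx P) s (f : vtx P') t : pt e s = pt f t ->
  (pos e).1 + s * (dir e).1 = (pos f).1 + t * (dir f).1 /\
  (pos e).2 + s * (dir e).2 = (pos f).2 + t * (dir f).2.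
Proof. by move/pair_eqP. Qed.

Variable P : polygon R.
Implicit Types e f : vtx P.

Lemma meet_sym e s f t : meet_at e s f t -> meet_at f t e s.
Proof. by case=> ef se tf st; split=> //; rewrite eq_sym. Qed.

Lemma pt1 e : pt e 1 = pos (nextv e).
Proof. by rewrite ptE /dir; apply/pair_eqP; rewrite /=; split; ring. Qed.

Lemma pt0 e : pt e 0 = pos e.
Proof. by rewrite ptE; apply/pair_eqP; rewrite /=; split; ring. Qed.

Hypothesis gP : generic P.

Lemma meet_interior e s f t : meet_at e s f t ->
  [/\ 0 < s < 1, 0 < t < 1 & det2 (dir e) (dir f) != 0].
Proof.
case=> ef se tf st; have [[eE _]|[s0 t0 d0]] := gP.1 _ _ _ _ se tf st.
  by rewrite eE eqxx in ef.
by split=> //; lra.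
Qed.

(** Two solutions of [pt e s = pt f t] differ by a solution of the homogeneous system, whose
    determinant is nonzero by transversality. *)
Lemma meet_param e s s' f t t' : meet_at e s f t -> meet_at e s' f t' -> s = s' /\ t = t'.
Proof.
move=> m m'; have [_ _ d0] := meet_interior m.
case: m m' => _ _ _ /pt_eq[E1 E2] [_ _ _ /pt_eq[E1' E2']].
suff ss : s = s'.
  split=> //; subst s'.
  have [/eqP d1|d1] := boolP ((dir f).1 == 0); last first.
    by apply: (mulIf d1); lra.
  have [/eqP d2|d2] := boolP ((dir f).2 == 0); last first.
    by apply: (mulIf d2); lra.
  by rewrite /det2 d1 d2 !mulr0 subrr eqxx in d0.
apply/eqP; rewrite -subr_eq0; apply/eqP/(mulIf d0); rewrite mul0r /det2.
have -> : (s - s') * ((dir e).1 * (dir f).2 - (dir e).2 * (dir f).1) =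
  (s * (dir e).1 - s' * (dir e).1) * (dir f).2 - (s * (dir e).2 - s' * (dir e).2) * (dir f).1 by
    ring.
have -> : s * (dir e).1 - s' * (dir e).1 = (t - t') * (dir f).1 by rewrite mulrBl; lra.
have -> : s * (dir e).2 - s' * (dir e).2 = (t - t') * (dir f).2 by rewrite mulrBl; lra.
ring.
Qed.

Lemma meet_edge e s f f' t t' : meet_at e s f t -> meet_at e s f' t' -> f = f' /\ t = t'.
Proof.
move=> m m'; suff ff : f = f'.
  by subst f'; have [] := meet_param m m'.
case: m m' => ef se tf st [ef' _ tf' st'].
have [fe|ff|//] := gP.2 _ _ _ _ _ _ tf se tf' (esym st) st'.
  by rewrite fe eqxx in ef.
by rewrite ff eqxx in ef'.
Qed.

(** Each of the finitely many edges [f] meets [e] at most once, so the crossings on [e] have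
    isolated parameters. *)
Lemma no_meet_right e s : \forall r \near s^'+, forall f t, ~ meet_at e r f t.
Proof.
apply: filter_forall => f.
have [[c [t m]]|nm] := pselect (exists c t, meet_at e c f t); last first.
  by near=> r => t m; apply: nm; exists r, t.
have [cs|sc] := leP c s.
  by near=> r => t' /(meet_param m)[cr _]; have : s < r by []; lra.
by near=> r => t' /(meet_param m)[cr _]; have : r < c by []; lra.
Unshelve. all: by end_near. Qed.

Lemma no_meet_left e s : \forall r \near s^'-, forall f t, ~ meet_at e r f t.
Proof.
apply: filter_forall => f.
have [[c [t m]]|nm] := pselect (exists c t, meet_at e c f t); last first.
  by near=> r => t m; apply: nm; exists r, t.
have [sc|cs] := leP s c.
  by near=> r => t' /(meet_param m)[cr _]; have : r < s by []; lra.
by near=> r => t' /(meet_param m)[cr _]; have : c < r by []; lra.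
Unshelve. all: by end_near. Qed.

(** Consecutive edges already share a vertex; a second common point would make them parallel,
    against transversality. *)
Lemma meet_nextv e s t : ~ meet_at e s (nextv e) t.
Proof.
move=> m; have [s01 t01 /eqP[]] := meet_interior m.
case: m => _ _ _ /pt_eq[]; rewrite /det2 => E1 E2.
apply: (mulfI (_ : (1 - s) != 0)); first by apply/eqP; lra.
rewrite mulr0 mulrBr !mulrA.
have -> : (1 - s) * (dir e).1 = - t * (dir (nextv e)).1 by move: E1; rewrite {1 2}/dir/=; lra.
have -> : (1 - s) * (dir e).2 = - t * (dir (nextv e)).2 by move: E2; rewrite {1 2}/dir/=; lra.
ring.
Qed.

End Meets.

(** * Colours of points *)

Section Act.
Variables (T : Type) (Q : operator_quandle T).

(** Both rules of a crossing in one formula: [u] is the incoming colour of the edge considered, [w]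
    the colour of the other edge, and [b] tells whether the edge considered runs from bottom-left to
    top-right. *)
Definition act (l : passage T) (b : bool) (u w : Q) : Q :=
  match l with
  | Over => u
  | Under => if b then qdiv u w else qop u w
  | Virtual alpha => if b then autV alpha u else aut alpha u
  end.

Lemma act_transparent l b u w w' : l <> Under -> act l b u w = act l b u w'.
Proof. by case: l. Qed.

End Act.

Section PointColorings.
Variables (R : realType) (T : Type) (Q : operator_quandle T).
Variables (P : polygon R) (lb : vtx P -> vtx P -> passage T).
Implicit Types (g : vtx P -> R -> Q) (e f : vtx P).

(* Colours of all the points, a crossing point of an edge getting the colour
   with which the edge enters the crossing. *)
Record point_coloring g : Prop := PointColoring {
  pc_left : forall e s, 0 < s <= 1 -> \forall r \near s^'-, g e r = g e s;
  pc_free : forall e s, 0 <= s < 1 -> (forall f t, ~ meet_at e s f t) ->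
    \forall r \near s^'+, g e r = g e s;
  pc_meet : forall e s f t, meet_at e s f t ->
    \forall r \near s^'+,
      g e r = act (lb e f) (0 < det2 (dir e) (dir f)) (g e s) (g f t);
  pc_next : forall e, g (nextv e) 0 = g e 1 }.

Definition same_points g g' := forall e s, 0 <= s <= 1 -> g e s = g' e s.

(** [act] reads the colour of the other edge only at an undercrossing, so at all other points
    agreement propagates by itself. *)
Lemma pc_agree g g' e (a b : R) : point_coloring g -> point_coloring g' ->
  0 <= a -> b <= 1 -> g e a = g' e a ->
  (forall (r : R) f t, a <= r < b -> meet_at e r f t ->
     lb e f <> Under \/ g f t = g' f t) ->
  forall s, a <= s <= b -> g e s = g' e s.
Proof.
move=> pg pg' a0 b1 ga H; apply: real_ind => // [s /andP[as_ sb] IH|s /andP[as_ sb] IH].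
  have gs : g e s = g' e s by apply: IH; rewrite as_ lexx.
  have [[f [t m]]|nm] := pselect (exists f t, meet_at e s f t).
    have := pc_meet pg m; have := pc_meet pg' m.
    have E : act (lb e f) (0 < det2 (dir e) (dir f)) (g e s) (g f t) =
             act (lb e f) (0 < det2 (dir e) (dir f)) (g' e s) (g' f t).
      rewrite -gs; have [| |->//] := H _ _ _ _ m; first by rewrite as_.
      exact: act_transparent.
    move=> h' h; near=> r; transitivity (act (lb e f) (0 < det2 (dir e) (dir f)) (g e s) (g f t)).
      by near: r.
    by rewrite E; apply/esym; near: r.
  have nm' f t : ~ meet_at e s f t by move=> m; apply: nm; exists f, t.
  have s01 : 0 <= s < 1 by lra.
  have := pc_free pg s01 nm'; have := pc_free pg' s01 nm'.
  move=> h' h; near=> r; transitivity (g e s); first by near: r.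
  by rewrite gs; apply/esym; near: r.
have s01 : 0 < s <= 1 by lra.
have h := pc_left pg e s01; have h' := pc_left pg' e s01.
near s^'- => r; have <- : g e r = g e s by near: r.
have <- : g' e r = g' e s by near: r.
apply: IH; apply/andP; split; last by [].
by near: r; apply: nbhs_left_ge.
Unshelve. all: by end_near. Qed.

Lemma pc_const g e (a b : R) : point_coloring g -> 0 <= a -> b <= 1 ->
  (forall (r : R) f t, a <= r < b -> meet_at e r f t -> lb e f = Over) ->
  forall s, a <= s <= b -> g e s = g e a.
Proof.
move=> pg a0 b1 H; apply: real_ind => // [s /andP[as_ sb] IH|s /andP[as_ sb] IH].
  have gs : g e s = g e a by apply: IH; rewrite as_ lexx.
  rewrite -gs; have [[f [t m]]|nm] := pselect (exists f t, meet_at e s f t).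
    by have := pc_meet pg m; rewrite (H _ _ _ _ m) // as_.
  apply: pc_free => //; first by lra.
  by move=> f t m; apply: nm; exists f, t.
have s01 : 0 < s <= 1 by lra.
have h := pc_left pg e s01; near s^'- => r; have <- : g e r = g e s by near: r.
apply: IH; apply/andP; split; last by [].
by near: r; apply: nbhs_left_ge.
Unshelve. all: by end_near. Qed.

Lemma pc_after g e (a : R) f (t b : R) : point_coloring g -> meet_at e a f t -> a < b -> b <= 1 ->
  (forall (r : R) f' t', a < r < b -> meet_at e r f' t' -> lb e f' = Over) ->
  forall s, a < s <= b -> g e s = act (lb e f) (0 < det2 (dir e) (dir f)) (g e a) (g f t).
Proof.
move=> pg m ab b1 H s /andP[as_ sb].
have h := pc_meet pg m; near a^'+ => r.
have <- : g e r = act (lb e f) (0 < det2 (dir e) (dir f)) (g e a) (g f t) by near: r.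
have ar : a < r by [].
have rs : r < s by near: r; apply: nbhs_right_lt.
have a0 : 0 <= a by case: m => _ /andP[].
apply: (pc_const pg _ b1); rewrite ?(ltW rs) ?sb ?(le_trans a0 (ltW ar)) //.
by move=> r' f' t' r'b; apply: H; lra.
Unshelve. all: by end_near. Qed.

End PointColorings.

Section ArcColorings.
Variables (R : realType) (T : Type) (Q : operator_quandle T) (D : diagram R T).
Implicit Types (A B C : arcs D) (x y : vtx D * R) (c : arcs D -> Q).

Let gD : generic D := (diagramP D).1.

Lemma lab_mirror (e : vtx D) s f t : meet_at e s f t -> lab f e = mirror (lab e f).
Proof. by move=> m; apply: (diagramP D).2; exists s, t. Qed.

Lemma run_on_arc x y : clos_refl_sym_trans _ (@run R T D) x y -> on_arc D x <-> on_arc D y.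
Proof.
elim=> [{}x {}y [Hx Hy _]|//|{}x {}y _ ->//|{}x {}y z _ -> _ ->//].
by split.
Qed.

Lemma arc_on A x : val A x -> on_arc D x.
Proof. by case: A => a /= /set_mem[y oy <-] /run_on_arc <-. Qed.

Lemma arc_inhabited A : exists x, val A x.
Proof. by case: A => a /= /set_mem[y oy <-]; exists y; apply: rst_refl. Qed.

Lemma arc_eq A B x : val A x -> val B x -> A = B.
Proof.
case: A B => [a ia] [b ib] /= ax bx; apply: val_inj => /=.
case/set_mem: ia ax => y oy <- yx; case/set_mem: ib bx => z oz <- zx.
apply/seteqP; split=> w /= h.
  apply: rst_trans zx _; apply: rst_trans h; exact: rst_sym.
apply: rst_trans yx _; apply: rst_trans h; exact: rst_sym.
Qed.

Lemma arc_run A x y : run x y -> val A x <-> val A y.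
Proof.
case: A => a /= /set_mem[z oz <-] xy; split=> h; apply: rst_trans h _.
  exact: rst_step.
exact/rst_sym/rst_step.
Qed.

Lemma arc_at x : on_arc D x -> exists A, val A x.
Proof.
move=> ox; have ix : arc_of x \in arcs D by apply/mem_set; exists x.
by exists (exist (fun a => a \in arcs D) (arc_of x) ix); apply: rst_refl.
Qed.

Lemma on_arc_free (e : vtx D) s : 0 <= s < 1 -> (forall f t, ~ meet_at e s f t) -> on_arc D (e, s).
Proof. by move=> s01 nm; split=> //= f t /nm. Qed.

Lemma on_arc_vertex (e : vtx D) : on_arc D (e, 0).
Proof.
apply: on_arc_free; first by lra.
by move=> f t /(meet_interior gD)[]; lra.
Qed.

Lemma on_arc_right (e : vtx D) s : 0 <= s < 1 -> \forall r \near s^'+, on_arc D (e, r).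
Proof.
move=> /andP[s0 s1]; have h := no_meet_right gD e s.
near=> r; apply: on_arc_free; last by near: r.
by apply/andP; split; [apply: (le_trans s0); near: r; exact: nbhs_right_ge|near: r;
  exact: nbhs_right_lt].
Unshelve. all: by end_near. Qed.

Lemma on_arc_left (e : vtx D) s : 0 < s <= 1 -> \forall r \near s^'-, on_arc D (e, r).
Proof.
move=> /andP[s0 s1]; have h := no_meet_left gD e s.
near=> r; apply: on_arc_free; last by near: r.
apply/andP; split; first by near: r; exact: nbhs_left_ge.
by apply: lt_le_trans s1; near: r; exact: nbhs_left_lt.
Unshelve. all: by end_near. Qed.

Lemma arc_in_exists (e : vtx D) s : 0 < s <= 1 -> exists A, arc_in (val A) e s.
Proof.
move=> s01; have /near_leftP[d ds Hd] := on_arc_left e s01.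
pose r := (Num.max d 0 + s) / 2.
have [d0 d1] : d <= Num.max d 0 /\ 0 <= Num.max d 0 by rewrite !le_max !lexx orbT.
have dm : Num.max d 0 < s by rewrite gt_max ds; lra.
have [A Ar] : exists A, val A (e, r) by apply/arc_at/Hd; rewrite /r; lra.
exists A, r; split => //; first by rewrite /r; lra.
by move=> q rq; apply: Hd; move: rq; rewrite /r; lra.
Qed.

Lemma arc_in_uniq A B (e : vtx D) s : s <= 1 -> arc_in (val A) e s -> arc_in (val B) e s -> A = B.
Proof.
move=> s1 [a [a0 Aa Ha]] [b [b0 Bb Hb]].
wlog ab : a b A B a0 Aa Ha b0 Bb Hb / a <= b.
  move=> H; have [ab|ba] := leP a b; first exact: (H a b).
  by apply/esym/(H b a) => //; exact: ltW.
apply: arc_eq Bb; apply: (iffLR (arc_run _ _)) Aa; split.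
- by apply: Ha; lra.
- by apply: Hb; lra.
- by left; split=> //= r rab; apply: Ha; lra.
Qed.

Lemma arc_in_on A (e : vtx D) s : on_arc D (e, s) -> arc_in (val A) e s -> val A (e, s).
Proof.
move=> os [a [a0 Aa Ha]]; apply: (iffLR (arc_run _ _)) Aa; split=> //.
  by apply: Ha; lra.
left; split=> /=; [by []|by lra|move=> r /andP[ar]].
rewrite le_eqVlt => /orP[/eqP -> //|rs].
by apply: Ha; rewrite ar.
Qed.

Definition represents c (g : vtx D -> R -> Q) := forall A e s, val A (e, s) -> c A = g e s.

(** Along a [run] every crossing is an overcrossing, so a point colouring is constant there and
    descends to the arcs. *)
Lemma represents_col g : point_coloring (@lab R T D) g -> exists2 c, Col D Q c & represents c g.
Proof.
move=> pg.
have run_g x y : run x y -> g x.1 x.2 = g y.1 y.2.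
  case: x y => [e s] [f t] [] [] /= /andP[s0 s1] _ [] /= /andP[t0 t1] _ [[<- st H]|[[-> ->] H]].
    apply/esym/(pc_const pg s0 (ltW t1)); last by rewrite st lexx.
    by move=> r h u rst m; have [|_ /(_ _ _ m)] := H r; first by lra.
  rewrite (pc_next pg); apply/esym/(pc_const pg s0 (lexx _)); last by rewrite (ltW s1) lexx.
  by move=> r h u rst m; have [|_ /(_ _ _ m)] := H r; first by lra.
have rst_g x y : clos_refl_sym_trans _ (@run R T D) x y -> g x.1 x.2 = g y.1 y.2.
  elim=> [|//|{}x {}y _ ->//|{}x {}y z _ -> _ ->//]; exact: run_g.
have /choice[c Hc] : forall A, exists v, forall x, val A x -> v = g x.1 x.2.
  move=> A; have [[e s] Ax] := arc_inhabited A; exists (g e s) => -[f t].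
  case: A Ax => a /= /set_mem[z oz <-] h h'.
  by rewrite -(rst_g _ _ h) -(rst_g _ _ h').
have rep : represents c g by move=> A e s /Hc.
exists c => //.
have c_in A e s : s <= 1 -> arc_in (val A) e s -> c A = g e s.
  move=> s1 [a [/andP[a0 sa] Aa Ha]]; rewrite (rep _ _ _ Aa); apply/esym.
  apply: (pc_const pg a0 s1); last by rewrite ltW //= lexx.
  by move=> r h u rst m; have [|_ /(_ _ _ m)] := Ha r; first by lra.
have c_out A e s f t : meet_at e s f t -> arc_out (val A) e s ->
    c A = act (lab e f) (0 < det2 (dir e) (dir f)) (g e s) (g f t).
  move=> m [a [/andP[a0 sa] Aa Ha]]; rewrite (rep _ _ _ Aa).
  apply: (pc_after pg m a0 (ltW sa)); last by rewrite a0 /=.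
  by move=> r h u rst m'; have [|_ /(_ _ _ m')] := Ha r; first by lra.
move=> e s f t m d0; have m' := meet_sym m; have lm := lab_mirror m.
have [/andP[s0 s1] /andP[t0 t1] _] := meet_interior gD m.
have d0' : 0 < det2 (dir f) (dir e) = false by apply/negbTE; move: d0; rewrite /det2; lra.
case E : (lab e f) => [| |al].
- move=> A B C Ai Bo Cs; rewrite (c_out _ _ _ _ _ m' Bo) (c_in _ _ _ (ltW t1) Ai) (rep _ _ _ Cs).
  by rewrite lm E /= d0'.
- move=> A B C Ai Bo Cs; rewrite (c_out _ _ _ _ _ m Bo) (c_in _ _ _ (ltW s1) Ai) (rep _ _ _ Cs).
  by rewrite E /= d0.
- split=> A B Ai Bo.
    by rewrite (c_out _ _ _ _ _ m' Bo) (c_in _ _ _ (ltW t1) Ai) lm E /= d0'.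
  by rewrite (c_out _ _ _ _ _ m Bo) (c_in _ _ _ (ltW s1) Ai) E /= d0.
Qed.

(** A point takes the colour of the arc that reaches it from the left. This also colours the
    crossing points that lie on no arc, with the incoming colour. *)
Lemma col_represents c : Col D Q c -> exists2 g, point_coloring (@lab R T D) g & represents c g.
Proof.
move=> colc.
(* The clauses complement each other: at parameter 0 no arc arrives within the edge, and an
   undercrossing or virtual crossing lies on no arc. Where both apply they name the same arc, by
   [arc_in_on]. *)
pose good (x : vtx D * R) A := (on_arc D x -> val A x) /\ (0 < x.2 <= 1 -> arc_in (val A) x.1 x.2).
have /choice[G HG] : forall x, exists A, good x A.
  case=> e s; have [s01|ns] := boolP (0 < s <= 1).
    have [A Ai] := arc_in_exists e s01; exists A; split=> //= os.
    exact: arc_in_on Ai.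
  have [os|nos] := pselect (on_arc D (e, s)).
    have [A As] := arc_at os; exists A; split=> //= s01.
    by rewrite s01 in ns.
  have [A _] := arc_at (on_arc_vertex e); exists A; split=> //= s01.
  by rewrite s01 in ns.
pose g e s := c (G (e, s)).
have rep : represents c g.
  move=> A e s As; have os := arc_on As; congr c; apply: arc_eq As _.
  exact: (HG (e, s)).1.
have g_in A e s : 0 < s <= 1 -> arc_in (val A) e s -> g e s = c A.
  move=> s01 Ai; congr c; have := (HG (e, s)).2 s01; move=> Gi.
  by case/andP: s01 => _ s1; exact: (arc_in_uniq s1 Gi Ai).
have near_out e s : 0 <= s < 1 -> exists2 A, arc_out (val A) e s & \forall r \near s^'+,
  g e r = c A.
  move=> s01; have /near_rightP[d ds Hd] := on_arc_right e s01.
  pose d' := Num.min d 1.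
  have [d0 d1] : d' <= d /\ d' <= 1 by rewrite /d' !ge_min !lexx orbT.
  have sd : s < d' by rewrite lt_min ds; lra.
  have [A Ar] : exists A, val A (e, (s + d') / 2) by apply/arc_at/Hd; lra.
  exists A; first by exists ((s + d') / 2); split=> // [|r rs]; [lra|apply: Hd; lra].
  near=> r; have sr : s < r by [].
  have rd : r < (s + d') / 2 by near: r; apply: nbhs_right_lt; lra.
  apply/esym/rep; apply: (iffRL (arc_run _ _)) Ar; split.
  - by apply: Hd; lra.
  - by apply: Hd; lra.
  - by left; split=> //= [|q rq]; [lra|apply: Hd; lra].
exists g => //; split.
- move=> e s s01; have [A Ai] := arc_in_exists e s01.
  rewrite (g_in _ _ _ s01 Ai); case: Ai => a [/andP[a0 as_] Aa Ha].
  near=> r; have ar : a < r by near: r; exact: nbhs_left_gt.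
  have rs : r < s by [].
  apply: g_in; first by lra.
  by exists a; split=> // [|q qr]; [lra|apply: Ha; lra].
- move=> e s s01 nm; have [A [a [/andP[sa a1] Aa Ha]] Hn] := near_out e s s01.
  rewrite (_ : g e s = c A) //; apply/esym/rep; apply: (iffRL (arc_run _ _)) Aa.
  have os := on_arc_free s01 nm.
  split=> //; first by apply: Ha; rewrite sa lexx.
  left; split=> /=; [by []|exact: ltW|move=> r /andP[]].
  rewrite le_eqVlt => /orP[/eqP <- //|sr ra].
  by apply: Ha; rewrite sr.
- move=> e s f t m; have m' := meet_sym m; have lm := lab_mirror m.
  have [s01 t01 d0] := meet_interior gD m.
  have [B Bo Hn] : exists2 A, arc_out (val A) e s & \forall r \near s^'+, g e r = c A.
    by apply: near_out; lra.
  have s01' : 0 < s <= 1 by lra.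
  have [A Ai] := arc_in_exists e s01'.
  rewrite (g_in _ _ _ s01' Ai).
  suff <- : c B = act (lab e f) (0 < det2 (dir e) (dir f)) (c A) (g f t) by [].
  (* At an overcrossing the arc runs through, so the outgoing arc is the incoming one. *)
  have over : on_arc D (e, s) -> c B = c A.
    move=> os; congr c; have := arc_in_on os Ai; case: Bo => b [/andP[sb b1] Bb Hb].
    move=> As; apply: (arc_eq Bb); apply: (iffLR (arc_run _ _)) As; split=> //.
      by apply: Hb; rewrite sb lexx.
    left; split=> /=; [by []|exact: ltW|move=> r /andP[]].
    rewrite le_eqVlt => /orP[/eqP <- //|sr ra].
    by apply: Hb; rewrite sr.
  have [dp|dn] := boolP (0 < det2 (dir e) (dir f)).
    have := colc _ _ _ _ m dp; case E : (lab e f) lm => [| |al] /= lm.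
    + move=> _; apply: over; split=> /= [|f' t' m'']; first by lra.
      by have [<- _] := meet_edge gD m m''.
    + move=> H; have of_ : on_arc D (f, t).
        split=> /= [|f' t' m'']; first by lra.
        by have [<- _] := meet_edge gD m' m''.
      have [C Ct] := arc_at of_; rewrite (H _ _ _ Ai Bo Ct).
      by rewrite (rep _ _ _ Ct).
    + by case=> _ H; apply: H.
  (* [is_coloring] states the rules with the two edges in positive order, so the negative case reads
     the crossing with [f] first. *)
  have dp : 0 < det2 (dir f) (dir e).
    move: dn d0; rewrite -leNgt le_eqVlt => /orP[/eqP ->|]; first by rewrite eqxx.
    by rewrite /det2; lra.
  have := colc _ _ _ _ m' dp; case E : (lab e f) lm => [| |al] /= lm; rewrite lm.
  + move=> _; apply: over; split=> /= [|f' t' m'']; first by lra.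
    by have [<- _] := meet_edge gD m m''.
  + move=> H; have of_ : on_arc D (f, t).
      split=> /= [|f' t' m'']; first by lra.
      by have [<- _] := meet_edge gD m' m''.
    have [C Ct] := arc_at of_; rewrite (H _ _ _ Ai Bo Ct).
    by rewrite (rep _ _ _ Ct).
  + by case=> H _; apply: H.
- move=> e; have o1 : 0 < 1 :> R by lra.
  have [A Ai] : exists A, arc_in (val A) e 1 by apply: arc_in_exists; lra.
  rewrite (g_in _ _ _ _ Ai); last by lra.
  case: Ai => a [/andP[a0 a1] Aa Ha]; apply/esym/rep.
  apply: (iffLR (arc_run _ _)) Aa; split; [by apply: Ha; lra|exact: on_arc_vertex|by right].
Unshelve. all: by end_near. Qed.

(** Points off every arc are limits from the left of points on arcs, so the values on arcs determine
    the others. *)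
Lemma represents_same c g g' : point_coloring (@lab R T D) g -> point_coloring (@lab R T D) g' ->
  represents c g -> represents c g' -> same_points g g'.
Proof.
move=> pg pg' r r'.
have on e s : on_arc D (e, s) -> g e s = g' e s.
  by move=> /arc_at[A As]; rewrite -(r _ _ _ As) -(r' _ _ _ As).
move=> e s /andP[]; rewrite le_eqVlt => /orP[/eqP <- _|s0 s1].
  exact/on/on_arc_vertex.
have s01 : 0 < s <= 1 by rewrite s0.
have h := on_arc_left e s01; have h1 := pc_left pg e s01; have h2 := pc_left pg' e s01.
near s^'- => q; have <- : g e q = g e s by near: q.
have <- : g' e q = g' e s by near: q.
by apply: on; near: q.
Unshelve. all: by end_near. Qed.

Lemma represents_inj c c' g g' : represents c g -> represents c' g' -> same_points g g' -> c = c'.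
Proof.
move=> r r' gg; apply/funext => A; have [[e s] Ax] := arc_inhabited A.
rewrite (r _ _ _ Ax) (r' _ _ _ Ax); apply: gg.
by have [/andP[/= -> /ltW ->]] := arc_on Ax.
Qed.

End ArcColorings.

(** [M] is a relation because a move produces a partner only up to values at irrelevant parameters.
    The third hypothesis makes it single-valued and injective up to [same_points]; choice then gives
    two mutually inverse maps. *)
Lemma col_card_eq (R : realType) (T : Type) (Q : operator_quandle T) (D1 D2 : diagram R T)
    (M : (vtx D1 -> R -> Q) -> (vtx D2 -> R -> Q) -> Prop) :
  (forall g1, point_coloring (@lab R T D1) g1 ->
     exists2 g2, point_coloring (@lab R T D2) g2 & M g1 g2) ->
  (forall g2, point_coloring (@lab R T D2) g2 ->
     exists2 g1, point_coloring (@lab R T D1) g1 & M g1 g2) ->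
  (forall g1 g2 g1' g2',
     point_coloring (@lab R T D1) g1 -> point_coloring (@lab R T D2) g2 ->
     point_coloring (@lab R T D1) g1' -> point_coloring (@lab R T D2) g2' ->
     M g1 g2 -> M g1' g2' -> same_points g1 g1' <-> same_points g2 g2') ->
  (Col D1 Q #= Col D2 Q)%card.
Proof.
move=> M12 M21 Mdet; apply/card_bijP.
pose N (c1 : Col D1 Q) (c2 : Col D2 Q) := exists g1 g2,
  [/\ point_coloring (@lab R T D1) g1, point_coloring (@lab R T D2) g2,
      represents (val c1) g1, represents (val c2) g2 & M g1 g2].
have N1 c1 : exists c2, N c1 c2.
  have [g1 p1 r1] := col_represents (set_mem (valP c1)).
  have [g2 p2 m] := M12 _ p1; have [c2 C2 r2] := represents_col p2.
  by exists (exist (fun c => c \in Col D2 Q) c2 (mem_set C2)), g1, g2.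
have N2 c2 : exists c1, N c1 c2.
  have [g2 p2 r2] := col_represents (set_mem (valP c2)).
  have [g1 p1 m] := M21 _ p2; have [c1 C1 r1] := represents_col p1.
  by exists (exist (fun c => c \in Col D1 Q) c1 (mem_set C1)), g1, g2.
have Ndet c1 c2 c1' c2' : N c1 c2 -> N c1' c2' -> c1 = c1' <-> c2 = c2'.
  case=> g1 [g2 [p1 p2 r1 r2 m]] [g1' [g2' [p1' p2' r1' r2' m']]].
  have D := Mdet _ _ _ _ p1 p2 p1' p2' m m'; split=> E; subst.
    apply/val_inj/(represents_inj r2 r2')/D; exact: represents_same r1 r1'.
  apply/val_inj/(represents_inj r1 r1')/D; exact: represents_same r2 r2'.
have [F HF] := choice N1; have [G HG] := choice N2.
exists F, G => [c1|c2].
  exact: (iffRL (Ndet _ _ _ _ (HG _) (HF _))).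
exact: (iffLR (Ndet _ _ _ _ (HF _) (HG _))).
Qed.

(** * Gauss diagrams and planar isotopy *)

Section OneSidedOrder.
Variable R : realType.
Implicit Types c s : R.

Lemma near_left_lt c s : \forall r \near s^'-, (c < r) = (c < s).
Proof.
have [cs|sc] := ltP c s.
  by near=> r; near: r; exact: nbhs_left_gt.
near=> r; apply/negbTE; rewrite -leNgt; apply: le_trans sc.
by near: r; exact: nbhs_left_le.
Unshelve. all: by end_near. Qed.

Lemma near_right_lt c s : \forall r \near s^'+, (c < r) = (c <= s).
Proof.
have [cs|sc] := leP c s.
  by near=> r; apply: le_lt_trans cs _; near: r; exact: nbhs_right_gt.
by near=> r; apply/negbTE; rewrite -leNgt; near: r; exact: nbhs_right_le.
Unshelve. all: by end_near. Qed.

End OneSidedOrder.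

Section CrossingParameter.
Variables (R : realType) (P : polygon R).
Implicit Types e f : vtx P.

(** Cramer's rule for the common point of the lines of [e] and [f]. Being an explicit formula, it
    varies continuously with the vertices as long as the edges are not parallel. *)
Definition cpar e f : R := det2 (pos f - pos e) (dir f) / det2 (dir e) (dir f).

Lemma pt_cpar e f : det2 (dir e) (dir f) != 0 -> pt e (cpar e f) = pt f (cpar f e).
Proof.
move=> d0; rewrite !ptE /cpar; move: (dir e) (dir f) d0 => [a b] [c d].
rewrite /det2 /= => d0; have d1 : c * b - d * a != 0.
  by apply: contraNN d0 => /eqP h; apply/eqP; lra.
by apply/pair_eqP; split; rewrite /=; field; rewrite d0 d1.
Qed.

Lemma cpar_meet e s f t : generic P -> meet_at e s f t -> s = cpar e f /\ t = cpar f e.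
Proof.
move=> gP m; have [_ _ d0] := meet_interior gP m.
case: m => _ _ _ /pt_eq[]; rewrite /cpar; move: (dir e) (dir f) d0 => [a b] [c d].
rewrite /det2 /= => d0 E1 E2.
have d1 : c * b - d * a != 0 by apply: contraNN d0 => /eqP h; apply/eqP; lra.
have -> : (pos f).1 - (pos e).1 = s * a - t * c by lra.
have -> : (pos f).2 - (pos e).2 = s * b - t * d by lra.
have -> : (pos e).1 - (pos f).1 = t * c - s * a by lra.
have -> : (pos e).2 - (pos f).2 = t * d - s * b by lra.
by split; field.
Qed.

Lemma cross_meet e f : generic P -> cross e f -> meet_at e (cpar e f) f (cpar f e).
Proof. by move=> gP [s [t m]]; have [<- <-] := cpar_meet gP m. Qed.

Lemma cross_sym e f : cross e f -> cross f e.
Proof. by case=> s [t /meet_sym m]; exists t, s. Qed.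

Lemma crossE e f : e != f -> det2 (dir e) (dir f) != 0 ->
  0 <= cpar e f < 1 -> 0 <= cpar f e < 1 -> cross e f.
Proof. by move=> ef d0 s t; exists (cpar e f), (cpar f e); split=> //; apply: pt_cpar. Qed.

End CrossingParameter.

Section GaussEquivalence.
Variables (R : realType) (T : Type).

(** An isomorphism of oriented Gauss diagrams. Carrying the inverse [psi] makes the notion
    symmetric. *)
Record gauss_equiv (D1 D2 : diagram R T) (phi : vtx D1 -> vtx D2) (psi : vtx D2 -> vtx D1) :
    Prop := GaussEquiv {
  ge_K : cancel phi psi;
  ge_VK : cancel psi phi;
  ge_next : forall v, phi (nextv v) = nextv (phi v);
  ge_cross : forall e f, cross e f <-> cross (phi e) (phi f);
  ge_sign : forall e f, cross e f ->
    (0 < det2 (dir e) (dir f)) = (0 < det2 (dir (phi e)) (dir (phi f)));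
  ge_order : forall e f f', cross e f -> cross e f' ->
    (cpar e f < cpar e f') = (cpar (phi e) (phi f) < cpar (phi e) (phi f'));
  ge_lab : forall e f, cross e f -> lab e f = lab (phi e) (phi f) }.

Lemma gauss_equiv_sym D1 D2 phi psi : @gauss_equiv D1 D2 phi psi -> gauss_equiv psi phi.
Proof.
case=> K VK nx cr sg od lb; split=> //.
- by move=> v; rewrite -{1}(VK v) -nx K.
- by move=> e f; rewrite cr !VK.
- by move=> e f; rewrite -{1}(VK e) -{1}(VK f) -cr => /sg ->; rewrite !VK.
- move=> e f f'; rewrite -{1}(VK e) -{1}(VK f) -cr => c1.
  by rewrite -{1}(VK e) -{1}(VK f') -cr => c2; rewrite (od _ _ _ c1 c2) !VK.
- by move=> e f; rewrite -{1}(VK e) -{1}(VK f) -cr => /lb ->; rewrite !VK.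
Qed.

Section Transport.
Variables (Q : operator_quandle T) (D1 D2 : diagram R T).
Variables (phi : vtx D1 -> vtx D2) (psi : vtx D2 -> vtx D1).
Hypothesis ge : gauss_equiv phi psi.

Let g1D := (diagramP D1).1.
Let g2D := (diagramP D2).1.

(** With the strict inequality a crossing point belongs to the interval that it closes, in
    accordance with left-continuous colours. *)
Definition same_place e (s1 s2 : R) := forall f, cross e f ->
  (cpar e f < s1) = (cpar (phi e) (phi f) < s2).

Lemma same_place_exists e (s2 : R) : 0 <= s2 <= 1 ->
  exists2 s1 : R, 0 <= s1 <= 1 & same_place e s1 s2.
Proof.
move=> s201.
pose B f := `[< cross e f >] && ~~ (cpar (phi e) (phi f) < s2).
(* The first crossing on [e] whose image is not before [s2], or the end 1 of the edge if there is
   none. *)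
exists (\big[Num.min/1]_(f | B f) cpar e f).
  rewrite bigmin_le_id andbT; apply/bigmin_geP; split=> // f /andP[/asboolP ef _].
  by have [] := cross_meet g1D ef => _ /andP[].
move=> f ef; have [c2|c2] := ltP (cpar (phi e) (phi f)) s2; last first.
  apply/negbTE; rewrite -leNgt; apply: bigmin_le_cond.
  by rewrite /B -leNgt c2 andbT; apply/asboolP.
apply/bigmin_gtP; split; first by have [] := cross_meet g1D ef => _ /andP[].
move=> f' /andP[/asboolP ef' ns]; rewrite (ge_order ge ef ef').
by move: ns; rewrite -leNgt; apply: lt_le_trans.
Qed.

Definition transported (g1 : vtx D1 -> R -> Q) (g2 : vtx D2 -> R -> Q) :=
  forall e (s1 s2 : R), 0 <= s1 <= 1 -> 0 <= s2 <= 1 -> same_place e s1 s2 ->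
    g1 e s1 = g2 (phi e) s2.

Lemma same_place_const (g1 : vtx D1 -> R ->
  Q) e (s1 s1' s2 : R) : point_coloring (@lab R T D1) g1 ->
  0 <= s1 <= 1 -> 0 <= s1' <= 1 -> same_place e s1 s2 -> same_place e s1' s2 ->
  g1 e s1 = g1 e s1'.
Proof.
move=> pg; wlog ss : s1 s1' / s1 <= s1'.
  move=> H a b c d; have [h|h] := leP s1 s1'; first exact: H.
  by apply/esym/H => //; exact: ltW.
move=> /andP[a0 _] /andP[_ b1] c d; apply/esym.
apply: (pc_const pg a0 b1); last by rewrite ss lexx.
move=> r f t /andP[ar rb] m; have ef : cross e f by exists r, t.
have [rE _] := cpar_meet g1D m; move: (c _ ef) (d _ ef); rewrite -rE rb => <-.
by move=> /esym h; move: ar; rewrite leNgt h.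
Qed.

(** A point of [D2] gets the colour of any point of [D1] at the same place; the choice is immaterial
    because no crossing separates two such points. *)
Lemma transport_exists (g1 : vtx D1 -> R -> Q) : point_coloring (@lab R T D1) g1 ->
  exists2 g2, point_coloring (@lab R T D2) g2 & transported g1 g2.
Proof.
move=> pg.
have /choice[st Hst] : forall x : vtx D2 * R, exists s1 : R,
    0 <= x.2 <= 1 -> 0 <= s1 <= 1 /\ same_place (psi x.1) s1 x.2.
  case=> e s; have [h|h] := boolP (0 <= s <= 1); last by exists 0 => /= h'; case/negP: h.
  by have [s1 a b] := same_place_exists (psi e) h; exists s1.
pose g2 e s := g1 (psi e) (st (e, s)).
have tr : transported g1 g2.
  move=> e s1 s2 a b c; have [] := Hst (phi e, s2) b; rewrite /g2 /= (ge_K ge) => d h.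
  exact: same_place_const c h.
have tr2 e (s1 s2 : R) : 0 <= s1 <= 1 -> 0 <= s2 <= 1 -> same_place (psi e) s1 s2 ->
  g2 e s2 = g1 (psi e) s1.
  by move=> a b c; rewrite (tr _ _ _ a b c) (ge_VK ge).
have cr e f : cross (psi e) f -> cross e (phi f).
  by rewrite (ge_cross ge) (ge_VK ge).
exists g2 => //; split.
- move=> e s s01.
  have [s1 a b] : exists2 s1 : R, 0 <= s1 <= 1 & same_place (psi e) s1 s.
    by apply: same_place_exists; lra.
  rewrite (tr2 _ _ _ a _ b); last by lra.
  have h : \forall r \near s^'-, same_place (psi e) s1 r.
    apply: filter_forall => f.
    have h := near_left_lt (cpar (phi (psi e)) (phi f)) s.
    by near=> r => ef; rewrite (b _ ef); apply/esym; near: r.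
  have [s0 s1'] : 0 < s /\ s <= 1 by lra.
  near=> r; apply: tr2 => //; last by near: r.
  apply/andP; split; first by near: r; exact: nbhs_left_ge.
  by apply: le_trans s1'; near: r; exact: nbhs_left_le.
- move=> e s s01 nm.
  have [s1 a b] : exists2 s1 : R, 0 <= s1 <= 1 & same_place (psi e) s1 s.
    by apply: same_place_exists; lra.
  rewrite (tr2 _ _ _ a _ b); last by lra.
  have h : \forall r \near s^'+, same_place (psi e) s1 r.
    apply: filter_forall => f.
    have h := near_right_lt (cpar (phi (psi e)) (phi f)) s.
    near=> r => ef; rewrite (b _ ef).
    have -> : (cpar (phi (psi e)) (phi f) < r) = (cpar (phi (psi e)) (phi f) <= s) by near: r.
    rewrite le_eqVlt; case: eqP => //= cs; case: (nm (phi f) (cpar (phi f) e)).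
    by rewrite -cs (ge_VK ge); apply/(cross_meet g2D)/cr.
  have [s0 s1'] : 0 <= s /\ s < 1 by lra.
  near=> r; apply: tr2 => //; last by near: r.
  apply/andP; split; last by near: r; exact: nbhs_right_le.
  by apply: le_trans s0 _; near: r; exact: nbhs_right_ge.
- move=> e s f t m; have [sE tE] := cpar_meet g2D m.
  have ef : cross (psi e) (psi f) by rewrite (ge_cross ge) !(ge_VK ge); exists s, t.
  have m1 := cross_meet g1D ef.
  have [s01 t01 _] := meet_interior g2D m.
  have [c01 d01 _] := meet_interior g1D m1.
  have pe : same_place (psi e) (cpar (psi e) (psi f)) s.
    by move=> f' ef'; rewrite (ge_order ge ef' ef) !(ge_VK ge) -sE.
  have pf : same_place (psi f) (cpar (psi f) (psi e)) t.
    by move=> f' ef'; rewrite (ge_order ge ef' (cross_sym ef)) !(ge_VK ge) -tE.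
  rewrite (tr2 _ _ _ _ _ pe); [|lra|lra].
  rewrite (tr2 _ _ _ _ _ pf); [|lra|lra].
  have := ge_sign ge ef; rewrite !(ge_VK ge) => <-.
  have := ge_lab ge ef; rewrite !(ge_VK ge) => <-.
  have Hm := pc_meet pg m1; set c := cpar (psi e) (psi f) in pe c01 Hm m1 *.
  have h1 : \forall q \near c^'+, forall f', (cpar (psi e) f' < q) = (cpar (psi e) f' <= c).
    by apply: filter_forall => f'; exact: near_right_lt.
  have [c0 c1] : 0 <= c /\ c < 1 by lra.
  (* A point [q] just after the crossing of [D1] has the same place as the points just after the
     crossing of [D2], so the jump is carried over as a whole. *)
  near c^'+ => q.
  have <- : g1 (psi e) q = act (lab (psi e) (psi f))
     (0 < det2 (dir (psi e)) (dir (psi f))) (g1 (psi e) c) (g1 (psi f) (cpar (psi f) (psi e))).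
    by near: q.
  have Hq : forall f', (cpar (psi e) f' < q) = (cpar (psi e) f' <= c) by near: q.
  have h : \forall r \near s^'+, same_place (psi e) q r.
    apply: filter_forall => f'.
    have h := near_right_lt (cpar (phi (psi e)) (phi f')) s.
    near=> r => ef'; rewrite Hq.
    have -> : (cpar (phi (psi e)) (phi f') < r) = (cpar (phi (psi e)) (phi f') <= s) by near: r.
    by rewrite !leNgt (ge_order ge ef ef') !(ge_VK ge) -sE.
  have [s0 s1'] : 0 <= s /\ s < 1 by lra.
  have q01 : 0 <= q <= 1.
    apply/andP; split; last by near: q; exact: nbhs_right_le.
    by apply: le_trans c0 _; near: q; exact: nbhs_right_ge.
  near=> r; apply: tr2 => //; last by near: r.
  apply/andP; split; last by near: r; exact: nbhs_right_le.
  by apply: le_trans s0 _; near: r; exact: nbhs_right_ge.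
- move=> e.
  have -> : g2 (nextv e) 0 = g1 (psi (nextv e)) 0.
    apply: tr2; try lra.
    move=> f ef; rewrite !ltNge.
    have [_ /andP[-> _] _ _] := cross_meet g1D ef.
    have := cross_meet g2D (iffLR (ge_cross ge _ _) ef).
    by case=> _ /andP[-> _].
  have -> : g2 e 1 = g1 (psi e) 1.
    apply: tr2; try lra.
    move=> f ef.
    have [_ /andP[_ ->] _ _] := cross_meet g1D ef.
    have := cross_meet g2D (iffLR (ge_cross ge _ _) ef).
    by case=> _ /andP[_ ->].
  by rewrite -(pc_next pg) (ge_next (gauss_equiv_sym ge)).
Unshelve. all: by end_near. Qed.

End Transport.

Lemma gauss_equiv_card (Q : operator_quandle T) D1 D2 phi psi : @gauss_equiv D1 D2 phi psi ->
  (Col D1 Q #= Col D2 Q)%card.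
Proof.
move=> ge; have ge' := gauss_equiv_sym ge.
have sp e s1 s2 : same_place phi e s1 s2 <-> same_place psi (phi e) s2 s1.
  split=> h f ef.
    by move: (h (psi f)); rewrite (ge_cross ge) (ge_VK ge) (ge_K ge) => /(_ ef) ->.
  by move: (h (phi f)); rewrite -(ge_cross ge) !(ge_K ge) => /(_ ef) ->.
apply: (@col_card_eq _ _ _ _ _ (transported phi)) => [g1|g2 p2|].
- exact: (transport_exists ge).
- have [g1 p1 tr] := transport_exists ge' p2; exists g1 => // e s1 s2 a b c.
  by rewrite (tr (phi e) s2 s1) ?(ge_K ge) //; apply/sp.
move=> g1 g2 g1' g2' p1 p2 p1' p2' t t'; split=> h e s s01.
  have [s1 a b] := same_place_exists ge (psi e) s01.
  by rewrite -(ge_VK ge e) -(t _ _ _ a s01 b) -(t' _ _ _ a s01 b) h.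
have [s2 a b] := same_place_exists ge' (phi e) s01; move/sp: b => b.
by rewrite (t _ _ _ s01 a b) (t' _ _ _ s01 a b) h.
Qed.

End GaussEquivalence.

(** * Crossings of a moving polygon *)

Section MovingPolygon.
Variables (R : realType) (V : finType) (nx : V -> V) (nx_inj : injective nx).
Variable p : R -> V -> R * R.
Hypothesis p_cont : forall v, {within `[0, 1], continuous (fun t => p t v)}.

Definition moving (t : R) : polygon R := Polygon nx_inj (p t).

Hypothesis p_gen : forall t : R, 0 <= t <= 1 -> generic (moving t).

Implicit Types e f v : V.

Local Notation crosst t e f := (@cross R (moving t) e f).
Local Notation dirt t e := (@dir R (moving t) e).
Local Notation cpart t e f := (@cpar R (moving t) e f).

Definition same_crossing (t t' : R) e f :=
  [/\ crosst t e f <-> crosst t' e f,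
      crosst t e f -> (0 < det2 (dirt t e) (dirt t f)) = (0 < det2 (dirt t' e) (dirt t' f)) &
      forall f', crosst t e f -> crosst t e f' ->
        (cpart t e f < cpart t e f') = (cpart t' e f < cpart t' e f')].

Definition same_crossings t t' := forall e f, same_crossing t t' e f.

Section LocallyConstant.
Variable t0 : R.
Hypothesis t01 : 0 <= t0 <= 1.

Local Notation F0 := (within `[0%R, 1%R]%classic (nbhs t0)).

Let cx v : (p t v).1 @[t --> F0] --> (p t0 v).1.
Proof.
have /subspace_continuousP/(_ t0) := @p_cont v; rewrite /= in_itv /= => /(_ t01) h.
exact: (cvg_comp _ _ h (@cvg_fst _ _ _ _ _)).
Qed.

Let cy v : (p t v).2 @[t --> F0] --> (p t0 v).2.
Proof.
have /subspace_continuousP/(_ t0) := @p_cont v; rewrite /= in_itv /= => /(_ t01) h.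
exact: (cvg_comp _ _ h (@cvg_snd _ _ _ _ _)).
Qed.

Let cdir1 e : (dirt t e).1 @[t --> F0] --> (dirt t0 e).1.
Proof.
exact: (@cvgB _ _ _ _ _ (fun t => (p t (nx e)).1) (fun t => (p t e).1) _ _ (@cx _) (@cx _)).
Qed.

Let cdir2 e : (dirt t e).2 @[t --> F0] --> (dirt t0 e).2.
Proof.
exact: (@cvgB _ _ _ _ _ (fun t => (p t (nx e)).2) (fun t => (p t e).2) _ _ (@cy _) (@cy _)).
Qed.

Let cdet e f : det2 (dirt t e) (dirt t f) @[t --> F0] --> det2 (dirt t0 e) (dirt t0 f).
Proof.
exact: (@cvgB _ _ _ _ _ (fun t => (dirt t e).1 * (dirt t f).2) (fun t => (dirt t e).2 * (dirt t
  f).1)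
  _ _ (cvgM (@cdir1 _) (@cdir2 _)) (cvgM (@cdir2 _) (@cdir1 _))).
Qed.

Let ccpar e f : det2 (dirt t0 e) (dirt t0 f) != 0 -> cpart t e f @[t --> F0] --> cpart t0 e f.
Proof.
move=> d0.
have h1 : (p t f).1 - (p t e).1 @[t --> F0] --> (p t0 f).1 - (p t0 e).1.
  exact: (@cvgB _ _ _ _ _ (fun t => (p t f).1) (fun t => (p t e).1) _ _ (@cx _) (@cx _)).
have h2 : (p t f).2 - (p t e).2 @[t --> F0] --> (p t0 f).2 - (p t0 e).2.
  exact: (@cvgB _ _ _ _ _ (fun t => (p t f).2) (fun t => (p t e).2) _ _ (@cy _) (@cy _)).
apply: cvgM (cvgV d0 (@cdet e f)).
exact: (@cvgB _ _ _ _ _ (fun t => ((p t f).1 - (p t e).1) * (dirt t f).2)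
  (fun t => ((p t f).2 - (p t e).2) * (dirt t f).1) _ _ (cvgM h1 (@cdir2 _)) (cvgM h2 (@cdir1 _))).
Qed.

Let ngt (u : R -> R) (l z : R) : u @ F0 --> l -> z < l -> \forall t \near F0, z < u t.
Proof. by move=> c zl; apply: (cvgr_gt l c). Qed.

Let nlt (u : R -> R) (l z : R) : u @ F0 --> l -> l < z -> \forall t \near F0, u t < z.
Proof. by move=> c zl; apply: (cvgr_lt l c). Qed.

(** A crossing is transverse and strictly inside both edges, and these are open conditions on the
    vertices. *)
Lemma near_cross e f : crosst t0 e f -> \forall t \near F0, crosst t e f /\
  (0 < det2 (dirt t0 e) (dirt t0 f)) = (0 < det2 (dirt t e) (dirt t f)).
Proof.
move=> ef; have m := cross_meet (p_gen t01) ef.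
have [/andP[s0 s1] /andP[u0 u1] d0] := meet_interior (p_gen t01) m.
have d0' : det2 (dirt t0 f) (dirt t0 e) != 0.
  by apply: contraNN d0 => /eqP; rewrite /det2 => h; apply/eqP; lra.
have ne : e != f by case: m.
have sg : \forall t \near F0, det2 (dirt t e) (dirt t f) != 0 /\
    (0 < det2 (dirt t0 e) (dirt t0 f)) = (0 < det2 (dirt t e) (dirt t f)).
  have [dp|dn] := ltP 0 (det2 (dirt t0 e) (dirt t0 f)).
    have h := ngt (@cdet e f) dp.
    near=> t; have ht : 0 < det2 (dirt t e) (dirt t f) by near: t.
    by rewrite ht; split=> //; rewrite gt_eqF.
  have {}dn : det2 (dirt t0 e) (dirt t0 f) < 0 by rewrite lt_neqAle d0.
  have h := nlt (@cdet e f) dn.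
  near=> t; have ht : det2 (dirt t e) (dirt t f) < 0 by near: t.
  by rewrite lt_eqF // (lt_gtF ht).
have h1 := ngt (@ccpar _ _ d0) s0; have h2 := nlt (@ccpar _ _ d0) s1.
have h3 := ngt (@ccpar _ _ d0') u0; have h4 := nlt (@ccpar _ _ d0') u1.
near=> t; have [dt st] : det2 (dirt t e) (dirt t f) != 0 /\
    (0 < det2 (dirt t0 e) (dirt t0 f)) = (0 < det2 (dirt t e) (dirt t f)) by near: t; exact: sg.
have q1 : 0 < cpart t e f by near: t.
have q2 : cpart t e f < 1 by near: t.
have q3 : 0 < cpart t f e by near: t.
have q4 : cpart t f e < 1 by near: t.
by split=> //; apply: crossE => //; rewrite ?(ltW q1) ?(ltW q3).
Unshelve. all: by end_near. Qed.

(** Disjointness of two compact edges is an open condition; edges that share a vertex need a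
    separate argument. *)
Lemma near_not_cross e f : ~ crosst t0 e f -> \forall t \near F0, t \in `[0, 1] -> ~ crosst t e f.
Proof.
move=> nef.
(* Compactness says nothing about consecutive edges, but genericity at time [t] excludes a crossing
   between them. *)
have [->|fe] := eqVneq f (nx e).
  by near=> t; rewrite in_itv /= => /p_gen gt [s [u m]]; apply: (@meet_nextv _ (moving t) gt e s u).
have [->|ef] := eqVneq e (nx f).
  near=> t; rewrite in_itv /= => /p_gen gt [s [u m]].
  by apply: (@meet_nextv _ (moving t) gt f u s); apply: meet_sym.
have [->|ne] := eqVneq e f; first by near=> t => _ [s [u []]]; rewrite eqxx.
(* The parameter 1 is included for compactness. The end of an edge is the point 0 of the next one,
   which genericity keeps off all other edges. *)
have far (s u : R) : 0 <= s <= 1 -> 0 <= u <= 1 ->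
    @pt _ (moving t0) e s <> @pt _ (moving t0) f u.
  have g0 := (p_gen t01).1.
  move=> /andP[s0]; rewrite le_eqVlt => /orP[/eqP -> |s1] /andP[u0];
    rewrite le_eqVlt => /orP[/eqP -> |u1].
  - rewrite !pt1 => h; have [] := g0 (nx e) (nx f) 0 0; rewrite ?lexx ?ltr01 ?ltxx //.
    + by rewrite !pt0.
    + by case=> /nx_inj/eqP; rewrite (negbTE ne).
    + by case.
  - rewrite pt1 => h; have [] := g0 (nx e) f 0 u; rewrite ?lexx ?ltr01 ?ltxx ?u0 //.
    + by rewrite pt0.
    + by case=> E; rewrite E eqxx in fe.
    + by case.
  - rewrite pt1 => h; have [] := g0 e (nx f) s 0; rewrite ?lexx ?ltr01 ?ltxx ?s0 //.
    + by rewrite pt0.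
    + by case=> E; rewrite E eqxx in ef.
    + by case.
  - by move=> h; apply: nef; exists s, u; split; rewrite ?s0 ?u0.
have K : compact (`[0%R, 1%R]%classic `*` `[0%R, 1%R]%classic : set (R * R)).
  by apply: compact_setX; apply: segment_compact.
(* Compactness of the square gives one neighbourhood of [t0] for all pairs of parameters. *)
move/compact_near_coveringP: K.
move=> /(_ R F0 (fun t x => @pt _ (moving t) e x.1 <> @pt _ (moving t) f x.2)) H.
have {H} h : \forall t \near F0, (`[0%R, 1%R]%classic `*` `[0%R, 1%R]%classic : set (R * R)) `<=`
    (fun x => @pt _ (moving t) e x.1 <> @pt _ (moving t) f x.2).
  apply: H => -[s u] [/=]; rewrite !in_itv /= => s01 u01.
  pose G := filter_prod (nbhs ((s, u) : R * R)) F0.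
  have cs : z.1.1 @[z --> G] --> s by apply: (cvg_comp _ _ cvg_fst); exact: cvg_fst.
  have cu : z.1.2 @[z --> G] --> u by apply: (cvg_comp _ _ cvg_fst); exact: cvg_snd.
  have cG (w : R -> R) (l : R) : w @ F0 --> l -> w z.2 @[z --> G] --> l.
    by move=> c; apply: (cvg_comp _ _ cvg_snd); exact: c.
  have near_ne (w : R * R * R -> R) (l : R) : w @ G --> l -> l != 0 -> \forall z \near G, w z != 0.
    by move=> c l0; apply: (cvgr_neq0 l c).
  have ne1 : ((p t0 e).1 + s * (dirt t0 e).1) - ((p t0 f).1 + u * (dirt t0 f).1) != 0 \/
             ((p t0 e).2 + s * (dirt t0 e).2) - ((p t0 f).2 + u * (dirt t0 f).2) != 0.
    apply/orP; rewrite -negb_and; apply/negP => /andP[/eqP E1 /eqP E2].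
    apply: (far s u s01 u01); rewrite !ptE; apply/pair_eqP; split.
      by apply/eqP; rewrite -subr_eq0; apply/eqP; exact: E1.
    by apply/eqP; rewrite -subr_eq0; apply/eqP; exact: E2.
  case: ne1 => l0; have hn w c := near_ne w _ c l0.
    have c : ((p z.2 e).1 + z.1.1 * (dirt z.2 e).1) - ((p z.2 f).1 + z.1.2 * (dirt z.2 f).1) @[z
      --> G]
        --> ((p t0 e).1 + s * (dirt t0 e).1) - ((p t0 f).1 + u * (dirt t0 f).1).
      exact: (@cvgB _ _ _ _ _ (fun z : R * R * R => (p z.2 e).1 + z.1.1 * (dirt z.2 e).1)
        (fun z => (p z.2 f).1 + z.1.2 * (dirt z.2 f).1) _ _
        (@cvgD _ _ _ _ _ (fun z : R * R * R => (p z.2 e).1) (fun z => z.1.1 * (dirt z.2 e).1) _ _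
          (cG (fun t => (p t e).1) _ (@cx e)) (@cvgM _ _ _ _ (fun z : R * R * R => z.1.1) (fun z =>
            (dirt z.2 e).1) _ _ cs (cG (fun t => (dirt t e).1) _ (@cdir1 e))))
        (@cvgD _ _ _ _ _ (fun z : R * R * R => (p z.2 f).1) (fun z => z.1.2 * (dirt z.2 f).1) _ _
          (cG (fun t => (p t f).1) _ (@cx f)) (@cvgM _ _ _ _ (fun z : R * R * R => z.1.2) (fun z =>
            (dirt z.2 f).1) _ _ cu (cG (fun t => (dirt t f).1) _ (@cdir1 f))))).
    apply: filterS (hn _ c) => -[[s' u'] t] /= /eqP z0 /pt_eq[E1 E2]; apply: z0.
    by apply/eqP; rewrite subr_eq0; apply/eqP; exact: E1.
  have c : ((p z.2 e).2 + z.1.1 * (dirt z.2 e).2) - ((p z.2 f).2 + z.1.2 * (dirt z.2 f).2) @[z -->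
    G]
        --> ((p t0 e).2 + s * (dirt t0 e).2) - ((p t0 f).2 + u * (dirt t0 f).2).
      exact: (@cvgB _ _ _ _ _ (fun z : R * R * R => (p z.2 e).2 + z.1.1 * (dirt z.2 e).2)
        (fun z => (p z.2 f).2 + z.1.2 * (dirt z.2 f).2) _ _
        (@cvgD _ _ _ _ _ (fun z : R * R * R => (p z.2 e).2) (fun z => z.1.1 * (dirt z.2 e).2) _ _
          (cG (fun t => (p t e).2) _ (@cy e)) (@cvgM _ _ _ _ (fun z : R * R * R => z.1.1) (fun z =>
            (dirt z.2 e).2) _ _ cs (cG (fun t => (dirt t e).2) _ (@cdir2 e))))
        (@cvgD _ _ _ _ _ (fun z : R * R * R => (p z.2 f).2) (fun z => z.1.2 * (dirt z.2 f).2) _ _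
          (cG (fun t => (p t f).2) _ (@cy f)) (@cvgM _ _ _ _ (fun z : R * R * R => z.1.2) (fun z =>
            (dirt z.2 f).2) _ _ cu (cG (fun t => (dirt t f).2) _ (@cdir2 f))))).
    apply: filterS (hn _ c) => -[[s' u'] t] /= /eqP z0 /pt_eq[E1 E2]; apply: z0.
    by apply/eqP; rewrite subr_eq0; apply/eqP; exact: E2.
near=> t => t01' [s [u [_ s01 u01 su]]].
have ht : (`[0%R, 1%R]%classic `*` `[0%R, 1%R]%classic : set (R * R)) `<=`
    (fun x => @pt _ (moving t) e x.1 <> @pt _ (moving t) f x.2) by near: t; exact: h.
by apply: (ht (s, u) _ su); rewrite /= !in_itv /=; split; lra.
Unshelve. all: by end_near. Qed.

Lemma near_same_crossings : \forall t \near F0, t \in `[0, 1] -> same_crossings t0 t.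
Proof.
apply: (@filterS _ F0 _ (fun t => forall e f, t \in `[0, 1] -> same_crossing t0 t e f)).
  by move=> t h t01' e f; apply: h.
apply: (@filter_forall R V (fun e t => forall f, t \in `[0, 1] -> same_crossing t0 t e f) F0) => e.
apply: (@filter_forall R V (fun f t => t \in `[0, 1] -> same_crossing t0 t e f) F0) => f.
have [ef|nef] := pselect (crosst t0 e f); last first.
  have h := near_not_cross nef; near=> t => t01'.
  have nt : ~ crosst t e f by move: t01'; near: t; exact: h.
  by split=> // [|f' /nef//]; split=> [/nef|/nt].
have h := near_cross ef.
have ho : \forall t \near F0, forall f', crosst t0 e f' ->
    (cpart t0 e f < cpart t0 e f') = (cpart t e f < cpart t e f').
  apply: filter_forall => f'.
  have [ef'|nef'] := pselect (crosst t0 e f'); last by near=> t => /nef'.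
  have m := cross_meet (p_gen t01) ef; have m' := cross_meet (p_gen t01) ef'.
  have [_ _ d0] := meet_interior (p_gen t01) m.
  have [_ _ d0'] := meet_interior (p_gen t01) m'.
  have cB : cpart t e f - cpart t e f' @[t --> F0] --> cpart t0 e f - cpart t0 e f'.
    exact: (@cvgB _ _ _ _ _ (fun t => cpart t e f) (fun t => cpart t e f')
      _ _ (@ccpar _ _ d0) (@ccpar _ _ d0')).
  have [cc|cc|cc] := ltgtP (cpart t0 e f) (cpart t0 e f').
  - have hn : \forall t \near F0, cpart t e f - cpart t e f' < 0 by apply: (nlt cB); lra.
    near=> t => _.
    have : cpart t e f - cpart t e f' < 0 by near: t; exact: hn.
    lra.
  - have hn : \forall t \near F0, 0 < cpart t e f - cpart t e f' by apply: (ngt cB); lra.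
    near=> t => _.
    have : 0 < cpart t e f - cpart t e f' by near: t; exact: hn.
    lra.
  (* Equal parameters mean a common crossing point on [e], hence the same partner. *)
  - have [ff _] := meet_edge (p_gen t01) m (eq_ind_r (fun c => @meet_at R (moving t0) e c f' (cpart
      t0 f' e)) m' cc).
    by near=> t => _; rewrite ff ltxx.
near=> t => _; have [c1 c2] : crosst t e f /\
  (0 < det2 (dirt t0 e) (dirt t0 f)) = (0 < det2 (dirt t e) (dirt t f)) by near: t; exact: h.
have oo : forall f', crosst t0 e f' ->
    (cpart t0 e f < cpart t0 e f') = (cpart t e f < cpart t e f') by near: t; exact: ho.
by split=> // f' _; exact: oo.
Unshelve. all: by end_near. Qed.

End LocallyConstant.

Lemma same_crossings_sym t t' : same_crossings t t' -> same_crossings t' t.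
Proof.
move=> h e f; have [c sg od] := h e f; split=> [|/c/sg//|f' /c cf]; first by split=> /c.
by have [c' _ _] := h e f'; move=> /c' cf'; rewrite od.
Qed.

Lemma same_crossings_trans t1 t2 t3 :
  same_crossings t1 t2 -> same_crossings t2 t3 -> same_crossings t1 t3.
Proof.
move=> h h' e f; have [c sg od] := h e f; have [c' sg' od'] := h' e f.
split=> [|cf|f' cf cf']; first by rewrite c.
  by rewrite sg // sg' //; apply/c.
by rewrite od // od' //; [apply/c|have [c'' _ _] := h e f'; apply/c''].
Qed.

(** The crossing data are locally constant in time by [near_same_crossings]; real induction plays
    the part of the connectedness of [[0, 1]]. *)
Lemma moving_same_crossings : same_crossings 0 1.
Proof.
have o01 : 0 <= 1 :> R by [].
suff : forall t : R, 0 <= t <= 1 -> same_crossings 0 t by apply; rewrite lexx o01.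
apply: real_ind => [|s /andP[s0 s1] IH|s /andP[s0 s1] IH].
- by move=> e f; split.
- have := near_same_crossings (_ : 0 <= s <= 1); rewrite s0 (ltW s1) => /(_ isT).
  rewrite near_withinE => h.
  have : \forall r \near s^'+, `[0%R, 1%R]%classic r -> r \in `[0, 1] -> same_crossings s r.
    exact: (@cvg_within _ (nbhs s) _ _ _ h).
  move=> {}h; near=> r; apply: (@same_crossings_trans _ s); first by apply: IH; rewrite s0 lexx.
  have r01 : r \in `[0, 1].
    rewrite in_itv /=; apply/andP; split; last by near: r; exact: nbhs_right_le.
    by apply: le_trans s0 _; near: r; exact: nbhs_right_ge.
  have : `[0%R, 1%R]%classic r -> r \in `[0, 1] -> same_crossings s r by near: r.
  by apply.
- have := near_same_crossings (_ : 0 <= s <= 1); rewrite s1 (ltW s0) => /(_ isT).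
  rewrite near_withinE => h.
  have {}h : \forall r \near s^'-, `[0%R, 1%R]%classic r -> r \in `[0, 1] -> same_crossings s r.
    exact: (@cvg_within _ (nbhs s) _ _ _ h).
  near s^'- => r; have r0 : 0 <= r by near: r; exact: nbhs_left_ge.
  have rs : r < s by [].
  apply: (@same_crossings_trans _ r); first by apply: IH; rewrite r0.
  have r01 : r \in `[0, 1] by rewrite in_itv /= r0 (le_trans (ltW rs)).
  apply: same_crossings_sym.
  have : `[0%R, 1%R]%classic r -> r \in `[0, 1] -> same_crossings s r by near: r.
  by apply.
Unshelve. all: by end_near. Qed.

End MovingPolygon.

Lemma isotopic_gauss_equiv (R : realType) (T : Type) (D1 D2 : diagram R T) : isotopic D1 D2 ->
  exists phi psi, @gauss_equiv R T D1 D2 phi psi.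
Proof.
case=> phi [p [[[psi K VK] nx] pc [p0 p1] pd lb]]; exists phi, psi.
have pg t : 0 <= t <= 1 -> generic (moving (@nextv_inj _ D1) p t) by move=> /pd[].
have := moving_same_crossings pc pg => H.
have E0 (e : vtx D1) : @dir R (moving (@nextv_inj _ D1) p 0) e = dir e by rewrite /dir /= p0.
have E1 (e : vtx D1) : @dir R (moving (@nextv_inj _ D1) p 1) e = dir (phi e).
  by rewrite /dir /= !p1 nx.
have C0 (e f : vtx D1) : @cpar R (moving (@nextv_inj _ D1) p 0) e f = cpar e f.
  by rewrite /cpar /dir /= p0.
have C1 (e f : vtx D1) : @cpar R (moving (@nextv_inj _ D1) p 1) e f = cpar (phi e) (phi f).
  by rewrite /cpar /dir /= !p1 !nx.
have X0 (e f : vtx D1) : @cross R (moving (@nextv_inj _ D1) p 0) e f <-> cross e f.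
  by split=> -[s [t [a b c d]]]; exists s, t; split=> //; move: d; rewrite /pt /dir /= p0.
have X1 (e f : vtx D1) : @cross R (moving (@nextv_inj _ D1) p 1) e f <-> cross (phi e) (phi f).
  have T1 (v : vtx D1) s : @pt R (moving (@nextv_inj _ D1) p 1) v s = pt (phi v) s.
    by rewrite /pt /dir /= !p1 nx.
  split=> -[s [t [a b c d]]]; exists s, t; split=> //.
  - by apply: contraNN a => /eqP/(can_inj K)/eqP.
  - by rewrite -!T1.
  - by apply: contraNN a => /eqP ->.
  - by rewrite !T1.
split=> //.
- move=> e f; have [h _ _] := H e f; split=> ef.
    exact: (iffLR (X1 e f) (iffLR h (iffRL (X0 e f) ef))).
  exact: (iffLR (X0 e f) (iffRL h (iffRL (X1 e f) ef))).
- by move=> e f /(iffRL (X0 e f)) ef; have [_ h _] := H e f;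
    rewrite -(E1 e) -(E1 f) -h // (E0 e) (E0 f).
- move=> e f f' /(iffRL (X0 e f)) ef /(iffRL (X0 e f')) ef'; have [_ _ h] := H e f.
  by rewrite -(C1 e f) -(C1 e f') -h // (C0 e f) (C0 e f').
Qed.

(** * Replacing a strand *)

Section Strands.
Variables (R : realType) (P : polygon R) (a : vtx P).

Section OneStrand.
Variable l : seq (R * R).
Local Notation J := (insert a l).
Implicit Types (x y : vtx P) (z w : vtx J).

Definition rk z : nat := match z with inl _ => 0 | inr i => i.+1 end.

(** A single parameter for the whole strand, from 0 to [size l + 1], whose integer part numbers the
    edge. It allows strands with different numbers of edges to be compared. *)
Definition spos z (s : R) : R := (rk z)%:R + s.

Lemma outer_next x : x != a -> nextv (inl x : vtx J) = inl (nextv x).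
Proof. by rewrite /= => /negbTE ->. Qed.

Lemma outer_dir x : x != a -> dir (inl x : vtx J) = dir x.
Proof. by rewrite /dir /= => /negbTE ->. Qed.

Lemma outer_pt x s : x != a -> pt (inl x : vtx J) s = pt x s.
Proof. by move=> xa; rewrite /pt outer_dir. Qed.

Lemma outer_meet x s y t : x != a -> y != a ->
  @meet_at _ J (inl x) s (inl y) t <-> meet_at x s y t.
Proof.
move=> xa ya; rewrite /meet_at !outer_pt //.
Qed.

Lemma strandVouter z : on_strand z \/ exists2 x, x != a & z = inl x.
Proof.
case: z => [x|i]; last by left.
by have [->|xa] := eqVneq x a; [left; rewrite /= eqxx|right; exists x].
Qed.

Lemma rk_le z : (rk z <= size l)%N.
Proof. by case: z => //= i. Qed.

Lemma rk_inj z w : on_strand z -> on_strand w -> rk z = rk w -> z = w.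
Proof.
case: z w => [x|i] [y|j] //=; first by move=> /eqP -> /eqP ->.
by move=> _ _ [] /ord_inj ->.
Qed.

Lemma rk_exists k : (k <= size l)%N -> exists2 z : vtx J, on_strand z & rk z = k.
Proof.
case: k => [_|k kl]; first by exists (inl a) => //=.
by exists (inr (Ordinal kl)).
Qed.

Lemma rk_next z : on_strand z -> (rk z < size l)%N ->
  on_strand (nextv z) /\ rk (nextv z) = (rk z).+1.
Proof.
have node k : (k < size l)%N -> on_strand (insert_node a l k) /\ rk (insert_node a l k) = k.+1.
  by rewrite /insert_node => kl; case: insubP => [i _ <-|]; last by rewrite kl.
case: z => [x /= xa|i /= _] h; last exact: node.
by rewrite xa; exact: node.
Qed.

Lemma strand_last z : on_strand z -> rk z = size l -> nextv z = inl (nextv a).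
Proof.
have node k : k = size l -> insert_node a l k = inl (nextv a).
  by rewrite /insert_node => kl; case: insubP => // i; rewrite kl ltnn.
by case: z => [x /= ->|i /= _] E; exact: node.
Qed.

Lemma nat_frac_inj (i j : nat) (s t : R) : 0 <= s < 1 -> 0 <= t < 1 ->
  i%:R + s = j%:R + t -> i = j /\ s = t.
Proof.
move=> s01 t01; have [ij|ji|-> h] := ltngtP i j; last by split=> //; lra.
  by move: ij; rewrite -(ler_nat R) -natr1; lra.
by move: ji; rewrite -(ler_nat R) -natr1; lra.
Qed.

Lemma spos_inj z w (s t : R) : on_strand z -> on_strand w -> 0 <= s < 1 -> 0 <= t < 1 ->
  spos z s = spos w t -> z = w /\ s = t.
Proof. by move=> zs ws s01 t01 /(nat_frac_inj s01 t01)[/(rk_inj zs ws) -> ->]. Qed.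

Lemma spos_exists (c : R) : 0 <= c < (size l).+1%:R ->
  exists z s, [/\ on_strand z, 0 <= s < 1 & c = spos z s].
Proof.
move=> /andP[c0 cm].
have /andP[tc ct] := truncn_itv c0.
have [z zs rz] : exists2 z : vtx J, on_strand z & rk z = Num.truncn c.
  by apply: rk_exists; rewrite -ltnS -(ltr_nat R); apply: le_lt_trans cm.
exists z, (c - (Num.truncn c)%:R); rewrite /spos rz; split=> //; last by lra.
by move: ct; rewrite -natr1; lra.
Qed.

(** For limits from the left an integer must be read as the end of an edge and not as the start of
    the next. *)
Lemma spos_exists_left (c : R) : 0 < c <= (size l).+1%:R ->
  exists z s, [/\ on_strand z, 0 < s <= 1 & c = spos z s].
Proof.
move=> /andP[c0 cm].
(* Rounding [c] up amounts to rounding down its distance to the end of the strand. *)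
have h : 0 <= (size l).+1%:R - c < (size l).+1%:R by lra.
have /andP[tc ct] : (Num.truncn ((size l).+1%:R - c))%:R <= (size l).+1%:R - c <
    (Num.truncn ((size l).+1%:R - c)).+1%:R by apply: truncn_itv; lra.
set k := Num.truncn _ in tc ct.
have kl : (k <= size l)%N by rewrite -ltnS -(ltr_nat R); lra.
have [z zs rz] : exists2 z : vtx J, on_strand z & rk z = (size l - k)%N.
  by apply: rk_exists; rewrite leq_subr.
exists z, (c - (size l - k)%:R); rewrite /spos rz; split=> //; last by lra.
rewrite natrB //; move: tc ct; rewrite -!natr1; lra.
Qed.

End OneStrand.
End Strands.

Section StrandColorings.
Variables (R : realType) (T : Type) (Q : operator_quandle T) (P : polygon R) (a : vtx P).

Section OneStrand.
Variables (l : seq (R * R)) (lb : labelling T a l).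
Local Notation J := (insert a l).
Local Notation m := ((size l).+1%:R : R).
Implicit Types (x y : vtx P) (z w : vtx J) (u v : vtx P -> R -> Q) (F G : R -> Q).

Definition glue u F : vtx J -> R -> Q := fun z s =>
  match z with
  | inl x => if x == a then F s else u x s
  | inr i => F (i.+1%:R + s)
  end.

Lemma glue_outer u F x s : x != a -> glue u F (inl x) s = u x s.
Proof. by rewrite /glue => /negbTE ->. Qed.

Lemma glue_strand u F z s : on_strand z -> glue u F z s = F (spos z s).
Proof. by case: z => [x /= -> /=|i //]; rewrite /spos add0r. Qed.

(* A point colouring, with the strand parametrised by a single real. *)
Record strand_coloring u F : Prop := StrandColoring {
  sc_left_outer : forall x s, x != a -> 0 < s <= 1 -> \forall r \near s^'-, u x r = u x s;
  sc_left : forall c, 0 < c <= m -> \forall r \near c^'-, F r = F c;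
  sc_free_outer : forall x s, x != a -> 0 <= s < 1 ->
    (forall f t, ~ @meet_at _ J (inl x) s f t) -> \forall r \near s^'+, u x r = u x s;
  sc_free : forall z s, on_strand z -> 0 <= s < 1 ->
    (forall f t, ~ meet_at z s f t) -> \forall r \near (spos z s)^'+, F r = F (spos z s);
  sc_meet_outer : forall x s f t, x != a -> @meet_at _ J (inl x) s f t ->
    \forall r \near s^'+, u x r =
      act (lb (inl x) f) (0 < det2 (dir (inl x : vtx J)) (dir f)) (u x s) (glue u F f t);
  sc_meet : forall z s f t, on_strand z -> meet_at z s f t ->
    \forall r \near (spos z s)^'+, F r =
      act (lb z f) (0 < det2 (dir z) (dir f)) (F (spos z s)) (glue u F f t);
  sc_next : forall x, x != a -> nextv x != a -> u (nextv x) 0 = u x 1;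
  sc_start : forall x, x != a -> nextv x = a -> F 0 = u x 1;
  sc_end : nextv a != a -> u (nextv a) 0 = F m;
  sc_loop : nextv a = a -> F 0 = F m }.

Lemma near_right_shift (k s : R) (S : R -> Prop) :
  (\forall r \near (k + s)^'+, S r) <-> (\forall r \near s^'+, S (k + r)).
Proof.
split=> /near_rightP[d sd H]; apply/near_rightP.
  by exists (d - k); [lra|move=> r rd; apply: H; lra].
by exists (k + d); [lra|move=> r rd; rewrite -(subrKC k r); apply: H; lra].
Qed.

Lemma near_left_shift (k s : R) (S : R -> Prop) :
  (\forall r \near (k + s)^'-, S r) <-> (\forall r \near s^'-, S (k + r)).
Proof.
split=> /near_leftP[d sd H]; apply/near_leftP.
  by exists (d - k); [lra|move=> r rd; apply: H; lra].
by exists (k + d); [lra|move=> r rd; rewrite -(subrKC k r); apply: H; lra].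
Qed.

Lemma spos_range z (s : R) : 0 <= s <= 1 -> 0 <= spos z s <= m.
Proof.
move=> s01; rewrite /spos; have := rk_le z; rewrite -(ler_nat R) => h.
have := ler0n R (rk z); rewrite -natr1; lra.
Qed.

Lemma spos_range_lt z (s : R) : 0 <= s < 1 -> 0 <= spos z s < m.
Proof.
move=> s01; rewrite /spos; have := rk_le z; rewrite -(ler_nat R) => h.
have := ler0n R (rk z); rewrite -natr1; lra.
Qed.

Lemma strand_coloring_point u F : strand_coloring u F -> point_coloring lb (glue u F).
Proof.
move=> sc; split.
- move=> z s s01; have [zs|[x xa ->]] := strandVouter z; last first.
    by under eq_near do rewrite !(glue_outer _ _ _ xa); exact: sc_left_outer sc _ _ xa s01.
  under eq_near do rewrite !(glue_strand _ _ _ zs).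
  apply/(near_left_shift _ _ (fun r => F r = F (spos z s)))/(sc_left sc).
  have := ler0n R (rk z); have /andP[] : 0 <= spos z s <= m by apply: spos_range; lra.
  by rewrite /spos; lra.
- move=> z s s01 nm; have [zs|[x xa E]] := strandVouter z; last first.
    rewrite E in nm *; under eq_near do rewrite !(glue_outer _ _ _ xa).
    exact: sc_free_outer sc _ _ xa s01 nm.
  under eq_near do rewrite !(glue_strand _ _ _ zs).
  exact/(near_right_shift _ _ (fun r => F r = F (spos z s)))/(sc_free sc).
- move=> z s f t mt; have [zs|[x xa E]] := strandVouter z; last first.
    rewrite E in mt *; under eq_near do rewrite !(glue_outer _ _ _ xa).
    exact: sc_meet_outer sc _ _ _ _ xa mt.
  under eq_near do rewrite !(glue_strand _ _ _ zs).
  exact/(near_right_shift _ _ (fun r => F r = _))/(sc_meet sc).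
- move=> z; have [zs|[x xa ->]] := strandVouter z; last first.
    rewrite outer_next // (glue_outer _ _ _ xa).
    have [E|nxa] := eqVneq (nextv x) a; last by rewrite glue_outer // (sc_next sc).
    by rewrite -(sc_start sc xa E) E /glue eqxx.
  rewrite (glue_strand _ _ _ zs); have [h|h] := ltnP (rk z) (size l).
    have [zs' E] := rk_next zs h; rewrite (glue_strand _ _ _ zs') /spos E -natr1.
    by congr F; ring.
  have {h}E : rk z = size l by apply/eqP; rewrite eqn_leq rk_le.
  rewrite (strand_last zs E) /spos E natr1.
  have [na|nxa] := eqVneq (nextv a) a; last by rewrite glue_outer // (sc_end sc).
  by rewrite na /glue eqxx (sc_loop sc).
Qed.

Lemma point_strand_coloring g : point_coloring lb g ->
  exists2 F, strand_coloring (fun x s => g (inl x) s) F &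
    same_points g (glue (fun x s => g (inl x) s) F).
Proof.
move=> pg.
(* The end of a strand edge and the start of the next have the same [spos]; [pc_next] makes their
   colours agree, so the colour is a function of [spos]. *)
have uniq z w (s t : R) : on_strand z -> on_strand w -> 0 <= s <= 1 -> 0 <= t <= 1 ->
    spos z s = spos w t -> g z s = g w t.
  have one z' w' (t' : R) : on_strand z' -> on_strand w' -> 0 <= t' < 1 ->
      spos z' 1 = spos w' t' -> g z' 1 = g w' t'.
    move=> zs' ws' t01; rewrite /spos natr1 -[LHS]addr0 => h.
    have [|E <-] := nat_frac_inj _ t01 h; first by lra.
    have [|nz rn] := rk_next zs'; first by rewrite E rk_le.
    by rewrite -(pc_next pg); congr g; apply: rk_inj => //; rewrite rn.
  move=> zs ws /andP[s0]; rewrite le_eqVlt => /orP[/eqP -> |s1] /andP[t0];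
    rewrite le_eqVlt => /orP[/eqP E|t1].
  - by rewrite E => /addIr/eqP; rewrite eqr_nat => /eqP h; congr g; exact: rk_inj.
  - by apply: one => //; rewrite t0.
  - by rewrite E => h; apply/esym/one => //; rewrite s0.
  - by move=> h; have [||-> ->] := spos_inj zs ws _ _ h; rewrite ?s0 ?t0.
have /choice[F HF] : forall c, exists q : Q, forall z (s : R), on_strand z -> 0 <= s <= 1 ->
    c = spos z s -> g z s = q.
  move=> c; have [[z [s [zs s01 cE]]]|no] := pselect (exists z (s : R), [/\ on_strand z,
    0 <= s <= 1 & c = spos z s]).
    by exists (g z s) => w t ws t01; rewrite cE => E; exact: uniq.
  by exists (g (inl a) 0) => z s zs s01 cE; case: no; exists z, s.
have FE z (s : R) : on_strand z -> 0 <= s <= 1 -> g z s = F (spos z s).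
  by move=> zs s01; apply: HF.
have same : same_points g (glue (fun x s => g (inl x) s) F).
  move=> z s s01; have [zs|[x xa ->]] := strandVouter z; last by rewrite glue_outer.
  by rewrite glue_strand // FE.
exists F => //; split.
- by move=> x s _ s01; exact: (pc_left pg (inl x : vtx J) s01).
- move=> c c0m; have [z [s [zs s01 ->]]] := spos_exists_left a c0m.
  apply/(near_left_shift _ _ (fun r => F r = F (spos z s))).
  have h := pc_left pg z s01; have [s0 s1] : 0 < s /\ s <= 1 by lra.
  near=> r; rewrite -[RHS]FE //; last by lra.
  transitivity (g z r); last by near: r.
  apply/esym/FE => //; apply/andP; split; first by near: r; exact: nbhs_left_ge.
  by apply: le_trans s1; near: r; exact: nbhs_left_le.
- by move=> x s _ s01 nm; exact: (pc_free pg s01 nm).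
- move=> z s zs s01 nm; apply/(near_right_shift _ _ (fun r => F r = F (spos z s))).
  have h := pc_free pg s01 nm; have [s0 s1] : 0 <= s /\ s < 1 by lra.
  near=> r; rewrite -[RHS]FE //; last by lra.
  transitivity (g z r); last by near: r.
  apply/esym/FE => //; apply/andP; split; last by near: r; exact: nbhs_right_le.
  by apply: le_trans s0 _; near: r; exact: nbhs_right_ge.
- move=> x s f t xa mt; rewrite -same; first exact: pc_meet mt.
  by case: mt => _ _ /andP[-> /ltW].
- move=> z s f t zs mt; rewrite -same; last by case: mt => _ _ /andP[-> /ltW].
  have [_ /andP[s0 s1] _ _] := mt.
  rewrite -FE //; last by rewrite s0 ltW.
  apply/(near_right_shift _ _ (fun r => F r = act _ _ _ _)).
  have h := pc_meet pg mt.
  near=> r; transitivity (g z r); last by near: r.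
  apply/esym/FE => //; apply/andP; split; last by near: r; exact: nbhs_right_le.
  by apply: le_trans s0 _; near: r; exact: nbhs_right_ge.
- by move=> x xa nxa; rewrite -(pc_next pg) outer_next.
- move=> x xa E; have := pc_next pg (inl x); rewrite outer_next // E => <-.
  by rewrite (FE (inl a)) /= ?eqxx // /spos ?addr0 // lexx ler01.
- have [z zs rz] := @rk_exists _ _ a l (size l) (leqnn _).
  move=> na; have := pc_next pg z; rewrite (strand_last zs rz) => ->.
  by rewrite FE ?lexx ?ler01 // /spos rz natr1.
- have [z zs rz] := @rk_exists _ _ a l (size l) (leqnn _).
  move=> na; have := pc_next pg z; rewrite (strand_last zs rz) na.
  rewrite (FE (inl a)) /= ?eqxx ?lexx ?ler01 // FE ?lexx ?ler01 // /spos rz natr1 /= add0r.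
  by [].
Unshelve. all: by end_near. Qed.

End OneStrand.
End StrandColorings.

Section StrandPropagation.
Variables (R : realType) (T : Type) (Q : operator_quandle T) (P : polygon R) (a : vtx P).
Variables (l : seq (R * R)) (lb : labelling T a l).
Local Notation J := (insert a l).
Local Notation m := ((size l).+1%:R : R).
Implicit Types (u v : vtx P -> R -> Q) (F G : R -> Q).

Lemma strand_agree u F v G (A B : R) :
  strand_coloring lb u F -> strand_coloring lb v G -> 0 <= A -> B <= m -> F A = G A ->
  (forall z (s : R) f t, on_strand z -> A <= spos z s < B -> meet_at z s f t ->
     lb z f <> Under \/ glue (l := l) u F f t = glue (l := l) v G f t) ->
  forall c, A <= c <= B -> F c = G c.
Proof.
move=> pF pG A0 Bm FG H; apply: real_ind => // [c /andP[Ac cB] IH|c /andP[Ac cB] IH].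
  have gc : F c = G c by apply: IH; rewrite Ac lexx.
  have [z [s [zs s01 cE]]] : exists (z : vtx J) s, [/\ on_strand z, 0 <= s < 1 & c = spos z s].
    by apply: spos_exists; lra.
  have [[f [t mt]]|nm] := pselect (exists f t, meet_at z s f t).
    have := sc_meet pF zs mt; have := sc_meet pG zs mt; rewrite -cE => h' h.
    have E : act (lb z f) (0 < det2 (dir z) (dir f)) (F c) (glue (l := l) u F f t) =
             act (lb z f) (0 < det2 (dir z) (dir f)) (G c) (glue (l := l) v G f t).
      rewrite gc; have [||->//] := H z s f t zs _ mt; first by rewrite -cE Ac.
      exact: act_transparent.
    near=> r; transitivity (act (lb z f) (0 < det2 (dir z) (dir f)) (F c) (glue (l := l) u F f t)).
      by near: r.
    by rewrite E; apply/esym; near: r.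
  have nm' f t : ~ meet_at z s f t by move=> mt; apply: nm; exists f, t.
  have := sc_free pF zs s01 nm'; have := sc_free pG zs s01 nm'; rewrite -cE => h' h.
  near=> r; transitivity (F c); first by near: r.
  by rewrite gc; apply/esym; near: r.
have c01 : 0 < c <= m by lra.
have h := sc_left pF c01; have h' := sc_left pG c01.
near c^'- => r; have <- : F r = F c by near: r.
have <- : G r = G c by near: r.
apply: IH; apply/andP; split; last by [].
by near: r; apply: nbhs_left_ge.
Unshelve. all: by end_near. Qed.

Lemma strand_const u F (A B : R) : strand_coloring lb u F -> 0 <= A -> B <= m ->
  (forall z (s : R) f t, on_strand z -> A <= spos z s < B -> meet_at z s f t -> lb z f = Over) ->
  forall c, A <= c <= B -> F c = F A.
Proof.
move=> pF A0 Bm H; apply: real_ind => // [c /andP[Ac cB] IH|c /andP[Ac cB] IH].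
  have gc : F c = F A by apply: IH; rewrite Ac lexx.
  have [z [s [zs s01 cE]]] : exists (z : vtx J) s, [/\ on_strand z, 0 <= s < 1 & c = spos z s].
    by apply: spos_exists; lra.
  rewrite -gc; have [[f [t mt]]|nm] := pselect (exists f t, meet_at z s f t).
    by have := sc_meet pF zs mt; rewrite (H z s f t) // -cE // Ac.
  by rewrite cE; apply: (sc_free pF zs s01) => f t mt; apply: nm; exists f, t.
have c01 : 0 < c <= m by lra.
have h := sc_left pF c01; near c^'- => r; have <- : F r = F c by near: r.
apply: IH; apply/andP; split; last by [].
by near: r; apply: nbhs_left_ge.
Unshelve. all: by end_near. Qed.

Lemma strand_after u F z (s : R) f t (B : R) : strand_coloring lb u F ->
  on_strand z -> meet_at z s f t -> spos z s < B -> B <= m ->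
  (forall z' (s' : R) f' t', on_strand z' -> spos z s < spos z' s' < B ->
     meet_at z' s' f' t' -> lb z' f' = Over) ->
  forall c, spos z s < c <= B ->
    F c = act (lb z f) (0 < det2 (dir z) (dir f)) (F (spos z s)) (glue (l := l) u F f t).
Proof.
move=> pF zs mt sB Bm H c /andP[sc cB].
have h := sc_meet pF zs mt; near (spos z s)^'+ => r.
have <- : F r = act (lb z f) (0 < det2 (dir z) (dir f)) (F (spos z s)) (glue (l :=
  l) u F f t) by near: r.
have sr : spos z s < r by [].
have rc : r < c by near: r; apply: nbhs_right_lt.
have s0 : 0 <= spos z s.
  by case: mt => _ s01 _ _; have /andP[] := spos_range_lt z s01.
apply: (strand_const pF _ Bm); rewrite ?(ltW rc) ?cB ?(le_trans s0 (ltW sr)) //.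
by move=> z' s' f' t' zs' r'B; apply: H => //; lra.
Unshelve. all: by end_near. Qed.

Definition same_strand_points u F v G := (forall x (s : R), x != a -> 0 <= s <= 1 ->
  u x s = v x s) /\
  (forall c : R, 0 <= c <= m -> F c = G c).

Lemma same_strand_pointsP u F v G :
  same_points (glue (a := a) (l := l) u F) (glue (l := l) v G) <-> same_strand_points u F v G.
Proof.
split=> [h|[h h'] z s s01]; last first.
  have [zs|[x xa ->]] := strandVouter z; last by rewrite !glue_outer // h.
  rewrite !glue_strand //; exact/h'/spos_range.
split=> [x s xa s01|c]; first by have := h (inl x) s s01; rewrite !glue_outer.
rewrite le_eqVlt => /andP[/orP[/eqP <- _|c0 cm]].
  have := h (inl a) 0; rewrite lexx ler01 !glue_strand /= ?eqxx // /spos /= addr0.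
  exact.
have [z [s [zs s01 ->]]] : exists (z : vtx J) s, [/\ on_strand z, 0 < s <= 1 & c = spos z s].
  by apply: spos_exists_left; rewrite c0.
have := h z s; rewrite !glue_strand //; apply; lra.
Qed.

End StrandPropagation.

(** The common frame of all moves except isotopy: the outer colours of both diagrams live on the
    same [P], and only the functions on the strands have different domains. *)
Lemma strand_card_eq (R : realType) (T : Type) (Q : operator_quandle T) (P : polygon R) (a : vtx P)
    (l1 l2 : seq (R * R)) (lab1 : labelling T a l1) (lab2 : labelling T a l2)
    (ok1 : is_diagram lab1) (ok2 : is_diagram lab2)
    (M : (vtx P -> R -> Q) -> (R -> Q) -> (vtx P -> R -> Q) -> (R -> Q) -> Prop) :
  (forall u F, strand_coloring lab1 u F -> exists u' F',
    strand_coloring lab2 u' F' /\ M u F u' F') ->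
  (forall u' F', strand_coloring lab2 u' F' -> exists u F,
    strand_coloring lab1 u F /\ M u F u' F') ->
  (forall u F u' F' v G v' G', strand_coloring lab1 u F -> strand_coloring lab2 u' F' ->
     strand_coloring lab1 v G -> strand_coloring lab2 v' G' -> M u F u' F' -> M v G v' G' ->
     same_strand_points a l1 u F v G <-> same_strand_points a l2 u' F' v' G') ->
  (Col (Diagram ok1) Q #= Col (Diagram ok2) Q)%card.
Proof.
move=> M12 M21 Mdet.
pose N (g1 : vtx (Diagram ok1) -> R -> Q) (g2 : vtx (Diagram ok2) -> R -> Q) := exists u F u' F',
  [/\ strand_coloring lab1 u F, strand_coloring lab2 u' F', M u F u' F',
      same_points g1 (glue (a := a) (l := l1) u F) & same_points g2 (glue (a := a) (l :=
        l2) u' F')].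
apply: (@col_card_eq _ _ _ _ _ N) => [g1 p1|g2 p2|].
- have [F sc E] := point_strand_coloring p1; have [u' [F' [sc' m]]] := M12 _ _ sc.
  by exists (glue (a := a) (l := l2) u' F');
    [exact: strand_coloring_point|exists (fun x s => g1 (inl x) s), F, u', F'].
- have [F' sc' E] := point_strand_coloring p2; have [u [F [sc m]]] := M21 _ _ sc'.
  by exists (glue (a := a) (l := l1) u F); [exact: strand_coloring_point|exists u, F,
    (fun x s => g2 (inl x) s), F'].
move=> g1 g2 g1' g2' _ _ _ _ [u [F [u' [F' [s1 s2 m E1 E2]]]]] [v [G [v' [G' [t1 t2 n X1 X2]]]]].
have := Mdet _ _ _ _ _ _ _ _ s1 s2 t1 t2 m n.
rewrite -!same_strand_pointsP => h; split=> H.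
  suff /h K : same_points (glue (a := a) (l := l1) u F) (glue (a := a) (l := l1) v G).
    by move=> z s s01; rewrite E2 // X2 // K.
  by move=> z s s01; rewrite -E1 // -X1 // H.
suff /h K : same_points (glue (a := a) (l := l2) u' F') (glue (a := a) (l := l2) v' G').
  by move=> z s s01; rewrite E1 // X1 // K.
by move=> z s s01; rewrite -E2 // -X2 // H.
Qed.

(** * Hulls and the first Reidemeister move *)

Section Hulls.
Variable R : realType.
Implicit Types (L : seq (R * R)) (x y : R * R).

Lemma hull_mem L x : x \in L -> hull L x.
Proof.
move=> xL; have iL : (index x L < size L)%N by rewrite index_mem.
exists (fun i => (i == Ordinal iL)%:R); split.
- by move=> i; case: (_ == _).
- by rewrite (bigD1 (Ordinal iL)) //= eqxx big1 ?addr0 // => i /negbTE ->.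
- rewrite (bigD1 (Ordinal iL)) //= eqxx scale1r nth_index // big1 ?addr0 // => i /negbTE ->.
  by rewrite scale0r.
Qed.

Lemma hull_conv L x y (s : R) : hull L x -> hull L y -> 0 <= s <= 1 -> hull L (x + s *: (y - x)).
Proof.
move=> [w [w0 w1 ->]] [v [v0 v1 ->]] /andP[s0 s1].
exists (fun i => w i + s * (v i - w i)); split.
- move=> i; have -> : w i + s * (v i - w i) = (1 - s) * w i + s * v i by ring.
  by rewrite addr_ge0 // mulr_ge0 // subr_ge0.
- by rewrite big_split /= -mulr_sumr sumrB w1 v1 subrr mulr0 addr0.
- rewrite -sumrB scaler_sumr -big_split /=; apply: eq_bigr => i _.
  by rewrite scalerDl -scalerA scalerBl scalerBr.
Qed.

Variables (P : polygon R) (a : vtx P) (l : seq (R * R)).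
Local Notation J := (insert a l).

Lemma strand_hull L (z : vtx J) (s : R) : {subset pos a :: rcons l (pos (nextv a)) <= L} ->
  on_strand z -> 0 <= s <= 1 -> hull L (pt z s).
Proof.
move=> lL zs s01.
have mem (w : vtx J) : on_strand w -> hull L (pos w).
  case: w => [x /= /eqP ->|i _]; apply/hull_mem/lL; first by apply: mem_head.
  by rewrite in_cons mem_rcons in_cons mem_nth ?orbT.
apply: hull_conv => //; first exact: mem.
have [h|h] := ltnP (rk z) (size l); first by apply: mem; have [] := rk_next zs h.
rewrite (strand_last zs); last by apply/eqP; rewrite eqn_leq rk_le.
by apply/hull_mem/lL; rewrite in_cons mem_rcons in_cons eqxx orbT.
Qed.

Lemma only_meets_strand L xs (z : vtx J) (s : R) (y : vtx P) t : generic J ->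
  only_meets a (hull L) xs -> {subset pos a :: rcons l (pos (nextv a)) <= L} ->
  on_strand z -> y != a -> meet_at z s (inl y : vtx J) t -> y \in xs.
Proof.
move=> gJ om lL zs ya mt; have [s01 t01 _] := meet_interior gJ mt.
have [] := om y t ya; [lra| |by []|by case=> _; lra].
case: mt => _ _ _; rewrite outer_pt // => <-.
by apply: strand_hull => //; lra.
Qed.

(** Neither an edge with itself nor two consecutive edges can meet. Hence strands of at most two
    edges are simple, and one of three edges crosses itself at most once. *)
Lemma strand_self_meet (z w : vtx J) (s t : R) : generic J -> on_strand z -> on_strand w ->
  meet_at z s w t -> ((rk z).+1 < rk w)%N \/ ((rk w).+1 < rk z)%N.
Proof.
move=> gJ; wlog zw : z w s t / (rk z <= rk w)%N.
  move=> H zs ws mt; have [h|h] := leqP (rk z) (rk w); first exact: H mt.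
  by rewrite or_comm; apply: H (meet_sym mt) => //; exact: ltnW.
move=> zs ws mt; left; rewrite ltn_neqAle; apply/andP; split.
  apply/eqP => E; have [] := rk_next zs; first by rewrite E rk_le.
  move=> nz; rewrite E => /(rk_inj nz ws) wE.
  by apply: (@meet_nextv _ J gJ z s t); rewrite wE.
rewrite ltn_neqAle zw andbT; apply/eqP => /(rk_inj zs ws) E.
by case: mt; rewrite E eqxx.
Qed.

End Hulls.

Section IdleStrands.
Variables (R : realType) (T : Type) (Q : operator_quandle T) (P : polygon R) (a : vtx P).

(** On a strand that meets nothing else and crosses itself only classically, a constant colour
    satisfies every rule by idempotence. *)
Lemma idle_strand_transfer (l1 l2 : seq (R * R)) (lab1 : labelling T a l1) (lab2 : labelling T a l2)
    (ok1 : is_diagram lab1) (ok2 : is_diagram lab2) u (F : R -> Q) :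
  same_outside lab1 lab2 ->
  (forall (z : vtx (insert a l1)) s y t, on_strand z -> y != a -> ~ meet_at z s (inl y) t) ->
  (forall (z : vtx (insert a l2)) s y t, on_strand z -> y != a -> ~ meet_at z s (inl y) t) ->
  (forall (z w : vtx (insert a l2)) s t, on_strand z -> on_strand w -> meet_at z s w t ->
     classical (lab2 z w)) ->
  (forall c : R, 0 <= c <= (size l1).+1%:R -> F c = F 0) ->
  strand_coloring lab1 u F -> strand_coloring lab2 u (fun _ => F 0).
Proof.
move=> so no1 no2 self Fc sc.
have act_id (p : passage T) b (q : Q) : classical p -> act p b q q = q.
  case: p => //= _; have id := qop_idem q; case: b => //.
  by rewrite -{1}id qopK.
have out_meet x s f t : x != a -> @meet_at _ (insert a l2) (inl x) s f t ->
    exists2 y, y != a /\ f = inl y & @meet_at _ (insert a l1) (inl x) s (inl y) t.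
  move=> xa mt; have [fs|[y ya E]] := strandVouter f.
    by case: (no2 _ _ _ _ fs xa (meet_sym mt)).
  exists y => //; apply/outer_meet => //; move: mt; rewrite E;
    exact: (iffLR (outer_meet _ _ _ _ _)).
split.
- exact: sc_left_outer sc.
- by move=> c _; near=> r.
- move=> x s xa s01 nm; apply: (sc_free_outer sc xa s01) => f t mt.
  have [fs|[y ya E]] := strandVouter f; first exact: no1 fs xa (meet_sym mt).
  apply: (nm (inl y) t); apply/outer_meet => //; move: mt; rewrite E.
  exact: (iffLR (outer_meet _ _ _ _ _)).
- by move=> z s _ _ _; near=> r.
- move=> x s f t xa mt; have [y [ya E] mt'] := out_meet _ _ _ _ xa mt.
  have := sc_meet_outer sc xa mt'; rewrite E !glue_outer // !outer_dir //.
  by rewrite (so _ _ xa ya) //; exists s, t; apply: (iffLR (outer_meet l1 s t xa ya)).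
- move=> z s f t zs mt; have [fs|[y ya E]] := strandVouter f.
    by rewrite glue_strand // act_id; [near=> r|exact: self mt].
  by rewrite E in mt; case: (no2 _ _ _ _ zs ya mt).
- exact: sc_next sc.
- exact: sc_start sc.
- by move=> /(sc_end sc) ->; apply: Fc; rewrite lexx ler0n.
- by [].
Unshelve. all: by end_near. Qed.

Lemma reidemeister1_card p q (lab1 : labelling T a [::]) (lab2 : labelling T a [:: p; q])
    (ok1 : is_diagram lab1) (ok2 : is_diagram lab2) :
  same_outside lab1 lab2 -> reidemeister1 lab2 ->
  (Col (Diagram ok1) Q #= Col (Diagram ok2) Q)%card.
Proof.
move=> so [om ce cl]; have g1 := ok1.1; have g2 := ok2.1.
set e1 : vtx (insert a [:: p; q]) := inl a in ce cl.
set e3 := nextv (nextv e1) in ce cl.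
have [e1s r1] : on_strand e1 /\ rk e1 = 0%N by rewrite /= eqxx.
have [e2s r2] := rk_next e1s (isT : (rk e1 < size [:: p; q])%N).
have [e3s r3] : on_strand e3 /\ rk e3 = 2%N.
  by have := @rk_next _ _ _ _ _ e2s; rewrite r2 r1; apply.
have no1 (z : vtx (insert a [::])) s y t : on_strand z -> y != a -> ~ meet_at z s (inl y) t.
  move=> zs ya mt; suff : y \in [::] by [].
  by apply: only_meets_strand g1 om _ zs ya mt => w; rewrite !inE => /orP[/eqP ->|/eqP ->];
    rewrite eqxx ?orbT.
have no2 (z : vtx (insert a [:: p; q])) s y t : on_strand z -> y != a -> ~ meet_at z s (inl y) t.
  by move=> zs ya mt; suff : y \in [::] by []; apply: only_meets_strand g2 om _ zs ya mt.
have self1 (z w : vtx (insert a [::])) s t : on_strand z -> on_strand w -> ~ meet_at z s w t.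
  move=> zs ws mt; have := rk_le z; have := rk_le w; rewrite !leqn0 => /eqP rw /eqP rz.
  by have [] := strand_self_meet g1 zs ws mt; rewrite rz rw.
have self2 (z w : vtx (insert a [:: p; q])) s t : on_strand z -> on_strand w ->
    meet_at z s w t -> (z = e1 /\ w = e3) \/ (z = e3 /\ w = e1).
  move=> zs ws mt; have := rk_le z; have := rk_le w => /= rw rz.
  have [h|h] := strand_self_meet g2 zs ws mt; [left|right].
    by split; [apply: (rk_inj zs e1s); rewrite r1|apply: (rk_inj ws e3s); rewrite r3]; lia.
  by split; [apply: (rk_inj zs e3s); rewrite r3|apply: (rk_inj ws e1s); rewrite r1]; lia.
have lm : lab2 e3 e1 = mirror (lab2 e1 e3) by apply: ok2.2.
have m13 := cross_meet g2 ce; set s1 := cpar e1 e3 in m13; set s3 := cpar e3 e1 in m13.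
have [s101 s301 _] := meet_interior g2 m13.
have p1 : spos e1 s1 = s1 by rewrite /spos r1 add0r.
have p3 : spos e3 s3 = 2 + s3 by rewrite /spos r3.
move: {r1 r2 r3} p1 p3 => p1 p3.
have size2 : (size [:: p; q]).+1%:R = 3 :> R by [].
have meetE (z : vtx (insert a [:: p; q])) s f t : on_strand z -> meet_at z s f t ->
    [/\ z = e1, s = s1, f = e3 & t = s3] \/ [/\ z = e3, s = s3, f = e1 & t = s1].
  move=> zs mt; have [fs|[y ya E]] := strandVouter f; last first.
    by rewrite E in mt; case: (no2 _ _ _ _ zs ya mt).
  have [[zE fE]|[zE fE]] := self2 _ _ _ _ zs fs mt; subst z f; [left|right].
    by have [-> ->] := meet_param g2 mt m13.
  by have [-> ->] := meet_param g2 mt (meet_sym m13).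
have const1 u (F : R -> Q) : strand_coloring lab1 u F ->
    forall c : R, 0 <= c <= (size (Nil (R * R))).+1%:R -> F c = F 0.
  move=> sc; apply: (strand_const sc) => // z s f t zs _ mt.
  have [fs|[y ya E]] := strandVouter f; first by case: (self1 _ _ _ _ zs fs mt).
  by rewrite E in mt; case: (no1 _ _ _ _ zs ya mt).
have const2 u (F : R -> Q) : strand_coloring lab2 u F ->
    forall c : R, 0 <= c <= (size [:: p; q]).+1%:R -> F c = F 0.
  move=> sc c; rewrite size2 => c03; case E : (lab2 e1 e3) cl lm => [| |//] _ lm.
  - have C : forall d : R, 0 <= d <= 2 + s3 -> F d = F 0.
      apply: (strand_const sc); rewrite ?size2 //; first by lra.
      move=> z s f t zs + mt; have [[-> -> -> _]|[-> -> _ _]] := meetE _ _ _ _ zs mt => //.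
      by rewrite p3 => h; exfalso; lra.
    have [c1|c1] := leP c (2 + s3); first by apply: C; lra.
    have K d : 2 + s3 < d <= 3 ->
        F d = act (lab2 e3 e1) (0 < det2 (dir e3) (dir e1)) (F (2 + s3)) (F s1).
      move=> d3; rewrite -[in F s1]p1 -(glue_strand u F s1 e1s) -p3.
      apply: (strand_after sc e3s (meet_sym m13) (B := 3)); rewrite ?size2 ?p3 //; first by lra.
      move=> z s f t zs + mt; have [[-> -> _ _]|[-> -> _ _]] := meetE _ _ _ _ zs mt.
        by rewrite p1 => h; exfalso; lra.
      by rewrite p3 => h; exfalso; lra.
    rewrite K; last by rewrite c1; case/andP: c03.
    rewrite lm /= !C; [|lra|lra].
    by case: ifP => _; rewrite -{1}(qop_idem (F 0)) ?qopK ?qop_idem.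
  - have C : forall d : R, 0 <= d <= s1 -> F d = F 0.
      apply: (strand_const sc); rewrite ?size2 //; first by lra.
      move=> z s f t zs + mt; have [[-> -> _ _]|[-> -> -> _]] := meetE _ _ _ _ zs mt.
        by rewrite p1 => h; exfalso; lra.
      by rewrite p3 => h; exfalso; lra.
    have [c1|c1] := leP c s1; first by apply: C; lra.
    have K d : s1 < d <= 3 ->
        F d = act Under (0 < det2 (dir e1) (dir e3)) (F 0) (F (2 + s3)).
      move=> d3; rewrite -(C s1); last by lra.
      rewrite -p3 -(glue_strand u F s3 e3s) -E -[in F s1]p1.
      apply: (strand_after sc e1s m13 (B := 3)); rewrite ?size2 ?p1 //; first by lra.
      move=> z s f t zs + mt; have [[-> -> _ _]|[-> -> -> _]] := meetE _ _ _ _ zs mt.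
        by rewrite p1 => h; exfalso; lra.
      by rewrite lm.
    (* The first passage is the lower one here, so the colour [d] after the crossing is also that of
       the over-strand. It solves [d = F 0 * d] or [d = F 0 / d], and [F 0] is the only solution. *)
    have K3 := K (2 + s3); rewrite K; last by rewrite c1; case/andP: c03.
    have {K3} := K3 ltac:(lra); set d := F (2 + s3); rewrite /act.
    case: ifP => _ dE; rewrite -dE.
      by rewrite -[RHS](qdivK d) /= -dE qop_idem.
    by rewrite -[RHS](qopK d) /= -dE -{2}(qop_idem d) qopK.
pose M (u : vtx P -> R -> Q) (F : R -> Q) (u' : vtx P -> R -> Q) (F' : R -> Q) :=
  (forall x (s : R), x != a -> 0 <= s <= 1 -> u x s = u' x s) /\ F 0 = F' 0.
have so' : same_outside lab2 lab1 by move=> x y xa ya c; rewrite so.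
have ov : forall c : R, 0 <= c <= (size [:: p; q]).+1%:R -> True by [].
apply: (@strand_card_eq _ _ _ _ _ _ _ _ _ ok1 ok2 M) => [u F sc|u F sc|u F u' F' v G v' G' s s' t
  t' [M1 M2] [N1 N2]].
- exists u, (fun _ => F 0); split=> //; apply: (idle_strand_transfer ok1 ok2 so no1 no2 _ _ sc);
    last exact: const1 sc.
  move=> z w s t zs ws /(self2 _ _ _ _ zs ws)[[-> ->]|[-> ->]] //.
  by rewrite lm; case: (lab2 e1 e3) cl.
- exists u, (fun _ => F 0); split=> //; apply: (idle_strand_transfer ok2 ok1 so' no2 no1 _ _ sc);
    last exact: const2 sc.
  by move=> z w s t zs ws /(self1 _ _ _ _ zs ws).
split=> -[h1 h2]; split=> [x r xa r01|c c01].
- by rewrite -M1 // -N1 // h1.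
- by rewrite (const2 _ _ s') // (const2 _ _ t') // -M2 -N2 h2 // lexx ler01.
- by rewrite M1 // N1 // h1.
- by rewrite (const1 _ _ s) // (const1 _ _ t) // M2 N2 h2 // lexx ler0n.
Qed.

End IdleStrands.

(** * Winding numbers and the detour move *)

Section AutPowers.
Variables (T : Type) (Q : operator_quandle T).
Implicit Types (alpha beta : T) (n : int) (x y : Q).

Definition apow alpha n x : Q :=
  match n with
  | Posz k => iter k (aut alpha) x
  | Negz k => iter k.+1 (autV alpha) x
  end.

Lemma apowS alpha n x : apow alpha (n + 1) x = aut alpha (apow alpha n x).
Proof.
case: n => [k|[|k]]; first by rewrite -PoszD addn1.
  by rewrite (_ : Negz 0 + 1 = 0) //= autVK.
have -> : Negz k.+1 + 1 = Negz k by rewrite !NegzE -[k.+2]addn1 PoszD; lia.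
by rewrite /= autVK.
Qed.

Lemma apowP alpha n x : apow alpha (n - 1) x = autV alpha (apow alpha n x).
Proof. by rewrite -{2}(subrK 1 n) apowS autK. Qed.

Lemma apowD alpha m n x : apow alpha (m + n) x = apow alpha m (apow alpha n x).
Proof.
elim/int_rect: m => [|k IH|k IH]; first by rewrite add0r.
  by rewrite -addn1 PoszD addrAC !apowS IH.
have -> : - (k.+1%:Z) = - k%:Z - 1 by rewrite -addn1 PoszD opprD.
by rewrite addrAC !apowP IH.
Qed.

Lemma apowK alpha n : cancel (apow alpha n) (apow alpha (- n)).
Proof. by move=> x; rewrite -apowD addNr. Qed.

Lemma autV_comm alpha beta x : autV beta (aut alpha x) = aut alpha (autV beta x).
Proof. by rewrite -{1}(autVK beta x) aut_comm autK. Qed.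

Lemma qdiv_aut alpha x y : aut alpha (qdiv x y) = qdiv (aut alpha x) (aut alpha y).
Proof. by rewrite -{2}(qdivK y x) autM qopK. Qed.

(** Classical crossings use that [alpha] is an automorphism, virtual ones that the operators
    commute. *)
Lemma aut_act alpha (l : passage T) b x y :
  aut alpha (act l b x y) = act l b (aut alpha x) (aut alpha y).
Proof.
case: l => [| |beta] //=; case: b; rewrite ?qdiv_aut ?autM ?autV_comm //.
exact: aut_comm.
Qed.

Lemma autV_act alpha (l : passage T) b x y :
  autV alpha (act l b x y) = act l b (autV alpha x) (autV alpha y).
Proof. by rewrite -{1}(autVK alpha x) -{1}(autVK alpha y) -aut_act autK. Qed.

Lemma apow_act alpha n (l : passage T) b x y :
  apow alpha n (act l b x y) = act l b (apow alpha n x) (apow alpha n y).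
Proof.
case: n => k /=; first by elim: k => //= k ->; exact: aut_act.
by rewrite -!iterS; elim: k.+1 => //= j ->; exact: autV_act.
Qed.

End AutPowers.

(** * Crossings of an edge with a horizontal ray *)

Section RayCount.
Variable R : realType.
Implicit Types (al be : R) (q d u v : R * R).

(* Sign conditions on [al + h * be] for small positive [h]. *)
Definition lexpos al be := (0 < al) || ((al == 0) && (0 < be)).
Definition lexnn al be := (0 < al) || ((al == 0) && (0 <= be)).

Lemma lexposP al be : exists2 e : R, 0 < e & forall h, 0 < h < e ->
  (0 < al + h * be) = lexpos al be.
Proof.
rewrite /lexpos; have [a0|a0|->] := ltrgt0P al; last first.
- by exists 1 => // h /andP[h0 _]; rewrite add0r pmulr_rgt0.
- have [b0|b0] := leP be 0.
    exists 1 => // h /andP[h0 _]; have := mulr_ge0_le0 (ltW h0) b0 => hb.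
    suff -> : (0 < al + h * be) = false by rewrite /= ?andbF.
    by apply/negbTE; rewrite -leNgt; lra.
  exists (- al / be); first by rewrite divr_gt0 // oppr_gt0.
  move=> h /andP[h0]; rewrite ltr_pdivlMr // => hb.
  suff -> : (0 < al + h * be) = false by [].
  by apply/negbTE; rewrite -leNgt; lra.
- have [b0|b0] := leP 0 be.
    exists 1 => // h /andP[h0 _]; have := mulr_ge0 (ltW h0) b0 => hb.
    by suff -> : 0 < al + h * be by []; lra.
  exists (al / - be); first by rewrite divr_gt0 // oppr_gt0.
  move=> h /andP[h0]; rewrite ltr_pdivlMr ?oppr_gt0 // => hb.
  by suff -> : 0 < al + h * be by []; lra.
Qed.

Lemma lexnnE al be : lexnn al be = ~~ lexpos (- al) (- be).
Proof. by rewrite /lexnn /lexpos !oppr_gt0 oppr_eq0; case: ltrgt0P => //= _; rewrite leNgt. Qed.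

Lemma lexnnP al be : exists2 e : R, 0 < e & forall h, 0 < h < e -> (0 <= al + h * be) = lexnn al be.
Proof.
have [e e0 H] := lexposP (- al) (- be); exists e => // h /H; rewrite lexnnE => <-.
by rewrite leNgt mulrN -opprD oppr_gt0.
Qed.

Definition edge_count (up down left right : bool) : int :=
  (up && left)%:R - (down && right)%:R.

(* Signed number of crossings of the edge from [u] to [v] with the horizontal
   ray to the right of [q], and its limit as [q] is approached along [d]. *)
Definition ray q u v : int :=
  edge_count ((u.2 <= q.2) && (q.2 < v.2)) ((v.2 <= q.2) && (q.2 < u.2))
    (0 < det2 (v - u) (q - u)) (0 < - det2 (v - u) (q - u)).

Definition ray_limit q d u v : int :=
  edge_count (lexnn (q.2 - u.2) d.2 && lexpos (v.2 - q.2) (- d.2))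
    (lexnn (q.2 - v.2) d.2 && lexpos (u.2 - q.2) (- d.2))
    (lexpos (det2 (v - u) (q - u)) (det2 (v - u) d))
    (lexpos (- det2 (v - u) (q - u)) (- det2 (v - u) d)).

Lemma ray_limitP q d u v : exists2 e : R, 0 < e &
  forall h, 0 < h < e -> ray (q + h *: d) u v = ray_limit q d u v.
Proof.
have [e1 p1 H1] := lexnnP (q.2 - u.2) d.2.
have [e2 p2 H2] := lexposP (v.2 - q.2) (- d.2).
have [e3 p3 H3] := lexnnP (q.2 - v.2) d.2.
have [e4 p4 H4] := lexposP (u.2 - q.2) (- d.2).
have [e5 p5 H5] := lexposP (det2 (v - u) (q - u)) (det2 (v - u) d).
have [e6 p6 H6] := lexposP (- det2 (v - u) (q - u)) (- det2 (v - u) d).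
exists (Num.min e1 (Num.min e2 (Num.min e3 (Num.min e4 (Num.min e5 e6))))).
  by rewrite !lt_min p1 p2 p3 p4 p5 p6.
move=> h; rewrite !lt_min => /andP[h0 /and5P[h1 h2 h3 h4 /andP[h5 h6]]].
have E : det2 (v - u) (q + h *: d - u) = det2 (v - u) (q - u) + h * det2 (v - u) d.
  by rewrite /det2 /= /GRing.scale /=; ring.
rewrite /ray /ray_limit -(H1 h) ?h0 // -(H2 h) ?h0 // -(H3 h) ?h0 // -(H4 h) ?h0 // -(H5 h) ?h0 //
  -(H6 h) ?h0 //.
rewrite E; congr (edge_count (_ && _) (_ && _) _ _); rewrite /= /GRing.scale /=; apply/idP/idP; lra.
Qed.

Lemma ray_limit0 q u v : ray_limit q 0 u v = ray q u v.
Proof.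
have D0 : det2 (v - u) 0 = 0 :> R by rewrite /det2 /= !mulr0 subrr.
rewrite /ray /ray_limit D0 /= oppr0 /lexpos /lexnn lexx ltxx !andbF !orbF !andbT.
congr (edge_count (_ && _) (_ && _) _ _); rewrite ?subr_gt0 //.
  by rewrite subr_eq0 le_eqVlt orbC eq_sym.
by rewrite subr_eq0 le_eqVlt orbC eq_sym.
Qed.

End RayCount.

Section RayJump.
Variable R : realType.
Implicit Types q d u v : R * R.

Definition bsg (x : R) : int := (0 < x)%R%:R - (x < 0)%R%:R.

Lemma bsgN (x : R) : bsg (- x) = - bsg x.
Proof. by rewrite /bsg oppr_gt0 oppr_lt0 opprB. Qed.

(* Contribution of the end [u] of an edge when the ray sweeps over it. *)
Definition sweep q d u : int := ((u.2 == q.2) && (q.1 < u.1))%R%:R * bsg d.2.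

(** [ray_limit] in coordinates centred at [q]: [a2] and [b2] are the heights of the ends, [D] and
    [E] the determinants of the edge with [q - u] and with the direction of approach. *)
Let side_count (a2 b2 d2 D E : R) : int :=
  edge_count (lexnn (- a2) d2 && lexpos b2 (- d2)) (lexnn (- b2) d2 && lexpos a2 (- d2))
    (lexpos D E) (lexpos (- D) (- E)).

Let swept (a1 a2 d2 : R) : int := ((a2 == 0) && (0 < a1))%R%:R * bsg d2.

Let count_unfold (a2 b2 d2 D E : R) :
  side_count a2 b2 d2 D E - side_count a2 b2 (- d2) D (- E) =
  (((a2 < 0) || (a2 == 0) && (0 <= d2)) && ((0 < b2) || (b2 == 0) && (d2 < 0)) &&
    ((0 < D) || (D == 0) && (0 < E)))%R%:R -
  (((b2 < 0) || (b2 == 0) && (0 <= d2)) && ((0 < a2) || (a2 == 0) && (d2 < 0)) &&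
    ((D < 0) || (D == 0) && (E < 0)))%R%:R -
  ((((a2 < 0) || (a2 == 0) && (d2 <= 0)) && ((0 < b2) || (b2 == 0) && (0 < d2)) &&
    ((0 < D) || (D == 0) && (E < 0)))%R%:R -
  (((b2 < 0) || (b2 == 0) && (d2 <= 0)) && ((0 < a2) || (a2 == 0) && (0 < d2)) &&
    ((D < 0) || (D == 0) && (0 < E)))%R%:R).
Proof.
by rewrite /side_count /edge_count /lexpos /lexnn !opprK !oppr_gt0 !oppr_eq0 !oppr_ge0.
Qed.

(** Off the edge, the counts ahead of [q] and behind it differ only when [q] has the height of an
    end to its right. The alternatives describe a point off the edge: off its line, with both ends
    strictly above or strictly below, or at the height of a horizontal edge with both ends strictly
    to one side. *)
Let side_count_jump (a1 a2 b1 b2 d2 D E : R) : D = a1 * b2 - a2 * b1 ->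
  [\/ D != 0, 0 < a2 * b2 | [/\ a2 = 0, b2 = 0 & 0 < a1 * b1]] ->
  side_count a2 b2 d2 D E - side_count a2 b2 (- d2) D (- E) = swept a1 a2 d2 - swept b1 b2 d2.
Proof.
move=> DE H; rewrite count_unfold /swept /bsg; have [ha|ha|ha] := ltrgt0P a2; have [hb|hb|hb] :=
  ltrgt0P b2.
- by case: (ltrgt0P d2); rewrite /= ?andbF.
- have D0 : D != 0 by case: H => // [|[]]; nra.
  by case: ltrgt0P D0; case: (ltrgt0P d2).
- have D0 : D != 0 by case: H => // [|[]]; nra.
  have -> : (0 < b1) = (D < 0) by rewrite DE hb mulr0 sub0r oppr_lt0 pmulr_rgt0.
  by case: ltrgt0P D0; case: (ltrgt0P d2).
- have D0 : D != 0 by case: H => // [|[]]; nra.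
  by case: ltrgt0P D0; case: (ltrgt0P d2).
- by case: (ltrgt0P d2); rewrite /= ?andbF.
- have D0 : D != 0 by case: H => // [|[]]; nra.
  have -> : (0 < b1) = (0 < D) by rewrite DE hb mulr0 sub0r oppr_gt0 nmulr_rlt0.
  by case: ltrgt0P D0; case: (ltrgt0P d2).
- have D0 : D != 0 by case: H => // [|[]]; nra.
  have -> : (0 < a1) = (0 < D) by rewrite DE ha mul0r subr0 pmulr_lgt0.
  by case: ltrgt0P D0; case: (ltrgt0P d2).
- have D0 : D != 0 by case: H => // [|[]]; nra.
  have -> : (0 < a1) = (D < 0) by rewrite DE ha mul0r subr0 nmulr_llt0.
  by case: ltrgt0P D0; case: (ltrgt0P d2).
- have ab : 0 < a1 * b1 by case: H => [||[]//]; rewrite ?DE ha hb ?mulr0 ?mul0r ?subr0 ?eqxx ?ltxx.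
  have -> : (0 < b1) = (0 < a1) by apply/idP/idP => h; nra.
  by case: (ltrgt0P d2); rewrite /= ?andbF ?subrr.
Qed.

(** At an interior point of the edge the determinant changes sign with the direction, which adds the
    crossing sign [bsg E] to the contributions of the ends. For a horizontal edge exactly one end is
    to the right of [q]. *)
Let side_count_cross (a1 a2 b1 b2 d2 D E : R) : D = 0 -> E != 0 ->
  a2 * b2 < 0 \/ [/\ a2 = 0, b2 = 0, a1 * b1 < 0 & E = (b1 - a1) * d2] ->
  side_count a2 b2 d2 D E - side_count a2 b2 (- d2) D (- E) =
    bsg E + swept a1 a2 d2 - swept b1 b2 d2.
Proof.
move=> D0 E0 H; rewrite count_unfold /swept D0 ltxx eqxx /bsg.
case: H => [ab|[-> -> ab EE]].
  have [ha|ha|ha] := ltrgt0P a2; have [hb|hb|hb] := ltrgt0P b2; try (by exfalso; nra).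
    by case: ltrgt0P E0; case: (ltrgt0P d2).
  by case: ltrgt0P E0; case: (ltrgt0P d2).
rewrite ltxx eqxx EE; have [hd|hd|hd] := ltrgt0P d2; last by rewrite EE hd mulr0 eqxx in E0.
  rewrite pmulr_lgt0 // pmulr_llt0 // subr_gt0 subr_lt0.
  have [ha|ha|ha] := ltrgt0P a1; have [hb|hb|hb] := ltrgt0P b1; try (by exfalso; nra).
    by rewrite (lt_trans hb ha) (lt_gtF (lt_trans hb ha)).
  by rewrite (lt_trans ha hb) (lt_gtF (lt_trans ha hb)).
rewrite nmulr_lgt0 // nmulr_llt0 // subr_gt0 subr_lt0.
have [ha|ha|ha] := ltrgt0P a1; have [hb|hb|hb] := ltrgt0P b1; try (by exfalso; nra).
  by rewrite (lt_trans hb ha) (lt_gtF (lt_trans hb ha)).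
by rewrite (lt_trans ha hb) (lt_gtF (lt_trans ha hb)).
Qed.

Definition off_edge q u v := forall h : R, 0 <= h <= 1 -> u + h *: (v - u) <> q.

Let ray_limitE q d u v : ray_limit q d u v =
  side_count (u.2 - q.2) (v.2 - q.2) d.2 (det2 (v - u) (q - u)) (det2 (v - u) d).
Proof. by rewrite /ray_limit /side_count !opprB. Qed.

Let sweepE q d u : sweep q d u = swept (u.1 - q.1) (u.2 - q.2) d.2.
Proof. by rewrite /sweep /swept subr_eq0 subr_gt0. Qed.

Let det2N (u v : R * R) : det2 u (- v) = - det2 u v.
Proof. by rewrite /det2 /=; ring. Qed.

Let ratio01 (x y : R) : x * y <= 0 -> x != y -> 0 <= x / (x - y) <= 1.
Proof.
move=> xy0; rewrite neq_lt => /orP[xy|xy].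
  have x0 : x <= 0 by rewrite leNgt; apply/negP => x0; nra.
  have y0 : 0 <= y by rewrite leNgt; apply/negP => y0; nra.
  have d0 : 0 < y - x by lra.
  have -> : x / (x - y) = (- x) / (y - x) by field; apply/andP; split; lra.
  by rewrite divr_ge0 ?ler_pdivrMr //; lra.
have x0 : 0 <= x by rewrite leNgt; apply/negP => x0; nra.
have y0 : y <= 0 by rewrite leNgt; apply/negP => y0; nra.
have d0 : 0 < x - y by lra.
by rewrite divr_ge0 ?ler_pdivrMr //; lra.
Qed.

Lemma off_edge_cases q u v : off_edge q u v ->
  [\/ det2 (v - u) (q - u) != 0, 0 < (u.2 - q.2) * (v.2 - q.2) |
     [/\ u.2 - q.2 = 0, v.2 - q.2 = 0 & 0 < (u.1 - q.1) * (v.1 - q.1)]].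
Proof.
move=> off; rewrite /det2 /=.
set a1 := u.1 - q.1; set a2 := u.2 - q.2; set b1 := v.1 - q.1; set b2 := v.2 - q.2.
have -> : (v.1 - u.1) * (q.2 - u.2) - (v.2 - u.2) * (q.1 - u.1) = a1 * b2 - a2 * b1.
  by rewrite /a1 /a2 /b1 /b2; ring.
have [D0|D0] := eqVneq (a1 * b2 - a2 * b1) 0; last by apply: Or31.
have [ab|ab] := ltP 0 (a2 * b2); first by apply: Or32.
have [ab2|ab2] := eqVneq a2 b2; last first.
  (* At this parameter the edge has the height of [q]; since [D0] puts [q] on the line, the point is
     [q] itself. *)
  case: (off (a2 / (a2 - b2))); first exact: ratio01.
  have ab0 : a2 - b2 != 0 by rewrite subr_eq0.
  apply/pair_eqP; rewrite /= /GRing.scale /=; split.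
    have -> : u.1 + a2 / (a2 - b2) * (v.1 - u.1) = q.1 - (a1 * b2 - a2 * b1) / (a2 - b2).
      by rewrite /a1 /b1; field.
    by rewrite D0 mul0r subr0.
  have -> : v.2 - u.2 = b2 - a2 by rewrite /a2 /b2; ring.
  have -> : u.2 = q.2 + a2 by rewrite /a2; ring.
  by field.
have a20 : a2 = 0 by apply/eqP; move: ab; rewrite -ab2 -expr2 le_eqVlt ltNge sqr_ge0 orbF sqrf_eq0.
have b20 : b2 = 0 by rewrite -ab2.
have [ab1|ab1] := ltP 0 (a1 * b1); first by apply: Or33.
have u2 : u.2 = q.2 by move: a20; rewrite /a2; lra.
have v2 : v.2 = q.2 by move: b20; rewrite /b2; lra.
have [ab3|ab3] := eqVneq a1 b1.
  have a10 : a1 = 0 by apply/eqP; move: ab1;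
    rewrite -ab3 -expr2 le_eqVlt ltNge sqr_ge0 orbF sqrf_eq0.
  case: (off 0); first by rewrite lexx ler01.
  by rewrite scale0r addr0; apply/pair_eqP; split=> //; move: a10; rewrite /a1; lra.
(* For a horizontal edge at the height of [q] the same ratio is taken horizontally. *)
case: (off (a1 / (a1 - b1))); first exact: ratio01.
have ab0 : a1 - b1 != 0 by rewrite subr_eq0.
apply/pair_eqP; rewrite /= /GRing.scale /= u2 v2 subrr mulr0 addr0; split=> //.
have -> : v.1 - u.1 = b1 - a1 by rewrite /a1 /b1; ring.
have -> : u.1 = q.1 + a1 by rewrite /a1; ring.
by field.
Qed.

Lemma ray_limit_off q d u v : off_edge q u v ->
  ray_limit q d u v - ray_limit q (- d) u v = sweep q d u - sweep q d v.
Proof.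
move=> off; rewrite !ray_limitE !sweepE det2N; apply: side_count_jump.
  by rewrite /det2 /=; ring.
exact: off_edge_cases.
Qed.

(** The convention [u.2 <= q.2 < v.2] assigns a height to the part above it, so off the edge [ray]
    does not jump when [q] moves upwards or sideways. *)
Lemma ray_limit_up q d u v : off_edge q u v -> 0 <= d.2 -> ray_limit q d u v = ray q u v.
Proof.
move=> off d2; have := off_edge_cases off; rewrite -ray_limit0 !ray_limitE.
have -> : det2 (v - u) 0 = 0 :> R by rewrite /det2 /= !mulr0 subrr.
move: (u.2 - q.2) (v.2 - q.2) (u.1 - q.1) (v.1 - q.1) => a2 b2 a1 b1.
move: (det2 (v - u) d) (det2 (v - u) (q - u)) => E D H.
rewrite /side_count /lexpos /lexnn /= d2 !oppr0 lexx ltxx !oppr_gt0 (le_gtF d2) !andbF !orbF !andbT.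
case: H => [D0|ab|[-> -> _]].
- by rewrite !oppr_eq0 (negbTE D0) /= ?orbF.
- rewrite !oppr_eq0; move: ab.
  have [ha|ha|->] := ltrgt0P a2; have [hb|hb|->] := ltrgt0P b2; rewrite ?mulr0 ?mul0r ?ltxx //.
    by rewrite nmulr_lgt0 // => h; move: (lt_trans h ha); rewrite ltxx.
  by rewrite pmulr_lgt0 // => h; move: (lt_trans h ha); rewrite ltxx.
- by rewrite ltxx !andbF.
Qed.

Lemma ray_limit_cross q d u v (h : R) : 0 < h < 1 -> q = u + h *: (v - u) -> det2 (v - u) d != 0 ->
  ray_limit q d u v - ray_limit q (- d) u v = bsg (det2 (v - u) d) + sweep q d u - sweep q d v.
Proof.
move=> h01 qE d0; rewrite !ray_limitE !sweepE det2N; apply: side_count_cross => //.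
  by rewrite qE /det2 /= /GRing.scale /=; ring.
have E1 : u.1 - q.1 = - h * (v.1 - u.1) by rewrite qE /= /GRing.scale /=; ring.
have E2 : u.2 - q.2 = - h * (v.2 - u.2) by rewrite qE /= /GRing.scale /=; ring.
have E3 : v.1 - q.1 = (1 - h) * (v.1 - u.1) by rewrite qE /= /GRing.scale /=; ring.
have E4 : v.2 - q.2 = (1 - h) * (v.2 - u.2) by rewrite qE /= /GRing.scale /=; ring.
have hh : 0 < h * (1 - h) by rewrite mulr_gt0; lra.
have [vu2|vu2] := eqVneq (v.2 - u.2) 0.
  right; rewrite E2 E4 vu2 !mulr0; split=> //; last first.
    by rewrite /det2 /= vu2 mul0r subr0 E1 E3; ring.
  have vu1 : v.1 - u.1 != 0.
    by apply: contraNN d0 => /eqP h0; rewrite /det2 /= h0 vu2 !mul0r subrr.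
  have -> : (u.1 - q.1) * (v.1 - q.1) = - ((h * (1 - h)) * (v.1 - u.1) ^+ 2).
    by rewrite E1 E3; ring.
  by rewrite oppr_lt0 mulr_gt0 // exprn_even_gt0.
left; have -> : (u.2 - q.2) * (v.2 - q.2) = - ((h * (1 - h)) * (v.2 - u.2) ^+ 2).
  by rewrite E2 E4; ring.
by rewrite oppr_lt0 mulr_gt0 // exprn_even_gt0.
Qed.

End RayJump.

Section StrandCount.
Variables (R : realType) (P : polygon R) (a : vtx P) (l : seq (R * R)).
Local Notation J := (insert a l).
Implicit Types (x y : vtx P) (z w : vtx J) (q d : R * R).

Definition strand_count q d : int :=
  \sum_(z : vtx J | on_strand z) ray_limit q d (pos z) (pos (nextv z)).

Definition off_strand q := forall z, on_strand z -> off_edge q (pos z) (pos (nextv z)).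

(** [nextv] permutes the vertices of [insert a l] and of [P], so both total sums vanish, and away
    from the strand their terms agree. What remains on either side is the strand and the edge
    [a]. *)
Lemma strand_telescope (h : R * R -> int) :
  \sum_(z : vtx J | on_strand z) (h (pos z) - h (pos (nextv z))) = h (pos a) - h (pos (nextv a)).
Proof.
have reindex_next (D : polygon R) (g : vtx D -> int) :
    \sum_(v : vtx D) g (nextv v) = \sum_(v : vtx D) g v.
  by rewrite [RHS](reindex_inj (@nextv_inj _ D)).
have tot (D : polygon R) (g : vtx D -> int) : \sum_(v : vtx D) (g v - g (nextv v)) = 0.
  by rewrite sumrB reindex_next subrr.
have := tot J (fun z => h (pos z)); rewrite (bigID (fun z : vtx J => on_strand z)) /=.
move/eqP; rewrite addr_eq0 => /eqP ->.
have := tot P (fun x => h (pos x)); rewrite (bigD1 a) //= => /eqP; rewrite addr_eq0 => /eqP ->.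
congr (- _); rewrite (big_sumType _ _ _) /=.
rewrite [X in _ + X]big1 ?addr0 => [|i]; last by [].
by apply: eq_bigr => x xa; rewrite (negbTE xa).
Qed.

Lemma off_edge_outer x s z : generic J -> x != a -> 0 <= s < 1 -> (s = 0 -> x <> nextv a) ->
  on_strand z -> (forall t, ~ @meet_at _ J (inl x) s z t) ->
    off_edge (pt x s) (pos z) (pos (nextv z)).
Proof.
move=> gJ xa s01 xb zs nm c /andP[h0]; rewrite le_eqVlt => /orP[/eqP ->|h1]; last first.
  move=> E; apply: (nm c); split; rewrite ?h0 //.
    by apply: contraNneq xa => E'; rewrite -E' in zs.
  by rewrite outer_pt.
(* [meet_at] leaves out the end of [z], which starts the next edge. This is another strand edge, or
   [nextv a], where the condition on [s = 0] enters. *)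
rewrite scale1r addrC subrK => E.
have [h|h] := ltnP (rk z) (size l).
  have [nzs _] := rk_next zs h.
  have [||[E' _]|[_ + _]] := gJ.1 (inl x) (nextv z) s 0 s01 _ _; rewrite ?lexx ?ltr01 ?ltxx //.
    by rewrite pt0 outer_pt.
  by move: nzs; rewrite -E' /= (negbTE xa).
have [b bE] : exists b, nextv z = inl b /\ b = nextv a.
  by exists (nextv a); split=> //; apply: strand_last => //; apply/eqP; rewrite eqn_leq rk_le.
case: bE => bE ba.
have [||[[E'] sE]|[_ + _]] := gJ.1 (inl x) (inl b) s 0 s01 _ _; rewrite ?lexx ?ltr01 ?ltxx //.
  by rewrite pt0 outer_pt // -E bE.
by case: (xb sE); rewrite E'.
Qed.

Definition strand_jump x s : int := \sum_(z : vtx J | on_strand z)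
  (if `[< exists t, @meet_at _ J (inl x) s z t >] then bsg (det2 (dir z) (dir x)) else 0).

(** The contributions of the inner vertices of the strand telescope, so besides the crossings only
    the two ends of the strand are felt. *)
Lemma strand_count_jump x s : generic J -> x != a -> 0 < s < 1 ->
  strand_count (pt x s) (dir x) - strand_count (pt x s) (- dir x) =
  strand_jump x s + (sweep (pt x s) (dir x) (pos a) - sweep (pt x s) (dir x) (pos (nextv a))).
Proof.
move=> gJ xa s01; rewrite -(strand_telescope (sweep (pt x s) (dir x))).
rewrite /strand_count /strand_jump -sumrB -big_split /=; apply: eq_bigr => z zs.
case: asboolP => [[t mt]|nm]; last first.
  rewrite add0r; apply: ray_limit_off; apply: off_edge_outer => //; first by lra.
    by move=> s0; exfalso; lra.
  by move=> t mt; apply: nm; exists t.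
have [_ t01 d0] := meet_interior gJ (meet_sym mt); have mt' := meet_sym mt.
have [_ t01' d0'] := meet_interior gJ mt.
rewrite outer_dir // in d0.
rewrite (@ray_limit_cross _ _ _ _ _ t) // ?addrA //.
by case: mt => _ _ _; rewrite outer_pt.
Qed.

Lemma strand_jump_free x s : (forall z t, on_strand z -> ~ @meet_at _ J (inl x) s z t) ->
  strand_jump x s = 0.
Proof.
by move=> nm; apply: big1 => z zs; case: asboolP => // -[t /nm]; case.
Qed.

Lemma strand_jump_meet x s z t : generic J -> on_strand z -> @meet_at _ J (inl x) s z t ->
  strand_jump x s = bsg (det2 (dir z) (dir x)).
Proof.
move=> gJ zs mt; rewrite /strand_jump (bigD1 z) //=.
case: asboolP => [_|[]]; last by exists t.
rewrite big1 ?addr0 // => w /andP[_ wz]; case: asboolP => // -[t' mt'].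
by have [E _] := meet_edge gJ mt mt'; rewrite E eqxx in wz.
Qed.

Lemma near_strand_count_right x s :
  \forall r \near s^'+, strand_count (pt x r) 0 = strand_count (pt x s) (dir x).
Proof.
have h : \forall r \near s^'+, forall z : vtx J,
    ray (pt x r) (pos z) (pos (nextv z)) = ray_limit (pt x s) (dir x) (pos z) (pos (nextv z)).
  apply: filter_forall => z; have [e e0 H] := ray_limitP (pt x s) (dir x) (pos z) (pos (nextv z)).
  apply/near_rightP; exists (s + e) => [|r rs]; first by lra.
  rewrite -(H (r - s)); last by lra.
  by rewrite /pt -addrA -scalerDl subrKC.
near=> r; apply: eq_bigr => z _; rewrite ray_limit0.
have H : forall z : vtx J, ray (pt x r) (pos z) (pos (nextv z)) =
  ray_limit (pt x s) (dir x) (pos z) (pos (nextv z)) by near: r.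
exact: H.
Unshelve. all: by end_near. Qed.

Lemma near_strand_count_left x s :
  \forall r \near s^'-, strand_count (pt x r) 0 = strand_count (pt x s) (- dir x).
Proof.
have h : \forall r \near s^'-, forall z : vtx J,
    ray (pt x r) (pos z) (pos (nextv z)) = ray_limit (pt x s) (- dir x) (pos z) (pos (nextv z)).
  apply: filter_forall => z; have [e e0 H] := ray_limitP (pt x s) (- dir x) (pos z) (pos (nextv z)).
  apply/near_leftP; exists (s - e) => [|r rs]; first by lra.
  rewrite -(H (s - r)); last by lra.
  by rewrite /pt scalerN -scaleNr opprB -addrA -scalerDl subrKC.
near=> r; apply: eq_bigr => z _; rewrite ray_limit0.
have H : forall z : vtx J, ray (pt x r) (pos z) (pos (nextv z)) =
  ray_limit (pt x s) (- dir x) (pos z) (pos (nextv z)) by near: r.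
exact: H.
Unshelve. all: by end_near. Qed.

End StrandCount.

Section Winding.
Variables (R : realType) (P : polygon R) (a : vtx P) (l1 l2 : seq (R * R)).
Hypotheses (g1 : generic (insert a l1)) (g2 : generic (insert a l2)).
Implicit Types (x y : vtx P) (q d : R * R).

(* The winding number around [q], seen in the direction [d], of the new strand
   followed by the reversed old one. *)
Definition winding q d : int := strand_count a l2 q d - strand_count a l1 q d.

(** The limit from the left along [x], as for colours. At parameter 0 there is no left side, so the
    view forward along the edge is taken; [winding_at_next] shows that it fits the end of the
    preceding edge. *)
Definition winding_at x s : int :=
  if s == 0 then winding (pos x) (dir x) else winding (pt x s) (- dir x).

(** When [q] is passed, the count of each strand changes by the sweep over its ends. The strands
    share these, so the views along [d] and [- d] agree, and for the upward one [ray_limit_up]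
    applies. *)
Lemma winding_off q d : off_strand a l1 q -> off_strand a l2 q -> winding q d = winding q 0.
Proof.
move=> o1 o2.
have W d' : winding q d' = winding q (- d').
  have jump l : off_strand a l q -> strand_count a l q d' - strand_count a l q (- d') =
      sweep q d' (pos a) - sweep q d' (pos (nextv a)).
    move=> o; rewrite -(@strand_telescope _ _ a l (sweep q d')) /strand_count -sumrB.
    by apply: eq_bigr => z zs; apply: ray_limit_off; exact: o.
  have := jump _ o1; have := jump _ o2; rewrite /winding; lia.
have up d' : 0 <= d'.2 -> winding q d' = winding q 0.
  move=> d0; congr (_ - _); apply: eq_bigr => z zs.
    by rewrite ray_limit0 ray_limit_up //; exact: o2.
  by rewrite ray_limit0 ray_limit_up //; exact: o1.
have [d0|d0] := leP 0 d.2; first exact: up.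
by rewrite W up //= oppr_ge0 ltW.
Qed.

Lemma winding_outer x s d : x != a -> 0 <= s < 1 -> (s = 0 -> x <> nextv a) ->
  (forall z t, on_strand z -> ~ @meet_at _ (insert a l1) (inl x) s z t) ->
  (forall z t, on_strand z -> ~ @meet_at _ (insert a l2) (inl x) s z t) ->
  winding (pt x s) d = winding (pt x s) 0.
Proof.
move=> xa s01 xb n1 n2; apply: winding_off => z zs.
  by apply: (off_edge_outer g1) => // t; exact: n1.
by apply: (off_edge_outer g2) => // t; exact: n2.
Qed.

Lemma winding_at_inner x s : x != a -> 0 < s < 1 ->
  (forall z t, on_strand z -> ~ @meet_at _ (insert a l1) (inl x) s z t) ->
  (forall z t, on_strand z -> ~ @meet_at _ (insert a l2) (inl x) s z t) ->
  winding_at x s = winding (pt x s) 0.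
Proof.
move=> xa s01 n1 n2; rewrite /winding_at; case: eqP => [s0|_]; first by exfalso; lra.
apply: winding_outer => //; first by lra.
by move=> s0; exfalso; lra.
Qed.

Lemma winding_at_left x s : x != a -> 0 < s <= 1 ->
  \forall r \near s^'-, winding_at x r = winding_at x s.
Proof.
move=> xa s01.
have n1 := @no_meet_left _ _ g1 (inl x) s; have n2 := @no_meet_left _ _ g2 (inl x) s.
have c1 := near_strand_count_left a l1 x s; have c2 := near_strand_count_left a l2 x s.
have [s0 s1] : 0 < s /\ s <= 1 by lra.
near=> r.
have r01 : 0 < r < 1.
  apply/andP; split; first by near: r; exact: nbhs_left_gt.
  by apply: lt_le_trans s1; near: r; exact: nbhs_left_lt.
rewrite winding_at_inner //.
- rewrite /winding_at (gt_eqF s0) /winding.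
  by congr (_ - _); near: r; [exact: c2|exact: c1].
- by move=> z t _; move: z t; near: r; apply: filterS n1 => r n1 z t; exact: n1.
- by move=> z t _; move: z t; near: r; apply: filterS n2 => r n2 z t; exact: n2.
Unshelve. all: by end_near. Qed.

(** The sweeps over the common ends of the strands cancel, leaving the crossing with the new strand
    minus that with the old one. *)
Lemma winding_at_right x s : x != a -> 0 <= s < 1 ->
  \forall r \near s^'+, winding_at x r =
    winding_at x s + (strand_jump a l2 x s - strand_jump a l1 x s).
Proof.
move=> xa s01.
have -> : winding_at x s + (strand_jump a l2 x s - strand_jump a l1 x s) = winding (pt x s) (dir x).
  rewrite /winding_at; case: eqP => [s0|s0].
    have nm l (z : vtx (insert a l)) t : generic (insert a l) ->
      ~ @meet_at _ (insert a l) (inl x) s z t.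
      by move=> g /(meet_interior g)[]; rewrite s0 ltxx.
    rewrite !strand_jump_free ?subrr ?addr0 ?s0 ?pt0 // => z t _; rewrite -s0; exact: nm.
  have s01' : 0 < s < 1 by apply/andP; split; [rewrite lt_neqAle eq_sym; apply/andP; split;
    [exact/eqP|lra]|lra].
  have := strand_count_jump g1 xa s01'; have := strand_count_jump g2 xa s01'.
  rewrite /winding; lia.
have n1 := @no_meet_right _ _ g1 (inl x) s; have n2 := @no_meet_right _ _ g2 (inl x) s.
have c1 := near_strand_count_right a l1 x s; have c2 := near_strand_count_right a l2 x s.
have [s0 s1] : 0 <= s /\ s < 1 by lra.
near=> r.
have r01 : 0 < r < 1.
  apply/andP; split; first by apply: le_lt_trans s0 _; near: r; exact: nbhs_right_gt.
  by near: r; exact: nbhs_right_lt.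
rewrite winding_at_inner //.
- by congr (_ - _); near: r; [exact: c2|exact: c1].
- by move=> z t _; move: z t; near: r; apply: filterS n1 => r n1 z t; exact: n1.
- by move=> z t _; move: z t; near: r; apply: filterS n2 => r n2 z t; exact: n2.
Unshelve. all: by end_near. Qed.

Lemma winding_at_meet x y s t : x != a -> y != a -> meet_at x s y t ->
  winding_at x s = winding_at y t.
Proof.
move=> xa ya mt.
have key l v r v' r' (z : vtx (insert a l)) h : generic (insert a l) -> v != a -> v' != a ->
    meet_at v r v' r' -> on_strand z -> ~ @meet_at _ (insert a l) (inl v) r z h.
  move=> g va va' m zs mz.
  have [E _] := meet_edge g (iffRL (outer_meet l _ _ va va') m) mz.
  by move: zs; rewrite -E /= (negbTE va').
have [s01 t01 _] := meet_interior g1 (iffRL (outer_meet l1 _ _ xa ya) mt).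
rewrite !winding_at_inner //.
- by congr winding; case: mt.
- by move=> z h zs; apply: key (meet_sym mt) zs.
- by move=> z h zs; apply: key (meet_sym mt) zs.
- by move=> z h zs; apply: key mt zs.
- by move=> z h zs; apply: key mt zs.
Qed.

Lemma winding_at_next x : x != a -> nextv x != a -> winding_at (nextv x) 0 = winding_at x 1.
Proof.
move=> xa nxa; rewrite /winding_at eqxx oner_eq0 pt1.
have nm l (z : vtx (insert a l)) t : generic (insert a l) ->
  ~ @meet_at _ (insert a l) (inl (nextv x)) 0 z t.
  by move=> g /(meet_interior g)[]; rewrite ltxx.
have W d : winding (pos (nextv x)) d = winding (pos (nextv x)) 0.
  rewrite -[pos (nextv x)]pt0; apply: winding_outer; rewrite ?lexx ?ltr01 //.
  - by move=> _ /nextv_inj E; rewrite E eqxx in xa.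
  - by move=> z t _; exact: nm.
  - by move=> z t _; exact: nm.
by rewrite W [RHS]W.
Qed.

End Winding.

Section StepFunctions.
Variables (R : realType) (I : finType) (A : pred I) (pt_ : I -> R) (w : I -> int).

Definition step (c : R) : int := \sum_(i | A i && (pt_ i < c)) w i.

Lemma step_left c : \forall r \near c^'-, step r = step c.
Proof.
have h : \forall r \near c^'-, forall i, (pt_ i < r) = (pt_ i < c).
  by apply: filter_forall => i; exact: near_left_lt.
near=> r; apply: eq_bigl => i.
have -> : (pt_ i < r) = (pt_ i < c) by move: i; near: r; exact: h.
by [].
Unshelve. all: by end_near. Qed.

Lemma step_right c : \forall r \near c^'+, step r = step c + \sum_(i | A i && (pt_ i == c)) w i.
Proof.
have h : \forall r \near c^'+, forall i, (pt_ i < r) = (pt_ i <= c).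
  by apply: filter_forall => i; exact: near_right_lt.
near=> r; rewrite /step [LHS](bigID (fun i => pt_ i < c)) /=; congr (_ + _).
  apply: eq_bigl => i.
  have -> : (pt_ i < r) = (pt_ i <= c) by move: i; near: r; exact: h.
  by case: (A i) => //=; case: ltgtP.
apply: eq_bigl => i.
have -> : (pt_ i < r) = (pt_ i <= c) by move: i; near: r; exact: h.
by case: (A i) => //=; case: ltgtP.
Unshelve. all: by end_near. Qed.

End StepFunctions.

(** * Colours along a virtual strand *)

Section VirtualStrands.
Variables (R : realType) (T : Type) (Q : operator_quandle T) (P : polygon R) (a : vtx P).
Variable alpha : T.

(** The minus sign reflects that an edge from bottom-left to top-right is acted on by
    [autV alpha]. *)
Lemma act_virtual b (x : R) (u w : Q) : x != 0 -> b = (0 < x) ->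
  act (Virtual alpha) b u w = apow alpha (- bsg x) u.
Proof. by rewrite /bsg => x0 ->; case: ltrgt0P x0. Qed.

Section OneStrand.
Variables (l : seq (R * R)) (lb : labelling T a l).
Hypothesis ok : is_diagram lb.
Hypothesis virt : strand_virtual lb alpha.
Local Notation J := (insert a l).
Local Notation m := ((size l).+1%:R : R).

Let gJ : generic J := ok.1.

Definition visit (v : vtx J * vtx J) := on_strand v.1 && `[< cross v.1 v.2 >].

(** The power of [alpha] accumulated along the strand. A self-crossing occurs twice among the
    visits, once from each of its edges. *)
Definition exponent : R -> int :=
  step visit (fun v => spos v.1 (cpar v.1 v.2)) (fun v => - bsg (det2 (dir v.1) (dir v.2))).

Lemma exponent0 : exponent 0 = 0.
Proof.
apply: big1 => -[z f] /= /andP[/andP[_ /asboolP c]]; have := cross_meet gJ c => -[_ s01 _ _].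
by have := spos_range_lt z s01 => /andP[h _]; rewrite ltNge h.
Qed.

Lemma exponent_free (z : vtx J) (s : R) : on_strand z -> 0 <= s < 1 -> (forall f t,
  ~ meet_at z s f t) ->
  \forall r \near (spos z s)^'+, exponent r = exponent (spos z s).
Proof.
move=> zs s01 nm; have h := step_right visit (fun v : vtx J * vtx J => spos v.1 (cpar v.1 v.2))
  (fun v => - bsg (det2 (dir v.1) (dir v.2))) (spos z s).
apply: filterS h => r E0; rewrite /exponent E0 big1 ?addr0 // => -[w f] /= /andP[/andP[ws /asboolP
  c] /eqP E].
have mt := cross_meet gJ c; have [_ c01 _ _] := mt.
have [/= wz cs] := spos_inj ws zs c01 s01 E; subst w.
by case: (nm f (cpar f z)); rewrite -cs.
Qed.

Lemma exponent_meet (z : vtx J) (s : R) f t : on_strand z -> meet_at z s f t ->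
  \forall r \near (spos z s)^'+, exponent r = exponent (spos z s) - bsg (det2 (dir z) (dir f)).
Proof.
move=> zs mt; have h := step_right visit (fun v : vtx J * vtx J => spos v.1 (cpar v.1 v.2))
  (fun v => - bsg (det2 (dir v.1) (dir v.2))) (spos z s).
have [sE _] := cpar_meet gJ mt; have [_ s01 _ _] := mt.
apply: filterS h => r E0; rewrite /exponent E0; congr (_ + _); rewrite (bigD1 (z, f)) /=;
  last first.
  by rewrite /visit /= zs -sE eqxx andbT; apply/asboolP; exists s, t.
rewrite big1 ?addr0 // => -[w f'] /= /andP[/andP[/andP[ws /asboolP c] /eqP E] ne].
have mt' := cross_meet gJ c; have [_ c01 _ _] := mt'.
have [/= wz cs] := spos_inj ws zs c01 s01 E; subst w; rewrite cs in mt'.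
by have [ff _] := meet_edge gJ mt mt'; rewrite ff eqxx in ne.
Qed.

Lemma virtual_strand u F : strand_coloring (Q := Q) lb u F ->
  forall c, 0 <= c <= m -> F c = apow alpha (exponent c) (F 0).
Proof.
move=> sc; apply: real_ind => [|c /andP[c0 cm] IH|c /andP[c0 cm] IH].
- by rewrite exponent0.
- have Fc := IH c; rewrite c0 lexx in Fc; have {}Fc := Fc isT.
  have [z [s [zs s01 cE]]] : exists (z : vtx J) s, [/\ on_strand z, 0 <= s < 1 & c = spos z s].
    by apply: spos_exists; rewrite c0.
  have [[f [t mt]]|nm] := pselect (exists f t, meet_at z s f t).
    have [_ _ d0] := meet_interior gJ mt.
    have := sc_meet sc zs mt; have := exponent_meet zs mt; rewrite -cE => h' h.
    near=> r; transitivity (act (lb z f) (0 < det2 (dir z) (dir f)) (F c) (glue (l := l) u F f t)).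
      by near: r.
    rewrite (virt zs); last by exists s, t.
    rewrite (act_virtual _ _ d0) // Fc -apowD addrC; congr (apow alpha _ _).
    by apply/esym; near: r.
  have nm' f t : ~ meet_at z s f t by move=> mt; apply: nm; exists f, t.
  have := sc_free sc zs s01 nm'; have := exponent_free zs s01 nm'; rewrite -cE => h' h.
  near=> r; transitivity (F c); first by near: r.
  by rewrite Fc; congr (apow alpha _ _); apply/esym; near: r.
have c01 : 0 < c <= m by rewrite c0.
have h := sc_left sc c01.
have h' : \forall r \near c^'-, exponent r = exponent c by exact: step_left.
near c^'- => r; have <- : F r = F c by near: r.
have <- : exponent r = exponent c by near: r; exact: h'.
by apply: IH; apply/andP; split; [near: r; exact: nbhs_left_ge|].
Unshelve. all: by end_near. Qed.

Definition crossing_number (x : vtx P) : int :=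
  \sum_(z : vtx J | on_strand z && `[< @cross _ J (inl x) z >]) bsg (det2 (dir z) (dir x)).

(** The two visits of a self-crossing have opposite signs, so only crossings with other edges
    survive. *)
Lemma exponent_total : exponent m = - \sum_(x : vtx P | x != a) crossing_number x.
Proof.
pose w (z f : vtx J) : int := if `[< cross z f >] then bsg (det2 (dir z) (dir f)) else 0.
have wN z f : w z f = - w f z.
  rewrite /w; have [c|c] := asboolP (cross z f).
    case: asboolP => [_|[]]; last exact: cross_sym.
    by rewrite -bsgN; congr bsg; rewrite /det2; ring.
  by case: asboolP => [/cross_sym/c//|_]; rewrite oppr0.
have -> : exponent m = - \sum_(z : vtx J | on_strand z) \sum_(f : vtx J) w z f.
  transitivity (\sum_(v : vtx J * vtx J | on_strand v.1) - w v.1 v.2).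
    rewrite /exponent /step.
    rewrite (eq_bigl (fun v : vtx J * vtx J => on_strand v.1 && `[< cross v.1 v.2 >])); last first.
      move=> [z f]; rewrite /visit /=; case: (on_strand z) => //=.
      case: asboolP => //= c; have [_ s01 _ _] := cross_meet gJ c.
      by have /andP[_ ->] := spos_range_lt z s01.
    rewrite big_mkcondr /=; apply: eq_bigr => -[z f] _; rewrite /w /=.
    by case: ifP; rewrite ?oppr0.
  rewrite sumrN pair_big_dep /=; congr (- _).
  by apply: eq_bigl => v; rewrite andbT.
rewrite (eq_bigr (fun z => \sum_(f : vtx J | on_strand f) w z f + \sum_(f : vtx J | ~~ on_strand f)
  w z f)); last first.
  by move=> z _; rewrite (bigID (fun f : vtx J => on_strand f)).
rewrite big_split /=.
have -> : \sum_(z : vtx J | on_strand z) \sum_(f : vtx J | on_strand f) w z f = 0.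
  (* Exchanging the two edges negates every term, and an integer with [A = - A] is 0. *)
  set A := (X in X = _); suff : A = - A by lia.
  rewrite {1}/A exchange_big /= -sumrN; apply: eq_bigr => z _.
  by rewrite -sumrN; apply: eq_bigr => f _.
rewrite add0r exchange_big /=; congr (- _).
rewrite (big_sumType _ _ _) /= [X in _ + X]big1 ?addr0 => [|i]; last by [].
apply: eq_bigr => x xa; rewrite /crossing_number [RHS]big_mkcondr /=.
apply: eq_bigr => z zs; rewrite /w outer_dir //.
case: asboolP => [c|c]; case: asboolP => // c'; first by case: c'; exact: cross_sym.
by case: c; exact: cross_sym.
Qed.

End OneStrand.
End VirtualStrands.

Section WindingTotal.
Variables (R : realType) (P : polygon R) (a : vtx P) (l1 l2 : seq (R * R)).
Hypotheses (g1 : generic (insert a l1)) (g2 : generic (insert a l2)).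

Let passed l (x : vtx P) : R -> int :=
  step (fun z : vtx (insert a l) => on_strand z && `[< @cross _ (insert a l) (inl x) z >])
    (fun z => @cpar _ (insert a l) (inl x) z) (fun z => bsg (det2 (dir z) (dir x))).

Let passed_right l x s : generic (insert a l) -> 0 <= s < 1 ->
  \forall r \near s^'+, passed l x r = passed l x s + strand_jump a l x s.
Proof.
move=> g s01; rewrite /passed /strand_jump.
have h := step_right (fun z : vtx (insert a l) => on_strand z && `[< @cross _ (insert a l) (inl x)
  z >])
    (fun z => @cpar _ (insert a l) (inl x) z) (fun z => bsg (det2 (dir z) (dir x))) s.
apply: filterS h => r ->; congr (_ + _).
rewrite [RHS](bigID (fun z : vtx (insert a l) => `[< exists t,
  @meet_at _ (insert a l) (inl x) s z t >])) /=.
rewrite [X in _ = _ + X]big1 ?addr0 => [|z /andP[_ /negbTE ->]] //.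
rewrite [RHS](eq_bigr (fun z : vtx (insert a l) => bsg (det2 (dir z) (dir x)))); last first.
  by move=> z /andP[_ ->].
apply: eq_bigl => z; rewrite -andbA; congr (_ && _); apply/andP/asboolP.
  by case=> /asboolP c /eqP <-; exists (@cpar _ (insert a l) z (inl x)); apply: cross_meet.
case=> t mt; split; first by apply/asboolP; exists s, t.
by have [<- _] := cpar_meet g mt.
Qed.

(** Along [x] the winding number and the crossing numbers [passed] so far have the same jumps; real
    induction sums them up. *)
Lemma winding_at_total x : x != a ->
  winding_at a l1 l2 x 1 - winding_at a l1 l2 x 0 =
  crossing_number a l2 x - crossing_number a l1 x.
Proof.
move=> xa.
have p0 l : generic (insert a l) -> passed l x 0 = 0.
  move=> g; apply: big1 => z /andP[/andP[_ /asboolP c]].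
  by have [_ /andP[h _] _ _] := cross_meet g c; rewrite ltNge h.
have p1 l : generic (insert a l) -> passed l x 1 = crossing_number a l x.
  move=> g; apply: eq_bigl => z; case: (on_strand z) => //=.
  by case: asboolP => //= c; have [_ /andP[_ ->] _ _] := cross_meet g c.
have : forall s : R, 0 <= s <= 1 -> winding_at a l1 l2 x s =
    winding_at a l1 l2 x 0 + (passed l2 x s - passed l1 x s).
  apply: real_ind => [|s /andP[s0 s1] IH|s /andP[s0 s1] IH].
  - by rewrite !p0 // subrr addr0.
  - have s01 : 0 <= s < 1 by rewrite s0.
    have h := winding_at_right g1 g2 xa s01.
    have h1 := passed_right x g1 s01; have h2 := passed_right x g2 s01.
    have hs := IH s; rewrite s0 lexx in hs; have {}hs := hs isT.
    near=> r.
    have -> : winding_at a l1 l2 x r = winding_at a l1 l2 x s +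
      (strand_jump a l2 x s - strand_jump a l1 x s) by near: r; exact: h.
    have -> : passed l1 x r = passed l1 x s + strand_jump a l1 x s by near: r; exact: h1.
    have -> : passed l2 x r = passed l2 x s + strand_jump a l2 x s by near: r; exact: h2.
    by rewrite hs; ring.
  have s01 : 0 < s <= 1 by rewrite s0.
  have h := winding_at_left g1 g2 xa s01.
  have h1 : \forall r \near s^'-, passed l1 x r = passed l1 x s by exact: step_left.
  have h2 : \forall r \near s^'-, passed l2 x r = passed l2 x s by exact: step_left.
  near s^'- => r.
  have <- : winding_at a l1 l2 x r = winding_at a l1 l2 x s by near: r; exact: h.
  have <- : passed l1 x r = passed l1 x s by near: r; exact: h1.
  have <- : passed l2 x r = passed l2 x s by near: r; exact: h2.
  by apply: IH; apply/andP; split; [near: r; exact: nbhs_left_ge|].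
move=> /(_ 1); rewrite ler01 lexx => /(_ isT) ->; rewrite !p1 //; ring.
Unshelve. all: by end_near. Qed.

(* The winding number at the start of the strand, seen from the preceding edge;
   it is [0] when the strand is a whole component. *)
Definition winding_start : int :=
  if [pick x : vtx P | (nextv x == a) && (x != a)] is Some x then winding_at a l1 l2 x 1 else 0.

Lemma winding_startE x : nextv x = a -> x != a -> winding_start = winding_at a l1 l2 x 1.
Proof.
move=> xE xa; rewrite /winding_start; case: pickP => [y /andP[/eqP yE ya]|/(_ x)].
  by congr winding_at; apply: nextv_inj; rewrite xE yE.
by rewrite xE eqxx xa.
Qed.

(** This is what makes the new colouring close up at the end of the strand. The winding numbers at
    the starts of all edges of [P] telescope; components without the strand contribute 0, so the
    component of [a] is isolated without following it edge by edge. *)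
Lemma winding_closing :
  let wb := if nextv a == a then winding_start else winding_at a l1 l2 (nextv a) 0 in
  wb - winding_start =
  \sum_(x : vtx P | x != a) crossing_number a l1 x - \sum_(x : vtx P | x != a) crossing_number a l2
    x.
Proof.
move=> wb.
(* The start of [a] is given the value seen from the preceding edge, so that the telescoping
   includes the vertex where the strand begins. *)
pose H (v : vtx P) : int := if v == a then winding_start else winding_at a l1 l2 v 0.
have nextH x : x != a -> winding_at a l1 l2 x 1 = H (nextv x).
  move=> xa; rewrite /H; case: eqP => [E|/eqP nxa]; first by rewrite (winding_startE E xa).
  by rewrite winding_at_next.
have tot : \sum_(x : vtx P) (H x - H (nextv x)) = 0.
  by rewrite sumrB [X in X - _](reindex_inj (@nextv_inj _ P)) subrr.
rewrite (bigD1 a) //= in tot.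
have wbE : wb = H (nextv a) by [].
have Ha : H a = winding_start by rewrite /H eqxx.
have S : \sum_(x : vtx P | x != a) (H x - H (nextv x)) =
  \sum_(x : vtx P | x != a) crossing_number a l1 x - \sum_(x : vtx P | x != a) crossing_number a l2
    x.
  rewrite -sumrB; apply: eq_bigr => x xa; rewrite -nextH // {1}/H (negbTE xa).
  by have := winding_at_total xa; lia.
by rewrite -S wbE -Ha; move/eqP: tot; rewrite addrC addr_eq0 opprB => /eqP ->.
Qed.

End WindingTotal.

Section WindingAntisymmetry.
Variables (R : realType) (P : polygon R) (a : vtx P) (l1 l2 : seq (R * R)).

Lemma winding_atN (x : vtx P) s : winding_at a l2 l1 x s = - winding_at a l1 l2 x s.
Proof.
have N q d : winding a l2 l1 q d = - winding a l1 l2 q d by rewrite /winding opprB.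
by rewrite /winding_at !N; case: ifP.
Qed.

Lemma winding_startN : winding_start a l2 l1 = - winding_start a l1 l2.
Proof. by rewrite /winding_start; case: pickP => [x _|_]; rewrite ?winding_atN ?oppr0. Qed.

End WindingAntisymmetry.

Lemma det2_anti (R : realType) (u v : R * R) : - det2 u v = det2 v u.
Proof. by rewrite /det2; ring. Qed.

Section Detours.
Variables (R : realType) (T : Type) (Q : operator_quandle T) (P : polygon R) (a : vtx P).
Variable alpha : T.

(** At a crossing with the strands the winding number jumps by new minus old, and the rule of the
    old diagram supplies the old part, so exactly the action of the new crossing remains. On the new
    strand the colour is forced by its start, which the preceding edge fixes. *)
Lemma detour_transfer (l1 l2 : seq (R * R)) (lab1 : labelling T a l1) (lab2 : labelling T a l2)
    u (F : R -> Q) : is_diagram lab1 -> is_diagram lab2 -> same_outside lab1 lab2 ->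
  strand_virtual lab1 alpha -> strand_virtual lab2 alpha -> strand_coloring lab1 u F ->
  strand_coloring lab2 (fun x s => apow alpha (winding_at a l1 l2 x s) (u x s))
    (fun c => apow alpha (winding_start a l1 l2 + exponent a l2 c) (F 0)).
Proof.
move=> ok1 ok2 so v1 v2 sc; have g1 := ok1.1; have g2 := ok2.1.
have VF := virtual_strand ok1 v1 sc.
set u' := fun x s => _; set F' := fun c => _.
have jump1 (x : vtx P) s : x != a -> 0 <= s < 1 ->
    (forall y t, y != a -> ~ @meet_at _ P x s y t) ->
    \forall r \near s^'+, u x r = apow alpha (strand_jump a l1 x s) (u x s).
  move=> xa s01 no.
  have [[f [t mt]]|nm] := pselect (exists f t, @meet_at _ (insert a l1) (inl x) s f t).
    have [fs|[y ya E]] := strandVouter f; last first.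
      by case: (no y t ya); apply: (iffLR (outer_meet l1 s t xa ya)); rewrite -E.
    have := sc_meet_outer sc xa mt; rewrite (strand_jump_meet g1 fs mt).
    have [_ _ d0] := meet_interior g1 mt.
    have -> : lab1 (inl x) f = Virtual alpha.
      have := ok1.2 f (inl x); rewrite (v1 f) //; last by exists t, s; apply: meet_sym.
      by apply; exists t, s; apply: meet_sym.
    by rewrite (act_virtual _ _ _ d0) // -bsgN det2_anti outer_dir.
  rewrite strand_jump_free; last by move=> z t zs mt; apply: nm; exists z, t.
  by apply: (sc_free_outer sc xa s01) => f t mt; apply: nm; exists f, t.
split.
- move=> x s xa s01; have h := winding_at_left g1 g2 xa s01; have h' := sc_left_outer sc xa s01.
  near=> r; rewrite /u'; congr (apow alpha _ _); near: r; [exact: h|exact: h'].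
- move=> c c01; have h : \forall r \near c^'-,
    exponent a l2 r = exponent a l2 c by exact: step_left.
  by near=> r; rewrite /F'; congr (apow alpha (_ + _) _); near: r.
- move=> x s xa s01 nm; have h := winding_at_right g1 g2 xa s01.
  have j2 : strand_jump a l2 x s = 0.
    by apply: strand_jump_free => z t _; exact: nm.
  have h' := jump1 x s xa s01 _; rewrite j2 sub0r in h.
  have {}h' : \forall r \near s^'+, u x r = apow alpha (strand_jump a l1 x s) (u x s).
    by apply: h' => y t ya mt; apply: (nm (inl y) t); apply: (iffRL (outer_meet l2 s t xa ya)).
  near=> r; rewrite /u'.
  have -> : winding_at a l1 l2 x r = winding_at a l1 l2 x s - strand_jump a l1 x s by near: r;
    exact: h.
  have -> : u x r = apow alpha (strand_jump a l1 x s) (u x s) by near: r; exact: h'.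
  by rewrite -apowD subrK.
- move=> z s zs s01 nm; have h := exponent_free ok2 zs s01 nm.
  by near=> r; rewrite /F'; congr (apow alpha (_ + _) _); near: r.
- move=> x s f t xa mt; have [s01' t01 d0] := meet_interior g2 mt.
  have s01 : 0 <= s < 1 by case: mt.
  have h := winding_at_right g1 g2 xa s01.
  have [fs|[y ya E]] := strandVouter f.
    have h' : \forall r \near s^'+, u x r = apow alpha (strand_jump a l1 x s) (u x s).
      apply: jump1 => // y t' ya mt'.
      have [E _] := meet_edge g2 mt (iffRL (outer_meet l2 s t' xa ya) mt').
      by move: fs; rewrite E /= (negbTE ya).
    have -> : lab2 (inl x) f = Virtual alpha.
      have := ok2.2 f (inl x); rewrite (v2 f) //; last by exists t, s; apply: meet_sym.
      by apply; exists t, s; apply: meet_sym.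
    rewrite (act_virtual _ _ _ d0) // -bsgN.
    rewrite (strand_jump_meet g2 fs mt) in h.
    have dE : - det2 (dir (inl x : vtx (insert a l2))) (dir f) = det2 (dir f) (dir x).
      by rewrite outer_dir // det2_anti.
    rewrite dE; near=> r; rewrite /u'.
    have -> : winding_at a l1 l2 x r = winding_at a l1 l2 x s +
      (bsg (det2 (dir f) (dir x)) - strand_jump a l1 x s) by near: r; exact: h.
    have -> : u x r = apow alpha (strand_jump a l1 x s) (u x s) by near: r; exact: h'.
    by rewrite -!apowD; congr (apow alpha _ _); ring.
  subst f; have mP := iffLR (outer_meet l2 s t xa ya) mt.
  have m1 := iffRL (outer_meet l1 s t xa ya) mP.
  have j l (g : generic (insert a l)) (m : @meet_at _ (insert a l) (inl x) s (inl y) t) :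
      strand_jump a l x s = 0.
    apply: strand_jump_free => z t' zs mz; have [E _] := meet_edge g m mz.
    by move: zs; rewrite -E /= (negbTE ya).
  have {}h : \forall r \near s^'+, winding_at a l1 l2 x r = winding_at a l1 l2 x s.
    by move: h; rewrite !j // subrr addr0.
  have h' := sc_meet_outer sc xa m1.
  rewrite glue_outer // -so //; last by exists s, t.
  rewrite !outer_dir // glue_outer // in h' *.
  near=> r; rewrite /u' -(winding_at_meet g1 g2 xa ya mP) -apow_act.
  by congr (apow alpha _ _); near: r; [exact: h|exact: h'].
- move=> z s f t zs mt; have [_ _ d0] := meet_interior g2 mt.
  have h := exponent_meet ok2 zs mt.
  rewrite (v2 _ _ zs); last by exists s, t.
  rewrite (act_virtual _ _ _ d0) //.
  near=> r; rewrite /F'.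
  have -> : exponent a l2 r = exponent a l2 (spos z s) - bsg (det2 (dir z) (dir f)) by near: r;
    exact: h.
  by rewrite -apowD; congr (apow alpha _ _); ring.
- by move=> x xa nxa; rewrite /u' winding_at_next // (sc_next sc).
- move=> x xa nxa; rewrite /u' /F' (exponent0 ok2) addr0 -(sc_start sc xa nxa).
  by rewrite (winding_startE _ _ nxa xa).
(* The total exponents of the new and the old strand differ by the change of the winding number from
   the start to the end of the strand. *)
- move=> na; have := winding_closing g1 g2; rewrite /= (negbTE na) => /eqP;
    rewrite subr_eq => /eqP W.
  rewrite /u' /F' (sc_end sc na) VF ?lexx ?ler0n // -apowD; congr (apow alpha _ _).
  by rewrite (exponent_total ok1) (exponent_total ok2) W; ring.
(* When the strand is a whole component both strands have the same total exponent, so the closing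
   condition passes from the old strand to the new. *)
- move=> na; have := winding_closing g1 g2; rewrite /= na eqxx subrr => W.
  rewrite /F' (exponent0 ok2) addr0 apowD; congr (apow alpha _ _).
  rewrite (exponent_total ok2) {1}(sc_loop sc na) VF ?lexx ?ler0n //; congr (apow alpha _ _).
  by rewrite (exponent_total ok1); congr (- _); apply/eqP; rewrite -subr_eq0 -W.
Unshelve. all: by end_near. Qed.

(** Exchanging the strands negates the winding number, so the transfer in the other direction
    inverts the first one. *)
Lemma detour_card (l1 l2 : seq (R * R)) (lab1 : labelling T a l1) (lab2 : labelling T a l2)
    (ok1 : is_diagram lab1) (ok2 : is_diagram lab2) : same_outside lab1 lab2 ->
  strand_virtual lab1 alpha -> strand_virtual lab2 alpha ->
  (Col (Diagram ok1) Q #= Col (Diagram ok2) Q)%card.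
Proof.
move=> so v1 v2.
have so' : same_outside lab2 lab1 by move=> x y xa ya c; rewrite so.
pose M (u : vtx P -> R -> Q) (F : R -> Q) (u' : vtx P -> R -> Q) (F' : R -> Q) :=
  (forall x s, u' x s = apow alpha (winding_at a l1 l2 x s) (u x s)) /\
  F' 0 = apow alpha (winding_start a l1 l2) (F 0).
apply: (@strand_card_eq _ _ _ _ _ _ _ _ _ ok1 ok2 M) => [u F sc|u F sc|u F u' F' v G v' G' s s' t
  t' [M1 M2] [N1 N2]].
- do 2 eexists; split; first exact: detour_transfer ok1 ok2 so v1 v2 sc.
  by split=> //; rewrite (exponent0 ok2) addr0.
- do 2 eexists; split; first exact: detour_transfer ok2 ok1 so' v2 v1 sc.
  split=> [x r|]; first by rewrite winding_atN apowK.
  by rewrite (exponent0 ok1) addr0 winding_startN apowK.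
have inj n : injective (apow alpha n : Q -> Q) := can_inj (apowK alpha n).
split=> -[h1 h2]; split=> [x r xa r01|c c01].
- by rewrite M1 N1 h1.
- rewrite (virtual_strand ok2 v2 s') // (virtual_strand ok2 v2 t') // M2 N2 h2 //.
  by rewrite lexx ler0n.
- by apply: (inj (winding_at a l1 l2 x r)); rewrite -M1 -N1 h1.
- rewrite (virtual_strand ok1 v1 s) // (virtual_strand ok1 v1 t) //; congr (apow alpha _ _).
  by apply: (inj (winding_start a l1 l2)); rewrite -M2 -N2 h2 // lexx ler0n.
Qed.

End Detours.

(** * Subdivision *)

Section Det2.
Variable R : realType.
Implicit Types u v : R * R.

Lemma det2Zl k u v : det2 (k *: u) v = k * det2 u v.
Proof. by rewrite /det2 /= /GRing.scale /=; ring. Qed.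

Lemma det2Zr k u v : det2 u (k *: v) = k * det2 u v.
Proof. by rewrite /det2 /= /GRing.scale /=; ring. Qed.

End Det2.

Section Reparametrization.
Variables (R : realType) (T : Type) (Q : operator_quandle T) (P : polygon R) (a : vtx P).

(** Continuity is implicit: an increasing bijection of intervals maps one-sided neighbourhoods to
    one-sided neighbourhoods. *)
Record reparam (m1 m2 : R) (th ps : R -> R) : Prop := Reparam {
  rp_range : forall c, 0 <= c <= m2 -> 0 <= th c <= m1;
  rp_mono : forall c c', 0 <= c -> c' <= m2 -> c < c' -> th c < th c';
  rp_K : forall c, 0 <= c <= m2 -> ps (th c) = c;
  rp_range' : forall c, 0 <= c <= m1 -> 0 <= ps c <= m2;
  rp_mono' : forall c c', 0 <= c -> c' <= m1 -> c < c' -> ps c < ps c';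
  rp_K' : forall c, 0 <= c <= m1 -> th (ps c) = c }.

Lemma reparam_sym m1 m2 th ps : reparam m1 m2 th ps -> reparam m2 m1 ps th.
Proof. by case=> a1 a2 a3 a4 a5 a6; split. Qed.

Section Order.
Variables (m1 m2 : R) (th ps : R -> R).
Hypothesis rp : reparam m1 m2 th ps.
Hypotheses (m10 : 0 <= m1) (m20 : 0 <= m2).

Lemma reparam0 : th 0 = 0.
Proof.
have /andP[h0 h1] : 0 <= th 0 <= m1 by apply: (rp_range rp); rewrite lexx.
move: h0; rewrite le_eqVlt => /orP[/eqP <- //|h].
have := rp_mono' rp (lexx 0) h1 h; rewrite (rp_K rp) ?lexx // => h2.
have : 0 <= ps 0 <= m2 by apply: (rp_range' rp); rewrite lexx.
lra.
Qed.

Lemma reparam_end : th m2 = m1.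
Proof.
have /andP[h0 h1] : 0 <= th m2 <= m1 by apply: (rp_range rp); rewrite m20 lexx.
move: h1; rewrite le_eqVlt => /orP[/eqP //|h].
have := rp_mono' rp h0 (lexx m1) h; rewrite (rp_K rp) ?lexx ?andbT // => h2.
have : 0 <= ps m1 <= m2 by apply: (rp_range' rp); rewrite m10 lexx.
lra.
Qed.

Lemma reparam_right c (S : R -> Prop) : 0 <= c < m2 ->
  (\forall r \near (th c)^'+, S r) -> \forall r \near c^'+, S (th r).
Proof.
move=> /andP[c0 cm] /near_rightP[d cd H]; apply/near_rightP.
have /andP[t0 tm] : 0 <= th c <= m1 by apply: (rp_range rp); rewrite c0 ltW.
have ctm : th c < m1 by rewrite -reparam_end; apply: (rp_mono rp).
(* Capped by [m1], the end of the interval on which [ps] inverts [th]. *)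
pose e := Num.min d m1.
have [ed em] : e <= d /\ e <= m1 by rewrite /e !ge_min !lexx orbT.
have ce : th c < e by rewrite lt_min cd.
have e0 : 0 <= e by lra.
exists (ps e) => [|r /andP[cr re]].
  by have := rp_mono' rp t0 em ce; rewrite (rp_K rp) // c0 ltW.
have pm : 0 <= ps e <= m2 by apply: (rp_range' rp); rewrite e0.
apply: H; apply/andP; split; first by apply: (rp_mono rp) => //; lra.
apply: lt_le_trans ed; rewrite -(rp_K' rp (_ : 0 <= e <= m1)) ?e0 //.
by apply: (rp_mono rp) => //; lra.
Qed.

Lemma reparam_left c (S : R -> Prop) : 0 < c <= m2 ->
  (\forall r \near (th c)^'-, S r) -> \forall r \near c^'-, S (th r).
Proof.
move=> /andP[c0 cm] /near_leftP[d cd H]; apply/near_leftP.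
have /andP[t0 tm] : 0 <= th c <= m1 by apply: (rp_range rp); rewrite ltW.
have ctm : 0 < th c by rewrite -reparam0; apply: (rp_mono rp).
pose e := Num.max d 0.
have [ed em] : d <= e /\ 0 <= e by rewrite /e !le_max !lexx orbT.
have ce : e < th c by rewrite gt_max cd.
have e0 : e <= m1 by lra.
exists (ps e) => [|r /andP[er rc]].
  by have := rp_mono' rp em tm ce; rewrite (rp_K rp) // ltW.
have pm : 0 <= ps e <= m2 by apply: (rp_range' rp); rewrite em.
apply: H; apply/andP; split; last by apply: (rp_mono rp) => //; lra.
apply: le_lt_trans ed _; rewrite -(rp_K' rp (_ : 0 <= e <= m1)) ?em //.
by apply: (rp_mono rp) => //; lra.
Qed.

End Order.

Section Transfer.
Variables (l1 l2 : seq (R * R)) (lab1 : labelling T a l1) (lab2 : labelling T a l2).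
Hypotheses (ok1 : is_diagram lab1) (ok2 : is_diagram lab2).
Hypothesis so : same_outside lab1 lab2.
Variables (th ps : R -> R).
Hypothesis rp : reparam (size l1).+1%:R (size l2).+1%:R th ps.
Hypothesis simple2 : forall (z w : vtx (insert a l2)) s t, on_strand z -> on_strand w ->
  ~ meet_at z s w t.
Hypothesis simple1 : forall (z w : vtx (insert a l1)) s t, on_strand z -> on_strand w ->
  ~ meet_at z s w t.
Hypothesis match_meet : forall (z1 : vtx (insert a l1)) (s1 : R) (z2 : vtx (insert a l2)) (s2 : R)
  y t,
  on_strand z1 -> on_strand z2 -> 0 <= s1 < 1 -> 0 <= s2 < 1 -> spos z1 s1 = th (spos z2 s2) ->
  y != a -> meet_at z1 s1 (inl y) t <-> meet_at z2 s2 (inl y) t.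
Hypothesis match_data : forall (z1 : vtx (insert a l1)) (s1 : R) (z2 : vtx (insert a l2)) (s2 : R)
  y t,
  on_strand z1 -> on_strand z2 -> meet_at z1 s1 (inl y) t -> meet_at z2 s2 (inl y) t ->
  spos z1 s1 = th (spos z2 s2) -> y != a ->
  lab1 z1 (inl y) = lab2 z2 (inl y) /\
  (0 < det2 (dir z1) (dir (inl y : vtx (insert a l1)))) =
  (0 < det2 (dir z2) (dir (inl y : vtx (insert a l2)))) /\
  (0 < det2 (dir (inl y : vtx (insert a l1))) (dir z1)) =
  (0 < det2 (dir (inl y : vtx (insert a l2))) (dir z2)).

Let m1_ge0 : 0 <= (size l1).+1%:R :> R. Proof. exact: ler0n. Qed.
Let m2_ge0 : 0 <= (size l2).+1%:R :> R. Proof. exact: ler0n. Qed.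

Let to1 (z2 : vtx (insert a l2)) (s2 : R) : on_strand z2 -> 0 <= s2 < 1 ->
  exists (z1 : vtx (insert a l1)) s1, [/\ on_strand z1, 0 <= s1 < 1 & spos z1 s1 = th (spos z2 s2)].
Proof.
move=> zs s01; have /andP[p0 pm] := spos_range_lt z2 s01.
have /andP[t0 tm] : 0 <= th (spos z2 s2) <= (size l1).+1%:R by apply: (rp_range rp); rewrite p0 ltW.
have tm' : th (spos z2 s2) < (size l1).+1%:R by rewrite -(reparam_end rp) //; apply: (rp_mono rp).
have [z1 [s1 [a1 a2 a3]]] : exists (z1 : vtx (insert a l1)) s1, [/\ on_strand z1,
  0 <= s1 < 1 & th (spos z2 s2) = spos z1 s1].
  by apply: spos_exists; rewrite t0.
by exists z1, s1.
Qed.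

Let to2 (z1 : vtx (insert a l1)) (s1 : R) : on_strand z1 -> 0 <= s1 < 1 ->
  exists (z2 : vtx (insert a l2)) s2, [/\ on_strand z2, 0 <= s2 < 1 & spos z1 s1 = th (spos z2 s2)].
Proof.
move=> zs s01; have /andP[p0 pm] := spos_range_lt z1 s01.
have /andP[t0 tm] : 0 <= ps (spos z1 s1) <= (size l2).+1%:R by apply: (rp_range' rp);
  rewrite p0 ltW.
have tm' : ps (spos z1 s1) < (size l2).+1%:R.
  by rewrite -(reparam_end (reparam_sym rp)) //; apply: (rp_mono' rp).
have [z2 [s2 [a1 a2 a3]]] : exists (z2 : vtx (insert a l2)) s2, [/\ on_strand z2,
  0 <= s2 < 1 & ps (spos z1 s1) = spos z2 s2].
  by apply: spos_exists; rewrite t0.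
by exists z2, s2; split=> //; rewrite -a3 (rp_K' rp) // p0 ltW.
Qed.

(** Stated for two arbitrary simple strands, so that it serves for subdividing an edge as well as
    for undoing it. *)
Lemma reparam_transfer u (F : R -> Q) : strand_coloring lab1 u F ->
  strand_coloring lab2 u (F \o th).
Proof.
move=> sc; split.
- exact: sc_left_outer sc.
- move=> c c0m; apply: (reparam_left rp m1_ge0 m2_ge0 (S := fun r => F r = F (th c))) => //.
  apply: (sc_left sc); apply/andP; split.
    by rewrite -(reparam0 rp) //; apply: (rp_mono rp) => //; case/andP: c0m.
  by have /andP[] : 0 <= th c <= (size l1).+1%:R by apply: (rp_range rp); case/andP: c0m => /ltW ->
    ->.
- move=> x s xa s01 nm; apply: (sc_free_outer sc xa s01) => f t mt.
  have [fs|[y ya E]] := strandVouter f; last first.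
    apply: (nm (inl y) t); apply: (iffRL (outer_meet _ _ _ xa ya)).
    by move: mt; rewrite E; exact: (iffLR (outer_meet _ _ _ xa ya)).
  have [_ t01 _ _] := meet_sym mt; have [z2 [s2 [zs2 s201 E]]] := to2 fs t01.
  apply: (nm z2 s2); apply: meet_sym.
  exact: (iffLR (match_meet _ fs zs2 t01 s201 E xa) (meet_sym mt)).
- move=> z s zs s01 nm; have [z1 [s1 [zs1 s101 E]]] := to1 zs s01.
  apply: (reparam_right rp m1_ge0 m2_ge0 (S := fun r => F r = F (th (spos z s)))) => //.
    exact: spos_range_lt.
  rewrite -E; apply: (sc_free sc zs1 s101) => f t mt.
  have [fs|[y ya fE]] := strandVouter f; first exact: simple1 zs1 fs mt.
  by subst f; apply: (nm (inl y) t); apply: (iffLR (match_meet _ zs1 zs s101 s01 E ya)).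
- move=> x s f t xa mt; have [fs|[y ya E]] := strandVouter f; last first.
    subst f; have m1 := iffRL (outer_meet l1 _ _ xa ya) (iffLR (outer_meet l2 _ _ xa ya) mt).
    have := sc_meet_outer sc xa m1; rewrite !glue_outer // !outer_dir //.
    by rewrite (so xa ya) //; exists s, t; apply: (iffLR (outer_meet l2 _ _ xa ya)).
  have [_ t01 _ _] := meet_sym mt; have [z1 [s1 [zs1 s101 E]]] := to1 fs t01.
  have m1 := iffRL (match_meet _ zs1 fs s101 t01 E xa) (meet_sym mt).
  have [L [_ S]] := match_data zs1 fs m1 (meet_sym mt) E xa.
  have := sc_meet_outer sc xa (meet_sym m1); rewrite !glue_strand //= -E.
  rewrite -S (_ : lab2 (inl x) f = lab1 (inl x) z1) //.
  rewrite (ok1.2 z1 (inl x)); last by exists s1, s.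
  by rewrite (ok2.2 f (inl x)) ?L //; exists t, s; exact: meet_sym.
- move=> z s f t zs mt; have [fs|[y ya E]] := strandVouter f; first by case: (simple2 zs fs mt).
  subst f; have [_ s01 _ _] := mt; have [z1 [s1 [zs1 s101 E]]] := to1 zs s01.
  have m1 := iffRL (match_meet _ zs1 zs s101 s01 E ya) mt.
  have [L [S _]] := match_data zs1 zs m1 mt E ya.
  apply: (reparam_right rp m1_ge0 m2_ge0 (S := fun r => F r = act _ _ _ _)) => //;
    first exact: spos_range_lt.
  by have := sc_meet sc zs1 m1; rewrite !glue_outer //= -E -S -L.
- exact: sc_next sc.
- by move=> x xa nx; rewrite /= (reparam0 rp) //; apply: (sc_start sc).
- by move=> na; rewrite /= (reparam_end rp) //; apply: (sc_end sc).
- by move=> na; rewrite /= (reparam0 rp) // (reparam_end rp) //; apply: (sc_loop sc).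
Qed.

End Transfer.

Section Subdivision.
Variables (p : R * R) (lab1 : labelling T a [::]) (lab2 : labelling T a [:: p]).
Hypotheses (ok1 : is_diagram lab1) (ok2 : is_diagram lab2).
Hypothesis so : same_outside lab1 lab2.
Variable s0 : R.
Hypotheses (s01 : 0 < s0 < 1) (pE : p = pt a s0).
Hypothesis sp : forall x, x != a -> same_passage lab1 lab2 x.

(** In [spos] the subdivided strand has length 2; its unit intervals go to the parts of the old edge
    before and after the new vertex. *)
Definition merge_param (c : R) : R := if c <= 1 then s0 * c else s0 + (1 - s0) * (c - 1).
Definition split_param (c : R) : R := if c <= s0 then c / s0 else 1 + (c - s0) / (1 - s0).

Lemma merge_reparam : reparam 1 2 merge_param split_param.
Proof.
have /andP[p0 s01'] := s01; have p1 : 0 < 1 - s0 by rewrite subr_gt0.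
have p0' : s0 != 0 by rewrite gt_eqF.
have p1' : 1 - s0 != 0 by rewrite gt_eqF.
split; rewrite /merge_param /split_param.
- move=> c /andP[c0 c2]; case: (leP c 1) => c1.
    have := mulr_ge0 (ltW p0) c0; have : s0 * c <= s0 by rewrite ler_piMr ?(ltW p0).
    lra.
  have : 0 <= (1 - s0) * (c - 1) by apply: mulr_ge0; lra.
  have : (1 - s0) * (c - 1) <= 1 - s0 by rewrite ler_piMr ?(ltW p1) //; lra.
  lra.
- move=> c c' c0 c'2 cc; case: (leP c 1) => c1; case: (leP c' 1) => c1'.
  + by rewrite ltr_pM2l.
  + have : s0 * c <= s0 by rewrite ler_piMr ?(ltW p0).
    have : 0 < (1 - s0) * (c' - 1) by rewrite mulr_gt0 // subr_gt0.
    lra.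
  + by exfalso; lra.
  + by rewrite ltrD2l ltr_pM2l // ltrD2r.
- move=> c c02; case: (leP c 1) => c1.
    by rewrite ler_piMr ?(ltW p0) // mulrAC mulfV // mul1r.
  rewrite ifF; first by field.
  by apply/negbTE; rewrite -ltNge ltrDl mulr_gt0 // subr_gt0.
- move=> c /andP[c0 c1]; case: (leP c s0) => cs.
    have : c / s0 <= 1 by rewrite ler_pdivrMr // mul1r.
    have : 0 <= c / s0 by rewrite divr_ge0 // ltW.
    lra.
  have : (c - s0) / (1 - s0) <= 1 by rewrite ler_pdivrMr //; lra.
  have : 0 <= (c - s0) / (1 - s0) by rewrite divr_ge0 //; lra.
  lra.
- move=> c c' c0 c1 cc; case: (leP c s0) => cs; case: (leP c' s0) => cs'.
  + by rewrite ltr_pM2r // invr_gt0.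
  + have : c / s0 <= 1 by rewrite ler_pdivrMr // mul1r.
    have : 0 < (c' - s0) / (1 - s0) by rewrite divr_gt0 // subr_gt0.
    lra.
  + by exfalso; lra.
  + by rewrite ltrD2l ltr_pM2r ?invr_gt0 // ltrD2r.
- move=> c /andP[c0 c1]; case: (leP c s0) => cs.
    by rewrite ler_pdivrMr // mul1r cs mulrC divfK.
  rewrite ifF; first by field.
  by apply/negbTE; rewrite -ltNge ltrDl divr_gt0 // subr_gt0.
Qed.

(** The directions of the halves are [s0] and [1 - s0] times the old one; these factors are
    positive, so no crossing changes its sign. *)
Lemma merge_pt (z : vtx (insert a [:: p])) (s : R) : on_strand z -> 0 <= s < 1 ->
  pt (inl a : vtx (insert a [::])) (merge_param (spos z s)) = pt z s /\
  exists2 k : R, 0 < k & dir z = k *: dir (inl a : vtx (insert a [::])).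
Proof.
move=> zs s01'; have /andP[p0 p1] := s01.
have d1 : dir (inl a : vtx (insert a [::])) = dir a.
  by rewrite /dir (@strand_last _ _ a [::] (inl a)) //= eqxx.
case: z zs => [x /= /eqP ->|i _].
  have dE : dir (inl a : vtx (insert a [:: p])) = s0 *: dir a.
    have [nas rna] : on_strand (nextv (inl a : vtx (insert a [:: p]))) /\ rk (nextv (inl a : vtx
      (insert a [:: p]))) = 1%N.
      by apply: rk_next; rewrite /= ?eqxx.
    have nE : nextv (inl a : vtx (insert a [:: p])) = inr ord0 by apply: rk_inj.
    by rewrite {1}/dir nE /= pE /pt addrC addKr.
  rewrite /spos add0r /merge_param ifT; last by lra.
  rewrite /pt dE d1; split; last by exists s0.
  by rewrite scalerA mulrC.
have i0 : i = ord0 := ord1 i.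
have nE : nextv (inr i : vtx (insert a [:: p])) = inl (nextv a).
  by apply: strand_last => //; rewrite i0.
have posi : pos (inr i : vtx (insert a [:: p])) = p by rewrite i0.
have rki : rk (inr i : vtx (insert a [:: p])) = 1%N by rewrite i0.
have dE : dir (inr i : vtx (insert a [:: p])) = (1 - s0) *: dir a.
  by rewrite {1}/dir nE posi pE /pt scalerBl scale1r opprD addrA.
split; last by exists (1 - s0); rewrite ?subr_gt0 // dE d1.
(* The start of the second edge has [spos] 1, which [merge_param] handles in its first branch. *)
have [s0'|sn0] := eqVneq s 0.
  by rewrite /spos rki s0' addr0 /merge_param lexx mulr1 pt0 posi pE /pt d1.
rewrite /spos rki /merge_param ifF; last by apply/negbTE;
  rewrite -ltNge ltrDl lt_neqAle eq_sym sn0; case/andP: s01'.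
rewrite /pt dE d1 posi pE /pt -[RHS]addrA; congr (_ + _).
by rewrite scalerA -scalerDl; congr (_ *: _); ring.
Qed.

Lemma subdivision_card : (Col (Diagram ok1) Q #= Col (Diagram ok2) Q)%card.
Proof.
have g1 := ok1.1; have g2 := ok2.1.
have simple1 (z w : vtx (insert a [::])) s t : on_strand z -> on_strand w -> ~ meet_at z s w t.
  by move=> zs ws mt; have := rk_le z; have := rk_le w => /= rw rz; have [] :=
    strand_self_meet g1 zs ws mt; lia.
have simple2 (z w : vtx (insert a [:: p])) s t : on_strand z -> on_strand w -> ~ meet_at z s w t.
  by move=> zs ws mt; have := rk_le z; have := rk_le w => /= rw rz; have [] :=
    strand_self_meet g2 zs ws mt; lia.
have rp : reparam (size (Nil (R * R))).+1%:R (size [:: p]).+1%:R merge_param split_param :=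
  merge_reparam.
have z1E (z : vtx (insert a [::])) : on_strand z -> z = inl a by case: z => [x /= /eqP ->|[]].
have mm (z1 : vtx (insert a [::])) (s1 : R) (z2 : vtx (insert a [:: p])) (s2 : R) y t :
    on_strand z1 -> on_strand z2 -> 0 <= s1 < 1 -> 0 <= s2 < 1 ->
      spos z1 s1 = merge_param (spos z2 s2) ->
    y != a -> meet_at z1 s1 (inl y) t <-> meet_at z2 s2 (inl y) t.
  move=> zs1 zs2 s101 s201 E ya; have [ptE _] := merge_pt zs2 s201.
  have pE' : pt z1 s1 = pt z2 s2 by rewrite -ptE -E (z1E _ zs1) /spos add0r.
  have ne l (z : vtx (insert a l)) : on_strand z -> z != inl y.
    by move=> zs; apply: contraTneq zs => ->; rewrite /= (negbTE ya).
  by split=> -[_ _ t01 h]; split=> //; rewrite ?ne //; move: h; rewrite !outer_pt // pE'.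
have md (z1 : vtx (insert a [::])) (s1 : R) (z2 : vtx (insert a [:: p])) (s2 : R) y t :
    on_strand z1 -> on_strand z2 -> meet_at z1 s1 (inl y) t -> meet_at z2 s2 (inl y) t ->
    spos z1 s1 = merge_param (spos z2 s2) -> y != a ->
    lab1 z1 (inl y) = lab2 z2 (inl y) /\
    (0 < det2 (dir z1) (dir (inl y : vtx (insert a [::])))) =
    (0 < det2 (dir z2) (dir (inl y : vtx (insert a [:: p])))) /\
    (0 < det2 (dir (inl y : vtx (insert a [::]))) (dir z1)) =
    (0 < det2 (dir (inl y : vtx (insert a [:: p]))) (dir z2)).
  move=> zs1 zs2 m1 m2 _ ya; split; first by apply: (sp ya) => //; [exists s1, t|exists s2, t].
  have [_ s201 _ _] := m2; have [_ [k k0 dE]] := merge_pt zs2 s201.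
  by rewrite (z1E _ zs1) dE !(outer_dir _ ya) !det2Zl !det2Zr !pmulr_rgt0.
have so' : same_outside lab2 lab1 by move=> x y xa ya c; rewrite so.
pose M (u : vtx P -> R -> Q) (F : R -> Q) (u' : vtx P -> R -> Q) (F' : R -> Q) :=
  (forall x (s : R), u x s = u' x s) /\
  (forall c : R, 0 <= c <= 2 -> F' c = F (merge_param c)).
have th01 c : 0 <= c <= 1 -> exists2 d, 0 <= d <= 2 & c = merge_param d.
  by move=> c01; exists (split_param c); [exact: (rp_range' rp)|rewrite (rp_K' rp)].
apply: (@strand_card_eq _ _ _ _ _ _ _ _ _ ok1 ok2 M) => [u F sc|u F sc|u F u' F' v G v' G' s s' t
  t' [M1 M2] [N1 N2]].
- exists u, (F \o merge_param); split=> //.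
  exact: (reparam_transfer ok1 ok2 so rp simple2 simple1 mm md sc).
- exists u, (F \o split_param); split; last by split=> // c c02; rewrite /= (rp_K rp).
  apply: (reparam_transfer ok2 ok1 so' (reparam_sym rp) simple1 simple2 _ _ sc).
    move=> z1 s1 z2 s2 y t zs1 zs2 s101 s201 E ya; apply: iff_sym.
    apply: mm => //; rewrite E (rp_K' rp) //.
    by have /andP[-> /ltW ->] := spos_range_lt z2 s201.
  move=> z1 s1 z2 s2 y t zs1 zs2 m1 m2 E ya.
  have [|-> [-> ->]] := md z2 s2 z1 s1 y t zs2 zs1 m2 m1 _ ya; last by [].
  have [_ s201 _ _] := m2; rewrite E (rp_K' rp) //.
  by have /andP[-> /ltW ->] := spos_range_lt z2 s201.
split=> -[h1 h2]; split=> [x r xa r01|c c01].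
- by rewrite -M1 -N1 h1.
- by rewrite M2 // N2 // h2 //; exact: (rp_range rp).
- by rewrite M1 N1 h1.
- by have [d d02 ->] := th01 c c01; rewrite -M2 // -N2 // h2.
Qed.

End Subdivision.
End Reparametrization.

(** * The third Reidemeister move *)

Section ThirdMoveAlgebra.
Variables (T : Type) (Q : operator_quandle T).
Implicit Types (x y z : Q) (L : passage T).

Lemma qdiv_idem x : qdiv x x = x.
Proof. by rewrite -{1}(qop_idem x) qopK. Qed.

Lemma qdiv_distr x y z : qdiv (qop x y) z = qop (qdiv x z) (qdiv y z).
Proof. by rewrite -{1}(qdivK z x) -{1}(qdivK z y) /= -qop_distr qopK. Qed.

Lemma qop_qdiv_distr x y z : qop (qdiv x y) z = qdiv (qop x z) (qop y z).
Proof. by rewrite -{2}(qdivK y x) /= qop_distr qopK. Qed.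

Lemma qdiv_qdiv_distr x y z : qdiv (qdiv x y) z = qdiv (qdiv x z) (qdiv y z).
Proof. by rewrite -{2}(qdivK y x) /= qdiv_distr qopK. Qed.

Definition bef (b : bool) x y := if b then x else y.

(* The colouring equations of three pairwise crossing strands e, x, y: each has
   an incoming, a middle and an outgoing colour; [be] says that e meets x before
   y, [bx] (resp. [by_]) that x (resp. y) meets e first; [sx], [sy], [sxy] are the
   signs of the crossings (e, x), (e, y), (x, y). *)
Definition three_strands (be bx by_ sx sy sxy : bool) Lx Ly Lxy (ie me oe ix mx ox iy my oy : Q) :
  Prop :=
  [/\ bef be me oe = act Lx sx (bef be ie me) (bef bx ix mx),
      bef (~~ be) me oe = act Ly sy (bef (~~ be) ie me) (bef by_ iy my),
      bef bx mx ox = act (mirror Lx) (~~ sx) (bef bx ix mx) (bef be ie me),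
      bef by_ my oy = act (mirror Ly) (~~ sy) (bef by_ iy my) (bef (~~ be) ie me) &
      bef (~~ bx) mx ox = act Lxy sxy (bef (~~ bx) ix mx) (bef (~~ by_) iy my) /\
      bef (~~ by_) my oy = act (mirror Lxy) (~~ sxy) (bef (~~ by_) iy my) (bef (~~ bx) ix mx)].

Ltac distribute z := rewrite ?(qop_distr _ _ z) ?(qdiv_distr _ _ z) ?(qop_qdiv_distr _ _ z)
  ?(qdiv_qdiv_distr _ _ z)
  ?qop_idem ?qdiv_idem ?qopK ?qdivK.

(** The parity conditions, established in [three_edges_parity], reduce the 64 combinations of signs
    and orders to 16; excluding cycles leaves the six orders of the strands by height. The new
    middle colours are then determined, and the outgoing colours agree by self-distributivity. *)
Lemma three_strands_flip be bx by_ sx sy sxy Lx Ly Lxy ie me oe ix mx ox iy my oy :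
  sx (+) bx = sy (+) by_ -> sx (+) be = sxy (+) by_ ->
  classical Lx -> classical Ly -> classical Lxy -> ~ (Lx = Lxy /\ Lxy = mirror Ly) ->
  three_strands be bx by_ sx sy sxy Lx Ly Lxy ie me oe ix mx ox iy my oy ->
  exists me' mx' my',
    three_strands (~~ be) (~~ bx) (~~ by_) sx sy sxy Lx Ly Lxy ie me' oe ix mx' ox iy my' oy.
Proof.
move=> p1 p2; case: Lx => // _; case: Ly => // _; case: Lxy => // _ cyc;
  try (by case: cyc);
  move: sx sy sxy be bx by_ p1 p2 => [] [] [] [] [] [] //= _ _; rewrite /three_strands /=;
  case=> E1 E2 E3 E4 [E5 E6]; subst.
(* The middle colours are left open and found by unification with the equations. *)
all: do 3 eexists; (split; [..|split]).
all: try (match goal with |- ?x = _ => is_evar x; reflexivity | |- _ = ?x => is_evar x;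
  reflexivity end).
all: try (by rewrite ?qopK ?qdivK).
(* What remains is self-distributivity with respect to one of the incoming colours, which is found
   by trial. *)
all: first [by distribute ie | by distribute ix | by distribute iy].
Qed.

End ThirdMoveAlgebra.

(** * Piecewise constant colours with two jumps *)

Section PiecewiseConstant.
Variables (R : realType) (Q : Type).
Implicit Types (h f : R -> Q) (lo hi s : R).

Lemma lim_const h (a b : R) :
  (forall s, a < s <= b -> \forall r \near s^'-, h r = h s) ->
  (forall s, a <= s < b -> \forall r \near s^'+, h r = h s) ->
  forall s, a <= s <= b -> h s = h a.
Proof.
move=> hl hr; apply: real_ind => // [s /andP[as_ sb] IH|s /andP[as_ sb] IH].
  have <- : h s = h a by apply: IH; rewrite as_ lexx.
  by apply: hr; rewrite as_.
have H := hl s; rewrite as_ in H; have {}H := H sb.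
near s^'- => r; have <- : h r = h s by near: r; exact: H.
by apply: IH; apply/andP; split; [near: r; exact: nbhs_left_ge|].
Unshelve. all: by end_near. Qed.

Lemma lim_after h (a b : R) w :
  (forall s, a < s <= b -> \forall r \near s^'-, h r = h s) ->
  (forall s, a < s < b -> \forall r \near s^'+, h r = h s) ->
  (\forall r \near a^'+, h r = w) ->
  forall s, a < s <= b -> h s = w.
Proof.
move=> hl hr hw s /andP[as_ sb]; near a^'+ => r.
have <- : h r = w by near: r; exact: hw.
have ar : a < r by [].
have rs : r < s by near: r; exact: nbhs_right_lt.
apply: (lim_const (b := b)); last by rewrite (ltW rs).
  by move=> s' /andP[rs' s'b]; apply: hl; rewrite (lt_trans ar).
by move=> s' /andP[rs' s'b]; apply: hr; rewrite (lt_le_trans ar).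
Unshelve. all: by end_near. Qed.

(** The colour along a strand with jumps at [v1] and [v2], in either order: incoming, middle,
    outgoing. The closed inequalities make it left-continuous; [tri_right] gives its limits from the
    right. *)
Definition tri (v1 v2 : R) (i m o : Q) s : Q :=
  if s <= Num.min v1 v2 then i else if s <= Num.max v1 v2 then m else o.

Definition tri_right (v1 v2 : R) (i m o : Q) s : Q :=
  if s < Num.min v1 v2 then i else if s < Num.max v1 v2 then m else o.

Lemma near_left_le (c s : R) : \forall r \near s^'-, (r <= c) = (s <= c).
Proof.
by apply: filterS (near_left_lt c s) => r E; rewrite !leNgt E.
Qed.

Lemma near_right_le (c s : R) : \forall r \near s^'+, (r <= c) = (s < c).
Proof.
by apply: filterS (near_right_lt c s) => r E; rewrite leNgt E ltNge.
Qed.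

Lemma tri_left v1 v2 i m o s : \forall r \near s^'-, tri v1 v2 i m o r = tri v1 v2 i m o s.
Proof.
have h1 := near_left_le (Num.min v1 v2) s; have h2 := near_left_le (Num.max v1 v2) s.
near=> r; rewrite /tri.
have -> : (r <= Num.min v1 v2) = (s <= Num.min v1 v2) by near: r; exact: h1.
by have -> : (r <= Num.max v1 v2) = (s <= Num.max v1 v2) by near: r; exact: h2.
Unshelve. all: by end_near. Qed.

Lemma tri_rightP v1 v2 i m o s : \forall r \near s^'+, tri v1 v2 i m o r = tri_right v1 v2 i m o s.
Proof.
have h1 := near_right_le (Num.min v1 v2) s; have h2 := near_right_le (Num.max v1 v2) s.
near=> r; rewrite /tri /tri_right.
have -> : (r <= Num.min v1 v2) = (s < Num.min v1 v2) by near: r; exact: h1.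
by have -> : (r <= Num.max v1 v2) = (s < Num.max v1 v2) by near: r; exact: h2.
Unshelve. all: by end_near. Qed.

Lemma tri_at1 v1 v2 i m o : v1 != v2 -> tri v1 v2 i m o v1 = if v1 < v2 then i else m.
Proof. by rewrite /tri le_min le_max !lexx /=; case: ltgtP. Qed.

Lemma tri_at2 v1 v2 i m o : v1 != v2 -> tri v1 v2 i m o v2 = if v1 < v2 then m else i.
Proof. by rewrite /tri le_min le_max !lexx orbT andbT; case: ltgtP. Qed.

Lemma tri_right1 v1 v2 i m o : v1 != v2 -> tri_right v1 v2 i m o v1 = if v1 < v2 then m else o.
Proof. by rewrite /tri_right lt_min lt_max ltxx /=; case: ltgtP. Qed.

Lemma tri_right2 v1 v2 i m o : v1 != v2 -> tri_right v1 v2 i m o v2 = if v1 < v2 then o else m.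
Proof. by rewrite /tri_right lt_min lt_max ltxx orbF andbF; case: ltgtP. Qed.

Lemma tri_right_free v1 v2 i m o s : s != v1 -> s != v2 ->
  tri_right v1 v2 i m o s = tri v1 v2 i m o s.
Proof.
move=> s1 s2; rewrite /tri_right /tri lt_min le_min lt_max le_max.
by rewrite !lt_neqAle s1 s2.
Qed.

Lemma tri_first v1 v2 i m o s : s <= v1 -> s <= v2 -> tri v1 v2 i m o s = i.
Proof. by move=> s1 s2; rewrite /tri le_min s1 s2. Qed.

Lemma tri_last v1 v2 i m o s : v1 < s -> v2 < s -> tri v1 v2 i m o s = o.
Proof. by move=> s1 s2; rewrite /tri le_min le_max !leNgt s1 s2. Qed.

Lemma tri_right_last v1 v2 i m o s : v1 <= s -> v2 <= s -> tri_right v1 v2 i m o s = o.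
Proof. by move=> s1 s2; rewrite /tri_right lt_min lt_max !ltNge s1 s2. Qed.

(** The jumps are named by the crossings, not by their order, so the proof reduces to a sorted pair.
    The last clause covers a visit at [hi] itself, whose jump already gives the limit from the
    right, together with the ordinary case. *)
Lemma two_visits h lo hi (v1 v2 : R) w1 w2 : lo <= v1 <= hi -> lo <= v2 <= hi -> v1 != v2 ->
  (forall s, lo < s <= hi -> \forall r \near s^'-, h r = h s) ->
  (forall s, lo <= s <= hi -> s != v1 -> s != v2 -> s < hi -> \forall r \near s^'+, h r = h s) ->
  (\forall r \near v1^'+, h r = w1) -> (\forall r \near v2^'+, h r = w2) ->
  exists m o, [/\ forall s, lo <= s <= hi -> h s = tri v1 v2 (h lo) m o s,
    w1 = if v1 < v2 then m else o, w2 = if v1 < v2 then o else m &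
    (hi != v1 -> hi != v2 -> \forall r \near hi^'+, h r = h hi) -> \forall r \near hi^'+, h r = o].
Proof.
move=> /andP[l1 h1] /andP[l2 h2] + hl hr.
have sorted (p q : R) wp wq : lo <= p -> q <= hi -> p < q ->
    (forall s, lo <= s <= hi -> s != p -> s != q -> s < hi -> \forall r \near s^'+, h r = h s) ->
    (\forall r \near p^'+, h r = wp) -> (\forall r \near q^'+, h r = wq) ->
    (forall s, lo <= s <= hi -> h s = if s <= p then h lo else if s <= q then wp else wq) /\
    ((hi != p -> hi != q -> \forall r \near hi^'+, h r = h hi) -> \forall r \near hi^'+, h r = wq).
  move=> lp qh pq hr' hp hq.
  have a1 : forall s, lo <= s <= p -> h s = h lo.
    apply: lim_const => s s1; first by apply: hl; lra.
    by apply: hr'; try lra; apply/eqP => E; subst; lra.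
  have a2 : forall s, p < s <= q -> h s = wp.
    apply: lim_after => // s s1; first by apply: hl; lra.
    by apply: hr'; try lra; apply/eqP => E; subst; lra.
  have a3 : forall s, q < s <= hi -> h s = wq.
    apply: lim_after => // s s1; first by apply: hl; lra.
    by apply: hr'; try lra; apply/eqP => E; subst; lra.
  split=> [s /andP[s1 s2]|H].
    have [sp|ps] := leP s p; first by apply: a1; rewrite s1.
    have [sq|qs] := leP s q; first by apply: a2; rewrite ps.
    by apply: a3; rewrite qs.
  move: qh; rewrite le_eqVlt => /orP[/eqP <- //|qh'].
  have -> : wq = h hi by apply/esym/a3; rewrite qh' lexx.
  by apply: H; rewrite gt_eqF // (lt_trans pq).
case: ltgtP => // v12 _ hw1 hw2.
  exists w1, w2; have [A B] := sorted v1 v2 w1 w2 l1 h2 v12 hr hw1 hw2.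
  split=> // s s01; rewrite A // /tri min_l ?max_r ?(ltW v12) //.
exists w2, w1; have [|A B] := sorted v2 v1 w2 w1 l2 h1 v12 _ hw2 hw1.
  by move=> s s01 n2 n1; apply: hr.
split=> [s s01|//|//|H]; first by rewrite A // /tri min_r ?max_l ?(ltW v12).
by apply: B => n2 n1; apply: H.
Qed.

Definition splice lo hi f h : R -> Q := fun s => if lo < s <= hi then f s else h s.

Lemma splice_left lo hi f h s : (\forall r \near s^'-, f r = f s) -> (\forall r \near s^'-,
  h r = h s) ->
  \forall r \near s^'-, splice lo hi f h r = splice lo hi f h s.
Proof.
move=> hf hh; have h1 := near_left_lt lo s; have h2 := near_left_le hi s.
near=> r; rewrite /splice.
have -> : (lo < r) = (lo < s) by near: r; exact: h1.
have -> : (r <= hi) = (s <= hi) by near: r; exact: h2.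
by case: ifP => _; near: r; [exact: hf|exact: hh].
Unshelve. all: by end_near. Qed.

Lemma splice_right lo hi f h s v : (\forall r \near s^'+, (if lo <= s < hi then f else h) r = v) ->
  \forall r \near s^'+, splice lo hi f h r = v.
Proof.
move=> hv; have h1 := near_right_lt lo s; have h2 := near_right_le hi s.
near=> r; rewrite /splice.
have -> : (lo < r) = (lo <= s) by near: r; exact: h1.
have -> : (r <= hi) = (s < hi) by near: r; exact: h2.
transitivity ((if lo <= s < hi then f else h) r); first by case: ifP.
by near: r; exact: hv.
Unshelve. all: by end_near. Qed.

End PiecewiseConstant.

Section ThirdMove.
Variables (R : realType) (T : Type) (Q : operator_quandle T) (P : polygon R) (a : vtx P).

(** What the two sides of the move have in common: one crossing with [X] and one with [Y], in an
    unspecified order. The old edge and the new pair of edges are thus treated by the same lemmas,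
    in both directions. *)
Record two_crossing_strand (l : seq (R * R)) (lb : labelling T a l) (X Y : vtx P)
    (zx zy : vtx (insert a l)) (sx tx sy ty : R) (LX LY : passage T) (bX bY : bool) : Prop :=
  TwoCrossingStrand {
  tc_x : on_strand zx;
  tc_y : on_strand zy;
  tc_mx : meet_at zx sx (inl X) tx;
  tc_my : meet_at zy sy (inl Y) ty;
  tc_only : forall (z : vtx (insert a l)) s f t, on_strand z -> meet_at z s f t ->
    f = inl X \/ f = inl Y;
  tc_onlyx : forall (z : vtx (insert a l)) s t, on_strand z -> meet_at z s (inl X) t ->
    z = zx /\ s = sx;
  tc_onlyy : forall (z : vtx (insert a l)) s t, on_strand z -> meet_at z s (inl Y) t ->
    z = zy /\ s = sy;
  tc_lx : lb zx (inl X) = LX;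
  tc_ly : lb zy (inl Y) = LY;
  tc_bx : (0 < det2 (dir zx) (dir (inl X : vtx (insert a l)))) = bX;
  tc_by : (0 < det2 (dir zy) (dir (inl Y : vtx (insert a l)))) = bY }.

Lemma two_crossing_swap l (lb : labelling T a l) X Y zx zy sx tx sy ty LX LY bX bY :
  @two_crossing_strand l lb X Y zx zy sx tx sy ty LX LY bX bY ->
  two_crossing_strand lb Y X zy zx sy ty sx tx LY LX bY bX.
Proof.
case=> a1 a2 a3 a4 a5 *; split=> // z s f t zs mt.
by case: (a5 _ _ _ _ zs mt) => ->; [right|left].
Qed.

(* [lo, hi] is the part of the edge [X] that lies in the triangle of the move. *)
Record window (X Y : vtx P) (lo hi c : R) : Prop := Window {
  wd_lo : 0 < lo;
  wd_hi : hi < 1;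
  wd_a : X != a;
  wd_in : lo <= c <= hi;
  wd_only : forall r f t, lo <= r <= hi -> f != a -> meet_at X r f t -> r = c }.

Lemma strand_sign l (lb : labelling T a l) (z : vtx (insert a l)) s f t : is_diagram lb ->
  meet_at z s f t ->
  (0 < det2 (dir f) (dir z)) = ~~ (0 < det2 (dir z) (dir f)).
Proof.
move=> ok /(meet_interior ok.1)[_ _ d0].
have -> : det2 (dir f) (dir z) = - det2 (dir z) (dir f) by rewrite /det2; ring.
by rewrite oppr_gt0; case: ltrgt0P d0.
Qed.

Lemma strand_mirror l (lb : labelling T a l) (z : vtx (insert a l)) s f t : is_diagram lb ->
  meet_at z s f t ->
  lb f z = mirror (lb z f).
Proof. by move=> ok m; apply: ok.2; exists s, t. Qed.

Section Setting.
Variables (X Y : vtx P) (lox hix zX loy hiy zY : R) (LXY : passage T).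
Hypotheses (wX : window X Y lox hix zX) (wY : window Y X loy hiy zY).
Hypothesis mXY : meet_at X zX Y zY.

Let Xa := wd_a wX.
Let Ya := wd_a wY.

Section Colors.
Variables (l : seq (R * R)) (lb : labelling T a l) (zx zy : vtx (insert a l)) (sx tx sy ty : R).
Variables (LX LY : passage T) (bX bY : bool).
Hypothesis ok : is_diagram lb.
Hypothesis tc : two_crossing_strand lb X Y zx zy sx tx sy ty LX LY bX bY.
Hypothesis lXY : lb (inl X) (inl Y) = LXY.
Hypotheses (inX : lox <= tx <= hix) (inY : loy <= ty <= hiy).

Let gJ := ok.1.
Local Notation J := (insert a l).
Local Notation m := ((size l).+1%:R : R).
Let px := spos zx sx.
Let py := spos zy sy.

Lemma XY_meet : @meet_at _ J (inl X) zX (inl Y) zY.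
Proof. exact: (iffRL (outer_meet l _ _ Xa Ya)). Qed.

Lemma tx_neq : tx != zX.
Proof.
apply/eqP => E; have := tc_mx tc; rewrite E => /meet_sym mx.
have [zE _] := meet_edge gJ mx XY_meet.
by have := tc_x tc; rewrite zE /= (negbTE Ya).
Qed.

Lemma px_neq : px != py.
Proof.
apply/eqP => E; have [_ s1 _ _] := tc_mx tc; have [_ s2 _ _] := tc_my tc.
have [zE sE] := spos_inj (tc_x tc) (tc_y tc) s1 s2 E.
have m1 := tc_mx tc; rewrite zE sE in m1.
have [[XE] _] := meet_edge gJ m1 (tc_my tc).
by case: mXY; rewrite XE eqxx.
Qed.

Lemma X_meets s f t : lox <= s <= hix -> @meet_at _ J (inl X) s f t ->
  (on_strand f /\ [/\ f = zx, t = sx & s = tx]) \/ [/\ f = inl Y, t = zY & s = zX].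
Proof.
move=> sw mt; have [fs|[y ya E]] := strandVouter f.
  have [E1 E2] := tc_onlyx tc fs (meet_sym mt); left; split=> //; split=> //.
  by subst f t; have [_ ->] := meet_param gJ (meet_sym mt) (tc_mx tc).
right; subst f; have mP := iffLR (outer_meet l _ _ Xa ya) mt.
have sE := wd_only wX sw ya mP; subst s.
by have [-> ->] := meet_edge gJ mt XY_meet.
Qed.


Let bXY := 0 < det2 (dir X) (dir Y).

Lemma strand_tri u (F : R -> Q) : strand_coloring lb u F -> exists me oe,
  [/\ forall c, 0 <= c <= m -> F c = tri px py (F 0) me oe c,
      act LX bX (F px) (u X tx) = bef (px < py) me oe &
      act LY bY (F py) (u Y ty) = bef (~~ (px < py)) me oe].
Proof.
move=> sc; have [_ sx1 _ _] := tc_mx tc; have [_ sy1 _ _] := tc_my tc.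
have rx : 0 <= px < m := spos_range_lt zx sx1; have ry : 0 <= py < m := spos_range_lt zy sy1.
have wx := sc_meet sc (tc_x tc) (tc_mx tc); rewrite glue_outer // (tc_lx tc) (tc_bx tc) -/px in wx.
have wy := sc_meet sc (tc_y tc) (tc_my tc); rewrite glue_outer // (tc_ly tc) (tc_by tc) -/py in wy.
have [||||me [oe [A B C _]]] := two_visits (h := F) (lo := 0) (hi := m) _ _ px_neq _ _ wx wy.
- by case/andP: rx => -> /ltW ->.
- by case/andP: ry => -> /ltW ->.
- by move=> c c01; exact: (sc_left sc c01).
- move=> c /andP[c0 _] cx cy cm; have [z [s [zs s01 cE]]] : exists (z : vtx J) s, [/\ on_strand z,
    0 <= s < 1 & c = spos z s].
    by apply: spos_exists; rewrite c0.
  rewrite cE; apply: (sc_free sc zs s01) => f t mt.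
  case: (tc_only tc zs mt) => E; rewrite E in mt.
    by have [E1 E2] := tc_onlyx tc zs mt; subst z s; rewrite cE eqxx in cx.
  by have [E1 E2] := tc_onlyy tc zs mt; subst z s; rewrite cE eqxx in cy.
exists me, oe; split=> //.
by rewrite C /bef; case: (px < py).
Qed.

Lemma X_tri u (F : R -> Q) : strand_coloring lb u F -> exists mx ox,
  [/\ forall s, lox <= s <= hix -> u X s = tri tx zX (u X lox) mx ox s,
      act (mirror LX) (~~ bX) (u X tx) (F px) = bef (tx < zX) mx ox,
      act LXY bXY (u X zX) (u Y zY) = bef (~~ (tx < zX)) mx ox &
      \forall r \near hix^'+, u X r = ox].
Proof.
move=> sc; have lo0 := wd_lo wX; have hi1 := wd_hi wX.
have wx := sc_meet_outer sc Xa (meet_sym (tc_mx tc)).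
rewrite (strand_mirror ok (tc_mx tc)) (strand_sign ok (tc_mx tc)) in wx.
rewrite (glue_strand _ _ _ (tc_x tc)) (tc_lx tc) (tc_bx tc) -/px in wx.
have wy := sc_meet_outer sc Xa XY_meet; rewrite glue_outer // !outer_dir // lXY -/bXY in wy.
have free s : lox <= s <= hix -> s != tx -> s != zX -> \forall r \near s^'+, u X r = u X s.
  move=> sw s1 s2; apply: (sc_free_outer sc Xa); first by lra.
  by move=> f t /(X_meets sw)[[_ [_ _ E]]|[_ _ E]]; [rewrite E eqxx in s1|rewrite E eqxx in s2].
have [||mx [ox [A B C D]]] := two_visits inX (wd_in wX) tx_neq _ _ wx wy.
- by move=> s s01; apply: (sc_left_outer sc Xa); lra.
- by move=> s s01 s1 s2 _; apply: free.
exists mx, ox; split=> //.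
- by rewrite C /bef; case: (tx < zX).
- by apply: D => h1 h2; apply: free => //; rewrite lexx andbT; case/andP: inX => /le_trans; apply.
Qed.

End Colors.


Lemma XY_sign (l : seq (R * R)) (lb : labelling T a l) : is_diagram lb ->
  (0 < det2 (dir Y) (dir X)) = ~~ (0 < det2 (dir X) (dir Y)).
Proof.
move=> ok; have m := iffRL (outer_meet l zX zY Xa Ya) mXY.
by have := strand_sign ok m; rewrite !outer_dir.
Qed.

Lemma XY_mirror (l : seq (R * R)) (lb : labelling T a l) : is_diagram lb ->
  lb (inl X) (inl Y) = LXY -> lb (inl Y) (inl X) = mirror LXY.
Proof.
move=> ok <-; exact: strand_mirror ok (iffRL (outer_meet l zX zY Xa Ya) mXY).
Qed.

End Setting.

(** On the strand and on both windows the colour is a [tri] function, and the rules of the three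
    crossings, two each, become the system [three_strands] in the nine values. *)
Lemma two_crossing_colors (X Y : vtx P) (lox hix zX loy hiy zY : R) (LXY : passage T)
    (l : seq (R * R)) (lb : labelling T a l) (zx zy : vtx (insert a l)) (sx tx sy ty : R)
    (LX LY : passage T) (bX bY : bool) u (F : R -> Q) :
  window X Y lox hix zX -> window Y X loy hiy zY -> meet_at X zX Y zY -> is_diagram lb ->
  two_crossing_strand lb X Y zx zy sx tx sy ty LX LY bX bY -> lb (inl X) (inl Y) = LXY ->
  lox <= tx <= hix -> loy <= ty <= hiy -> strand_coloring lb u F ->
  exists me oe mx ox my oy,
  [/\ three_strands (spos zx sx < spos zy sy) (tx < zX) (ty < zY) bX bY (0 < det2 (dir X) (dir Y))
        LX LY LXY (F 0) me oe (u X lox) mx ox (u Y loy) my oy,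
      forall c, 0 <= c <= (size l).+1%:R -> F c = tri (spos zx sx) (spos zy sy) (F 0) me oe c,
      forall s, lox <= s <= hix -> u X s = tri tx zX (u X lox) mx ox s,
      forall s, loy <= s <= hiy -> u Y s = tri ty zY (u Y loy) my oy s &
      (\forall r \near hix^'+, u X r = ox) /\ (\forall r \near hiy^'+, u Y r = oy)].
Proof.
move=> wX wY mXY ok tc lXY inX inY sc; have tc' := two_crossing_swap tc.
have lYX := XY_mirror wX wY mXY ok lXY.
have [me [oe [A1 A2 A3]]] := strand_tri wX wY mXY ok tc sc.
have [mx [ox [B1 B2 B3 B4]]] := X_tri wX wY mXY ok tc lXY inX sc.
have [my [oy [C1 C2 C3 C4]]] := X_tri wY wX (meet_sym mXY) ok tc' lYX inY sc.
exists me, oe, mx, ox, my, oy; split=> //.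
have nX := tx_neq wX wY mXY ok tc; have nY := tx_neq wY wX (meet_sym mXY) ok tc'.
have np := px_neq mXY ok tc.
have [_ sx1 _ _] := tc_mx tc; have [_ sy1 _ _] := tc_my tc.
have rx : 0 <= spos zx sx <= (size l).+1%:R by have /andP[-> /ltW ->] := spos_range_lt zx sx1.
have ry : 0 <= spos zy sy <= (size l).+1%:R by have /andP[-> /ltW ->] := spos_range_lt zy sy1.
have F1 : F (spos zx sx) = bef (spos zx sx < spos zy sy) (F 0) me by rewrite A1 // tri_at1.
have F2 : F (spos zy sy) = bef (~~ (spos zx sx < spos zy sy)) (F 0) me.
  by rewrite A1 // tri_at2 // /bef; case: (_ < _).
have X1 : u X tx = bef (tx < zX) (u X lox) mx by rewrite B1 // tri_at1.
have X2 : u X zX = bef (~~ (tx < zX)) (u X lox) mx.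
  by rewrite B1 ?(wd_in wX) // tri_at2 // /bef; case: (_ < _).
have Y1 : u Y ty = bef (ty < zY) (u Y loy) my by rewrite C1 // tri_at1.
have Y2 : u Y zY = bef (~~ (ty < zY)) (u Y loy) my.
  by rewrite C1 ?(wd_in wY) // tri_at2 // /bef; case: (_ < _).
rewrite (XY_sign wX wY mXY ok) in C3.
by split; rewrite -?F1 -?F2 -?X1 -?X2 -?Y1 -?Y2.
Qed.

End ThirdMove.

Section ThirdMoveTransfer.
Variables (R : realType) (T : Type) (Q : operator_quandle T) (P : polygon R) (a : vtx P).

Section OneEdge.
Variables (X Y : vtx P) (lox hix zX loy hiy zY : R) (LXY : passage T).
Hypotheses (wX : window a X Y lox hix zX) (wY : window a Y X loy hiy zY).
Hypothesis mXY : meet_at X zX Y zY.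
Variables (l1 l2 : seq (R * R)) (lab1 : labelling T a l1) (lab2 : labelling T a l2).
Hypotheses (ok1 : is_diagram lab1) (ok2 : is_diagram lab2).
Hypothesis so : same_outside lab1 lab2.
Variables (zx1 zy1 : vtx (insert a l1)) (sx1 tx1 sy1 ty1 : R).
Variables (zx2 zy2 : vtx (insert a l2)) (sx2 tx2 sy2 ty2 : R).
Variables (LX LY : passage T) (bX bY : bool).
Hypothesis tc1 : two_crossing_strand lab1 X Y zx1 zy1 sx1 tx1 sy1 ty1 LX LY bX bY.
Hypothesis tc2 : two_crossing_strand lab2 X Y zx2 zy2 sx2 tx2 sy2 ty2 LX LY bX bY.
Hypotheses (inX1 : lox <= tx1 <= hix) (inX2 : lox <= tx2 <= hix).
Hypothesis lXY : lab2 (inl X) (inl Y) = LXY.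
Variables (u u' : vtx P -> R -> Q) (F F' : R -> Q) (mx ox : Q) (f : R -> Q).
Hypothesis sc : strand_coloring lab1 u F.
Hypothesis oxE : \forall r \near hix^'+, u X r = ox.
Hypothesis u'X : u' X = splice lox hix (tri tx2 zX (u X lox) mx ox) (u X).
Hypothesis u'Y : u' Y = splice loy hiy f (u Y).
Hypothesis u'o : forall x, x != X -> x != Y -> u' x = u x.
Hypothesis Ex : bef (tx2 < zX) mx ox = act (mirror LX) (~~ bX) (u' X tx2) (F' (spos zx2 sx2)).
Hypothesis Ey : bef (~~ (tx2 < zX)) mx ox = act LXY (0 < det2 (dir X) (dir Y)) (u' X zX) (u' Y zY).

Let Xa := wd_a wX.
Let Ya := wd_a wY.

Let nX : tx2 != zX := tx_neq wX wY mXY ok2 tc2.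

Let inside s : lox <= s <= hix -> u' X s = tri tx2 zX (u X lox) mx ox s.
Proof.
move=> /andP[ls sh]; rewrite u'X /splice sh andbT; case: ltP => // sl.
have -> : s = lox by apply/eqP; rewrite eq_le sl ls.
rewrite tri_first //; first by case/andP: inX2.
by have /andP[] := wd_in wX.
Qed.

Let inside_right s : lox <= s <= hix ->
  \forall r \near s^'+, u' X r = tri_right tx2 zX (u X lox) mx ox s.
Proof.
move=> /andP[ls sh]; rewrite u'X; apply: splice_right; rewrite ls /=.
move: sh; rewrite le_eqVlt => /orP[/eqP ->|sh]; last by rewrite sh; exact: tri_rightP.
rewrite ltxx tri_right_last //; first by case/andP: inX2.
by have /andP[] := wd_in wX.
Qed.

Let outside s : ~~ (lox <= s <= hix) -> u' X s = u X s.
Proof.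
move=> ns; rewrite u'X /splice ifF //; apply: contraNF ns => /andP[/ltW -> ->] //.
Qed.

Let outside_right s v : ~~ (lox <= s <= hix) -> (\forall r \near s^'+, u X r = v) ->
  \forall r \near s^'+, u' X r = v.
Proof.
move=> ns uv; rewrite u'X; apply: splice_right; rewrite ifF //.
by apply: contraNF ns => /andP[-> /ltW ->].
Qed.

Lemma rebuilt_left s : 0 < s <= 1 -> \forall r \near s^'-, u' X r = u' X s.
Proof.
move=> s01; rewrite u'X; apply: splice_left; first exact: tri_left.
exact: (sc_left_outer sc Xa s01).
Qed.

Lemma rebuilt_free s : 0 <= s < 1 -> (forall e t, ~ @meet_at _ (insert a l2) (inl X) s e t) ->
  \forall r \near s^'+, u' X r = u' X s.
Proof.
move=> s01 nm; have [sw|sw] := boolP (lox <= s <= hix).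
  rewrite inside // -(@tri_right_free _ _ tx2 zX); first exact: inside_right.
    by apply/eqP => E; subst s; apply: (nm zx2 sx2); apply: meet_sym; exact: tc_mx tc2.
  apply/eqP => E; subst s; apply: (nm (inl Y) zY); exact: (iffRL (outer_meet l2 _ _ Xa Ya)).
rewrite outside //; apply: outside_right => //; apply: (sc_free_outer sc Xa s01) => e t mt.
have [es|[y ya E]] := strandVouter e; last first.
  subst e; apply: (nm (inl y) t); apply: (iffRL (outer_meet l2 _ _ Xa ya)).
  exact: (iffLR (outer_meet l1 _ _ Xa ya) mt).
have [E1 E2] := tc_onlyx tc1 es (meet_sym mt); subst e t.
have [_ E] := meet_param ok1.1 (meet_sym mt) (tc_mx tc1).
by rewrite E inX1 in sw.
Qed.

(** Inside the window the rules are [Ex] and [Ey]. Outside it the old rule persists, because a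
    crossing with [Y] in the window of [Y] would be at [zY], hence at [zX] on [X]. The lemma is used
    a second time with [X] and [Y] exchanged. *)
Lemma rebuilt_meet s e t : @meet_at _ (insert a l2) (inl X) s e t ->
  \forall r \near s^'+, u' X r =
    act (lab2 (inl X) e) (0 < det2 (dir (inl X : vtx (insert a l2))) (dir e)) (u' X s) (glue u' F'
      e t).
Proof.
move=> mt; have [sw|sw] := boolP (lox <= s <= hix).
  have [[es [E1 E2 E3]]|[E1 E2 E3]] := X_meets wX wY mXY ok2 tc2 sw mt; subst e t s.
    rewrite (strand_mirror ok2 (tc_mx tc2)) (strand_sign ok2 (tc_mx tc2)).
    rewrite (glue_strand _ _ _ (tc_x tc2)) (tc_lx tc2) (tc_bx tc2) -Ex /bef.
    by rewrite -(tri_right1 (u X lox) mx ox nX); exact: inside_right.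
  rewrite glue_outer // !outer_dir // lXY -Ey /bef.
  have -> : (if ~~ (tx2 < zX) then mx else ox) = tri_right tx2 zX (u X lox) mx ox zX.
    by rewrite tri_right2 //; case: (_ < _).
  exact: inside_right.
have [es|[y ya E]] := strandVouter e.
  have [E1 E2] := tc_onlyx tc2 es (meet_sym mt); subst e t.
  have [_ E] := meet_param ok2.1 (meet_sym mt) (tc_mx tc2).
  by rewrite E inX2 in sw.
subst e; have mP := iffLR (outer_meet l2 _ _ Xa ya) mt.
have m1 := iffRL (outer_meet l1 _ _ Xa ya) mP.
have := sc_meet_outer sc Xa m1; rewrite !glue_outer // !outer_dir // (so Xa ya); last by exists s,
  t.
rewrite outside //; have -> : u' y t = u y t.
  have [yX|yX] := eqVneq y X; first by case: mP; rewrite yX eqxx.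
  have [yY|yY] := eqVneq y Y; last by rewrite u'o.
  subst y; rewrite u'Y /splice; case: ifP => // /andP[lt th].
  have tE : t = zY by apply: (wd_only wY _ Xa (meet_sym mP)); rewrite ltW.
  subst t; have [E _] := meet_param ok1.1 m1 (iffRL (outer_meet l1 _ _ Xa ya) mXY).
  by rewrite E (wd_in wX) in sw.
exact: outside_right.
Qed.

End OneEdge.

Section Transfer.
Variables (X Y : vtx P) (lox hix zX loy hiy zY : R) (LXY : passage T).
Hypotheses (wX : window a X Y lox hix zX) (wY : window a Y X loy hiy zY).
Hypothesis mXY : meet_at X zX Y zY.
Variables (l1 l2 : seq (R * R)) (lab1 : labelling T a l1) (lab2 : labelling T a l2).
Hypotheses (ok1 : is_diagram lab1) (ok2 : is_diagram lab2).
Hypothesis so : same_outside lab1 lab2.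
Variables (zx1 zy1 : vtx (insert a l1)) (sx1 tx1 sy1 ty1 : R).
Variables (zx2 zy2 : vtx (insert a l2)) (sx2 tx2 sy2 ty2 : R).
Variables (LX LY : passage T) (bX bY : bool).
Hypothesis tc1 : two_crossing_strand lab1 X Y zx1 zy1 sx1 tx1 sy1 ty1 LX LY bX bY.
Hypothesis tc2 : two_crossing_strand lab2 X Y zx2 zy2 sx2 tx2 sy2 ty2 LX LY bX bY.
Hypotheses (inX1 : lox <= tx1 <= hix) (inX2 : lox <= tx2 <= hix).
Hypotheses (inY1 : loy <= ty1 <= hiy) (inY2 : loy <= ty2 <= hiy).
Hypothesis lXY : lab2 (inl X) (inl Y) = LXY.
Let bXY := 0 < det2 (dir X) (dir Y).
Let px1 := spos zx1 sx1.
Let py1 := spos zy1 sy1.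
Let px2 := spos zx2 sx2.
Let py2 := spos zy2 sy2.
Hypotheses (flip_e : (px2 < py2) = ~~ (px1 < py1)) (flip_X : (tx2 < zX) = ~~ (tx1 < zX))
  (flip_Y : (ty2 < zY) = ~~ (ty1 < zY)).
Hypotheses (par1 : bX (+) (tx1 < zX) = bY (+) (ty1 < zY))
  (par2 : bX (+) (px1 < py1) = bXY (+) (ty1 < zY)).
Hypotheses (cX : classical LX) (cY : classical LY) (cXY : classical LXY).
Hypothesis acyclic : ~ (LX = LXY /\ LXY = mirror LY).

Let Xa := wd_a wX.
Let Ya := wd_a wY.

Definition third_move_related (u : vtx P -> R -> Q) (F : R -> Q) (u' : vtx P -> R -> Q) (F' : R ->
  Q) :=
  (forall x s, (x = X -> ~~ (lox < s <= hix)) -> (x = Y -> ~~ (loy < s <= hiy)) ->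
    u x s = u' x s) /\
  F 0 = F' 0.

Let l2XY : lab1 (inl X) (inl Y) = LXY.
Proof. by rewrite (so Xa Ya) //; exists zX, zY. Qed.

(** Only the middle colours are replaced, by those of the flipped system. The incoming and outgoing
    ones are kept, so the new values fit the old ones at the ends of the windows and of the
    strand. *)
Lemma third_move_transfer u (F : R -> Q) : strand_coloring lab1 u F ->
  exists u' F', strand_coloring lab2 u' F' /\ third_move_related u F u' F'.
Proof.
move=> sc; have XY : Y != X by rewrite eq_sym; case: mXY.
have [me1 [oe [mx1 [ox [my1 [oy [H1 FE uX uY [limX limY]]]]]]]] :=
  two_crossing_colors wX wY mXY ok1 tc1 l2XY inX1 inY1 sc.
have [me [mx [my]]] := three_strands_flip par1 par2 cX cY cXY acyclic H1.
rewrite -flip_e -flip_X -flip_Y => -[E1 E2 E3 E4 [E5 E6]].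
pose uX' := splice lox hix (tri tx2 zX (u X lox) mx ox) (u X).
pose uY' := splice loy hiy (tri ty2 zY (u Y loy) my oy) (u Y).
pose u' x := if x == X then uX' else if x == Y then uY' else u x.
pose F' := tri px2 py2 (F 0) me oe.
have u'X : u' X = uX' by rewrite /u' eqxx.
have u'Y : u' Y = uY' by rewrite /u' (negbTE XY) eqxx.
have u'o x : x != X -> x != Y -> u' x = u x by rewrite /u' => /negbTE -> /negbTE ->.
have tc1' := two_crossing_swap tc1; have tc2' := two_crossing_swap tc2.
have mYX := meet_sym mXY.
have nX := tx_neq wX wY mXY ok2 tc2; have nY := tx_neq wY wX mYX ok2 tc2'.
have np := px_neq mXY ok2 tc2; rewrite -/px2 -/py2 in np.
have lYX := XY_mirror wX wY mXY ok2 lXY.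
have splice_in lo hi v w (i m o : Q) h s : lo <= v <= hi -> lo <= w <= hi -> lo <= s <= hi ->
  i = h lo ->
    splice lo hi (tri v w i m o) h s = tri v w i m o s.
  move=> /andP[lv vh] /andP[lw wh] /andP[ls sh] iE; rewrite /splice sh andbT; case: ltP => // sl.
  have -> : s = lo by apply/eqP; rewrite eq_le sl ls.
  by rewrite tri_first.
have F'x : F' px2 = bef (px2 < py2) (F 0) me by rewrite /F' tri_at1.
have F'y : F' py2 = bef (~~ (px2 < py2)) (F 0) me by rewrite /F' tri_at2 // /bef; case: (_ < _).
have X't : u' X tx2 = bef (tx2 < zX) (u X lox) mx.
  by rewrite u'X /uX' splice_in ?(wd_in wX) // tri_at1.
have X'z : u' X zX = bef (~~ (tx2 < zX)) (u X lox) mx.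
  by rewrite u'X /uX' splice_in ?(wd_in wX) // tri_at2 // /bef; case: (_ < _).
have Y't : u' Y ty2 = bef (ty2 < zY) (u Y loy) my.
  by rewrite u'Y /uY' splice_in ?(wd_in wY) // tri_at1.
have Y'z : u' Y zY = bef (~~ (ty2 < zY)) (u Y loy) my.
  by rewrite u'Y /uY' splice_in ?(wd_in wY) // tri_at2 // /bef; case: (_ < _).
rewrite -?F'x -?F'y -?X't -?X'z -?Y't -?Y'z in E1 E2 E3 E4 E5 E6.
have sYX := XY_sign wX wY mXY ok2; rewrite -sYX in E6.
have Xleft := rebuilt_left wX sc u'X; have Yleft := rebuilt_left wY sc u'Y.
have Xfree := rebuilt_free wX wY mXY ok1 tc1 tc2 inX1 inX2 sc limX u'X.
have Yfree := rebuilt_free wY wX mYX ok1 tc1' tc2' inY1 inY2 sc limY u'Y.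
have Xmeet := rebuilt_meet wX wY mXY ok1 ok2 so tc2 inX2 lXY sc limX u'X u'Y u'o E3 E5.
have Ymeet := rebuilt_meet wY wX mYX ok1 ok2 so tc2' inY2 lYX sc limY u'Y u'X (fun x xY xX => u'o x
  xX xY) E4 E6.
have [loX0 hiX1 loY0 hiY1] := And4 (wd_lo wX) (wd_hi wX) (wd_lo wY) (wd_hi wY).
have end0 x : u' x 0 = u x 0.
  rewrite /u'; case: eqP => [->|_]; first by rewrite /uX' /splice (lt_gtF loX0).
  by case: eqP => [->|_] //; rewrite /uY' /splice (lt_gtF loY0).
have end1 x : u' x 1 = u x 1.
  rewrite /u'; case: eqP => [->|_]; first by rewrite /uX' /splice [1 <= hix]leNgt hiX1 andbF.
  by case: eqP => [->|_] //; rewrite /uY' /splice [1 <= hiy]leNgt hiY1 andbF.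
have [_ s2x _ _] := tc_mx tc2; have [_ s2y _ _] := tc_my tc2.
have /andP[px0 pxm] := spos_range_lt zx2 s2x; have /andP[py0 pym] := spos_range_lt zy2 s2y.
have [_ s1x _ _] := tc_mx tc1; have [_ s1y _ _] := tc_my tc1.
have /andP[px10 px1m] := spos_range_lt zx1 s1x; have /andP[py10 py1m] := spos_range_lt zy1 s1y.
have F'0 : F' 0 = F 0 by rewrite /F' tri_first.
have F'm : F' (size l2).+1%:R = F (size l1).+1%:R.
  by rewrite /F' tri_last // FE ?lexx ?ler0n // tri_last.
exists u', F'; split; last first.
  split=> // x s hX hY; rewrite /u'; case: eqP => [xX|_].
    by subst x; rewrite /uX' /splice (negbTE (hX erefl)).
  by case: eqP => [xY|_] //; subst x; rewrite /uY' /splice (negbTE (hY erefl)).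
split.
- move=> x s xa s01; have [->|xX] := eqVneq x X; first exact: Xleft.
  have [->|xY] := eqVneq x Y; first exact: Yleft.
  by rewrite u'o //; exact: (sc_left_outer sc xa s01).
- by move=> c _; exact: tri_left.
- move=> x s xa s01 nm; have [xE|xX] := eqVneq x X; first by subst x; exact: Xfree.
  have [xE|xY] := eqVneq x Y; first by subst x; exact: Yfree.
  rewrite u'o //; apply: (sc_free_outer sc xa s01) => e t mt.
  have [es|[y ya E]] := strandVouter e.
    by case: (tc_only tc1 es (meet_sym mt)) => -[xE]; [rewrite xE eqxx in xX|rewrite xE eqxx in xY].
  subst e; apply: (nm (inl y) t); apply: (iffRL (outer_meet l2 _ _ xa ya)).
  exact: (iffLR (outer_meet l1 _ _ xa ya) mt).
- move=> z s zs s01 nm; have <- : tri_right px2 py2 (F 0) me oe (spos z s) = F' (spos z s);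
    last exact: tri_rightP.
  apply: tri_right_free.
    apply/eqP => E; have [E1' E2'] := spos_inj zs (tc_x tc2) s01 s2x E; subst z s.
    exact: (nm _ _ (tc_mx tc2)).
  apply/eqP => E; have [E1' E2'] := spos_inj zs (tc_y tc2) s01 s2y E; subst z s.
  exact: (nm _ _ (tc_my tc2)).
- move=> x s e t xa mt; have [xE|xX] := eqVneq x X; first by subst x; exact: Xmeet.
  have [xE|xY] := eqVneq x Y; first by subst x; exact: Ymeet.
  have [es|[y ya E]] := strandVouter e.
    by case: (tc_only tc2 es (meet_sym mt)) => -[xE]; [rewrite xE eqxx in xX|rewrite xE eqxx in xY].
  subst e; have mP := iffLR (outer_meet l2 _ _ xa ya) mt.
  have m1 := iffRL (outer_meet l1 _ _ xa ya) mP.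
  have := sc_meet_outer sc xa m1; rewrite !glue_outer // !outer_dir // (so xa ya);
    last by exists s, t.
  rewrite u'o //; suff -> : u' y t = u y t by [].
  rewrite /u'; case: eqP => [yX|_].
    subst y; rewrite /uX' /splice; case: ifP => // /andP[lt th].
    have tE : t = zX by apply: (wd_only wX _ xa (meet_sym mP)); rewrite ltW.
    subst t; have [E _] := meet_edge ok1.1 (meet_sym m1) (iffRL (outer_meet l1 _ _ Xa Ya) mXY).
    by case: E => E; rewrite E eqxx in xY.
  case: eqP => [yY|_] //.
  subst y; rewrite /uY' /splice; case: ifP => // /andP[lt th].
  have tE : t = zY by apply: (wd_only wY _ xa (meet_sym mP)); rewrite ltW.
  subst t; have [E _] := meet_edge ok1.1 (meet_sym m1) (iffRL (outer_meet l1 _ _ Ya Xa) mYX).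
  by case: E => E; rewrite E eqxx in xX.
- move=> z s e t zs mt; case: (tc_only tc2 zs mt) => E; subst e.
    have [E1' E2'] := tc_onlyx tc2 zs mt; subst z s.
    have [_ tE] := meet_param ok2.1 mt (tc_mx tc2); subst t.
    rewrite glue_outer // (tc_lx tc2) (tc_bx tc2) -E1 /bef -(tri_right1 (F 0) me oe np).
    exact: tri_rightP.
  have [E1' E2'] := tc_onlyy tc2 zs mt; subst z s.
  have [_ tE] := meet_param ok2.1 mt (tc_my tc2); subst t.
  rewrite glue_outer // (tc_ly tc2) (tc_by tc2) -E2 /bef.
  have -> : (if ~~ (px2 < py2) then me else oe) = tri_right px2 py2 (F 0) me oe py2.
    by rewrite tri_right2 //; case: (_ < _).
  exact: tri_rightP.
- by move=> x xa nx; rewrite end0 end1 (sc_next sc).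
- by move=> x xa nx; rewrite end1 F'0 (sc_start sc xa nx).
- by move=> na; rewrite end0 F'm (sc_end sc na).
- by move=> na; rewrite F'0 F'm (sc_loop sc na).
Qed.

(** In a non-cyclic order the top strand keeps its colour at both crossings, and each lower one
    depends only on strands already settled, so the incoming colours force everything. *)
Lemma third_move_determined u (F : R -> Q) v G : strand_coloring lab1 u F ->
  strand_coloring lab1 v G ->
  (forall x s, x != a -> 0 <= s <= 1 -> (x = X -> ~~ (lox < s <= hix)) ->
     (x = Y -> ~~ (loy < s <= hiy)) -> u x s = v x s) ->
  F 0 = G 0 -> same_strand_points a l1 u F v G.
Proof.
move=> sc sc' out FG; have XY : X != Y by case: mXY.
have [loX0 hiX1 loY0 hiY1] := And4 (wd_lo wX) (wd_hi wX) (wd_lo wY) (wd_hi wY).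
have /andP[lX hX] := wd_in wX; have /andP[lY hY] := wd_in wY.
have pc := strand_coloring_point sc; have pc' := strand_coloring_point sc'.
have lYX := XY_mirror wX wY mXY ok1 l2XY.
have uX0 : u X lox = v X lox.
  by apply: out => //; [lra|rewrite ltxx|move=> E; rewrite E eqxx in XY].
have uY0 : u Y loy = v Y loy.
  by apply: out => //; [lra|move=> E; rewrite E eqxx in XY|rewrite ltxx].
have claim_e : (LX = Under -> forall s, lox <= s <= hix -> u X s = v X s) ->
    (LY = Under -> forall s, loy <= s <= hiy -> u Y s = v Y s) ->
    forall c : R, 0 <= c <= (size l1).+1%:R -> F c = G c.
  move=> hx hy; apply: (strand_agree sc sc') => // z s e t zs _ mt.
  case: (tc_only tc1 zs mt) => E; subst e.
    have [E1 E2] := tc_onlyx tc1 zs mt; subst z s.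
    have [_ tE] := meet_param ok1.1 mt (tc_mx tc1); subst t; rewrite (tc_lx tc1) !glue_outer //.
    by case: (LX) hx => [_|h|? _]; [left|right; apply: h|left].
  have [E1 E2] := tc_onlyy tc1 zs mt; subst z s.
  have [_ tE] := meet_param ok1.1 mt (tc_my tc1); subst t; rewrite (tc_ly tc1) !glue_outer //.
  by case: (LY) hy => [_|h|? _]; [left|right; apply: h|left].
have claim_X : (mirror LX = Under -> F px1 = G px1) ->
    (LXY = Under -> u Y zY = v Y zY) -> forall s, lox <= s <= hix -> u X s = v X s.
  move=> he hy s sw; rewrite -(glue_outer l1 u F s Xa) -(glue_outer l1 v G s Xa).
  apply: (pc_agree pc pc' _ _ _ _ sw); [exact: ltW|exact: ltW|by rewrite !glue_outer|].
  move=> r e t /andP[r1 r2] mt; have rw : lox <= r <= hix by rewrite r1 ltW.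
  have [[es [E1 E2 E3]]|[E1 E2 E3]] := X_meets wX wY mXY ok1 tc1 rw mt; subst e t r.
    rewrite (strand_mirror ok1 (tc_mx tc1)) (tc_lx tc1) !(glue_strand _ _ _ (tc_x tc1)).
    by case: (LX) he => [h|_|? _]; [right; apply: h|left|left].
  rewrite l2XY !glue_outer //; by case: (LXY) hy => [_|h|? _]; [left|right; apply: h|left].
have tc1' := two_crossing_swap tc1.
have claim_Y : (mirror LY = Under -> F py1 = G py1) ->
    (mirror LXY = Under -> u X zX = v X zX) -> forall s, loy <= s <= hiy -> u Y s = v Y s.
  move=> he hx s sw; rewrite -(glue_outer l1 u F s Ya) -(glue_outer l1 v G s Ya).
  apply: (pc_agree pc pc' _ _ _ _ sw); [exact: ltW|exact: ltW|by rewrite !glue_outer|].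
  move=> r e t /andP[r1 r2] mt; have rw : loy <= r <= hiy by rewrite r1 ltW.
  have [[es [E1 E2 E3]]|[E1 E2 E3]] := X_meets wY wX (meet_sym mXY) ok1 tc1' rw mt; subst e t r.
    rewrite (strand_mirror ok1 (tc_my tc1)) (tc_ly tc1) !(glue_strand _ _ _ (tc_y tc1)).
    by case: (LY) he => [h|_|? _]; [right; apply: h|left|left].
  rewrite lYX !glue_outer //; by case: (LXY) hx => [h|_|? _]; [right; apply: h|left|left].
have [_ s1x _ _] := tc_mx tc1; have [_ s1y _ _] := tc_my tc1.
have rx : 0 <= px1 <= (size l1).+1%:R by have /andP[-> /ltW ->] := spos_range_lt zx1 s1x.
have ry : 0 <= py1 <= (size l1).+1%:R by have /andP[-> /ltW ->] := spos_range_lt zy1 s1y.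
(* Six of the eight cases are orders by height, settled from top to bottom; the other two are the
   cycles. *)
have [AX AY AF] : [/\ forall s, lox <= s <= hix -> u X s = v X s,
    forall s, loy <= s <= hiy -> u Y s = v Y s &
    forall c : R, 0 <= c <= (size l1).+1%:R -> F c = G c].
  move: claim_e claim_X claim_Y acyclic cX cY cXY.
  case: (LX) => // ce cx cy ac _; case: (LY) ce cy ac => // ce cy ac _;
    case: (LXY) cx cy ac => // cx cy ac _.
  - have e := ce ltac:(by []) ltac:(by []); have x := cx (fun _ => e _ rx) ltac:(by []).
    by have y := cy (fun _ => e _ ry) (fun _ => x _ (wd_in wX)).
  - have e := ce ltac:(by []) ltac:(by []); have y := cy (fun _ => e _ ry) ltac:(by []).
    by have x := cx (fun _ => e _ rx) (fun _ => y _ (wd_in wY)).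
  - by case: ac.
  - have y := cy ltac:(by []) ltac:(by []); have e := ce ltac:(by []) (fun _ => y).
    by have x := cx (fun _ => e _ rx) (fun _ => y _ (wd_in wY)).
  - have x := cx ltac:(by []) ltac:(by []); have e := ce (fun _ => x) ltac:(by []).
    by have y := cy (fun _ => e _ ry) (fun _ => x _ (wd_in wX)).
  - by case: ac.
  - have x := cx ltac:(by []) ltac:(by []); have y := cy ltac:(by []) (fun _ => x _ (wd_in wX)).
    by have e := ce (fun _ => x) (fun _ => y).
  - have y := cy ltac:(by []) ltac:(by []); have x := cx ltac:(by []) (fun _ => y _ (wd_in wY)).
    by have e := ce (fun _ => x) (fun _ => y).
split=> // x s xa s01.
have [xw|xw] := boolP [&& x == X, lox < s & s <= hix].
  by case/and3P: xw => /eqP -> h1 h2; apply: AX; rewrite ltW.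
have [yw|yw] := boolP [&& x == Y, loy < s & s <= hiy].
  by case/and3P: yw => /eqP -> h1 h2; apply: AY; rewrite ltW.
apply: out => // E; subst x; first by rewrite eqxx in xw.
by rewrite eqxx in yw.
Qed.

End Transfer.
End ThirdMoveTransfer.

(** * Geometry of the triangle of a move *)

Section TriangleGeometry.
Variables (R : realType) (P : polygon R) (a : vtx P).
Implicit Types (x y : vtx P) (q A B p : R * R).

(** An affine function of [q] that is positive to the left of the directed line of [x]. *)
Definition side x q : R := det2 (dir x) (q - pos x).

Lemma side_pt x s : side x (pt x s) = 0.
Proof. by rewrite /side ptE /det2 /=; ring. Qed.

Lemma side_edge (l : seq (R * R)) x (z : vtx (insert a l)) (s : R) :
  side x (pt z s) = (1 - s) * side x (pos z) + s * side x (pos (nextv z)).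
Proof. by rewrite /side ptE /det2 /dir /=; ring. Qed.

Lemma side_dir (l : seq (R * R)) x (z : vtx (insert a l)) :
  det2 (dir z) (dir x) = side x (pos z) - side x (pos (nextv z)).
Proof. by rewrite /side /det2 {1 3}/dir /=; ring. Qed.

(** By [side_edge] the function [side x] is affine along [z]; it vanishes at an interior point and
    is not constant, by transversality. *)
Lemma opposite_sides (l : seq (R * R)) x (z : vtx (insert a l)) (s t : R) : generic (insert a l) ->
  x != a ->
  meet_at z s (inl x) t ->
  side x (pos z) * side x (pos (nextv z)) < 0 /\
  (0 < det2 (dir z) (dir (inl x : vtx (insert a l)))) = (0 < side x (pos z)).
Proof.
move=> gJ xa mt; have [/andP[s0 s1] _] := meet_interior gJ mt.
have [_ _ _ E] := mt; rewrite outer_pt // in E.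
have := side_edge x z s; rewrite E side_pt outer_dir // side_dir => E0 d0.
move: (side x (pos z)) (side x (pos (nextv z))) E0 d0 => u v E0 d0.
have E1 : (1 - s) * u = - (s * v) by lra.
have [u0|u0|u0] := ltrgt0P u.
- have : 0 < (1 - s) * u by rewrite mulr_gt0 ?subr_gt0.
  rewrite E1 oppr_gt0 => v0.
  rewrite pmulr_rlt0 // in v0.
  by split; [rewrite pmulr_rlt0|rewrite subr_gt0 (lt_trans v0)].
- have : 0 < (1 - s) * - u by rewrite mulr_gt0 ?subr_gt0 ?oppr_gt0.
  rewrite mulrN E1 opprK => v0.
  rewrite pmulr_rgt0 // in v0.
  by split; [rewrite nmulr_rlt0|rewrite subr_gt0; apply/lt_gtF/(lt_trans u0)].
exfalso; move: E1 d0; rewrite u0 mulr0 => /esym/eqP.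
by rewrite oppr_eq0 mulf_eq0 gt_eqF //= => /eqP ->; rewrite subrr eqxx.
Qed.

Lemma segment_edge (z : vtx (insert a [::])) : on_strand z ->
  [/\ z = inl a, pos z = pos a & pos (nextv z) = pos (nextv a)].
Proof.
case: z => [x /= /eqP ->|[]//]; rewrite eqxx; split=> //.
by rewrite /insert_node; case: insubP.
Qed.

Lemma triangle_edge p (z : vtx (insert a [:: p])) : on_strand z ->
  [/\ rk z = 0%N, z = inl a, pos z = pos a & pos (nextv z) = p] \/
  [/\ rk z = 1%N, z = inr ord0, pos z = p & pos (nextv z) = pos (nextv a)].
Proof.
case: z => [x /= /eqP ->|i _]; [left|right].
  by rewrite eqxx; split=> //; rewrite /insert_node; case: insubP => [i _ E|] //=; rewrite E.
have -> : i = ord0 by apply/val_inj; case: i => [[]].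
by split=> //=; rewrite /insert_node; case: insubP.
Qed.

Lemma hull3 A p B Z : hull [:: A; p; B] Z -> exists w0 w1 w2 : R,
  [/\ [/\ 0 <= w0, 0 <= w1 & 0 <= w2], w0 + w1 + w2 = 1 & Z = w0 *: A + w1 *: p + w2 *: B].
Proof.
move=> [w [w0 w1 ZE]]; move: w1 ZE; rewrite !big_ord_recl !big_ord0 !addr0 !addrA /= => w1 ZE.
by exists (w ord0), (w (lift ord0 ord0)), (w (lift ord0 (lift ord0 ord0))).
Qed.

Lemma same_ray (k c v w zt tt : R) : k != 0 -> k * zt = w * c -> k * tt = v * c -> zt != 0 ->
  0 <= w -> 0 < v -> 0 < zt * tt.
Proof.
move=> k0 E1 E2 z0 w0 v0; have k2 : 0 < k * k by rewrite -expr2 exprn_even_gt0.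
have nz : w * c != 0 by rewrite -E1 mulf_neq0.
have : 0 < (w * v) * (c * c).
  move: nz; rewrite mulf_eq0 negb_or => /andP[w1 c1].
  have wp : 0 < w by rewrite lt_neqAle eq_sym w1.
  by apply: mulr_gt0; [exact: mulr_gt0|rewrite -expr2 exprn_even_gt0].
have -> : (w * v) * (c * c) = (k * k) * (zt * tt).
  by transitivity ((k * zt) * (k * tt)); [rewrite E1 E2|]; ring.
by rewrite pmulr_rgt0.
Qed.

(* The conclusion says that [zX] lies strictly between [t1] and [t2]. *)
Lemma triangle_between p x (z1 : vtx (insert a [::])) (z2 : vtx (insert a [:: p])) (s1 s2 t1 t2 zX
  : R) :
  generic (insert a [::]) -> generic (insert a [:: p]) -> x != a ->
  on_strand z1 -> on_strand z2 -> meet_at z1 s1 (inl x) t1 -> meet_at z2 s2 (inl x) t2 ->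
  hull [:: pos a; p; pos (nextv a)] (pt x zX) -> zX != t1 -> zX != t2 ->
  0 < (zX - t1) * (t2 - t1) /\ 0 < (zX - t2) * (t1 - t2).
Proof.
move=> g1 g2 xa o1 o2 m1 m2 hZ n1 n2.
have [/andP[s10 s11] _ d1] := meet_interior g1 m1.
have [/andP[s20 s21] _ d2] := meet_interior g2 m2.
have [_ _ _ E1] := m1; have [_ _ _ E2] := m2.
have [w0 [w1 [w2 [[p0 p1 p2] ws EZ]]]] := hull3 hZ.
have [_ A1 B1] := segment_edge o1.
rewrite (outer_dir [::] xa) in d1; rewrite (outer_dir [:: p] xa) in d2.
rewrite !outer_pt // in E1 E2.
have /pair_eqP[X1 Y1] : pt z1 s1 = pt x t1 by [].
have /pair_eqP[X2 Y2] : pt z2 s2 = pt x t2 by [].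
have /pair_eqP[XZ YZ] := EZ.
have T2 : (pos z2 = pos a /\ pos (nextv z2) = p) \/ (pos z2 = p /\ pos (nextv z2) = pos (nextv a)).
  by case: (triangle_edge o2) => -[_ _ -> ->]; [left|right].
move: d1 d2 X1 Y1 X2 Y2 XZ YZ; rewrite /det2 !ptE /dir A1 B1.
move: (pos z2) (pos (nextv z2)) T2 => P2 N2 T2 /=.
set Ax := (pos a).1; set Ay := (pos a).2; set Bx := (pos (nextv a)).1; set By := (pos (nextv a)).2.
set ux := (pos (nextv x)).1 - _; set uy := (pos (nextv x)).2 - _.
set vx := (pos x).1; set vy := (pos x).2.
move=> d1 d2 X1 Y1 X2 Y2 XZ YZ.
have z1n : zX - t1 != 0 by rewrite subr_eq0.
have z2n : zX - t2 != 0 by rewrite subr_eq0.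
have W : w0 = 1 - w1 - w2 by lra.
(* The determinant with the direction of the old edge is affine along [x] and vanishes at [t1]. At
   [zX] it is the barycentric weight [w1] of [p] times twice the signed area of the triangle; [K2]
   treats [t2] alike, and [same_ray] compares the signs. *)
have K1 : ((Bx - Ax) * uy - (By - Ay) * ux) * (zX - t1) = w1 * ((Bx - Ax) * (p.2 - Ay) - (By - Ay)
  * (p.1 - Ax)).
  have hx : ux * (zX - t1) = w0 * Ax + w1 * p.1 + w2 * Bx - (Ax + s1 * (Bx - Ax)) by rewrite X1
    -XZ; ring.
  have hy : uy * (zX - t1) = w0 * Ay + w1 * p.2 + w2 * By - (Ay + s1 * (By - Ay)) by rewrite Y1
    -YZ; ring.
  by rewrite mulrBl -!mulrA hx hy W; ring.
case: T2 => -[A2 B2]; rewrite A2 B2 in d2 X2 Y2.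
  have K2 : ((Bx - Ax) * uy - (By - Ay) * ux) * (t2 - t1) = s2 * ((Bx - Ax) * (p.2 - Ay) - (By -
    Ay) * (p.1 - Ax)).
    have hx : ux * (t2 - t1) = (Ax + s2 * (p.1 - Ax)) - (Ax + s1 * (Bx - Ax)) by rewrite X1 X2;
      ring.
    have hy : uy * (t2 - t1) = (Ay + s2 * (p.2 - Ay)) - (Ay + s1 * (By - Ay)) by rewrite Y1 Y2;
      ring.
    by rewrite mulrBl -!mulrA hx hy; ring.
  split; first exact: same_ray d1 K1 K2 z1n p1 s20.
  (* The same argument for the side of the triangle that the new strand crosses, with the weight of
     the opposite corner. *)
  apply: (same_ray (c := (p.1 - Ax) * (By - Ay) - (p.2 - Ay) * (Bx - Ax)) d2 _ _ z2n p2 s10).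
    have hx : ux * (zX - t2) = w0 * Ax + w1 * p.1 + w2 * Bx - (Ax + s2 * (p.1 - Ax)) by rewrite X2
      -XZ; ring.
    have hy : uy * (zX - t2) = w0 * Ay + w1 * p.2 + w2 * By - (Ay + s2 * (p.2 - Ay)) by rewrite Y2
      -YZ; ring.
    by rewrite mulrBl -!mulrA hx hy W; ring.
  have hx : ux * (t1 - t2) = (Ax + s1 * (Bx - Ax)) - (Ax + s2 * (p.1 - Ax)) by rewrite X1 X2; ring.
  have hy : uy * (t1 - t2) = (Ay + s1 * (By - Ay)) - (Ay + s2 * (p.2 - Ay)) by rewrite Y1 Y2; ring.
  by rewrite mulrBl -!mulrA hx hy; ring.
have q1 : 0 < 1 - s1 by lra. have q2 : 0 < 1 - s2 by lra.
have K2 : ((Bx - Ax) * uy - (By - Ay) * ux) * (t2 - t1) = (1 - s2) * ((Bx - Ax) * (p.2 - Ay) - (By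
  - Ay) * (p.1 - Ax)).
  have hx : ux * (t2 - t1) = (p.1 + s2 * (Bx - p.1)) - (Ax + s1 * (Bx - Ax)) by rewrite X1 X2; ring.
  have hy : uy * (t2 - t1) = (p.2 + s2 * (By - p.2)) - (Ay + s1 * (By - Ay)) by rewrite Y1 Y2; ring.
  by rewrite mulrBl -!mulrA hx hy; ring.
split; first exact: same_ray d1 K1 K2 z1n p1 q2.
apply: (same_ray (c := (Bx - p.1) * (Ay - p.2) - (By - p.2) * (Ax - p.1)) d2 _ _ z2n p0 q1).
  have hx : ux * (zX - t2) = w0 * Ax + w1 * p.1 + w2 * Bx - (p.1 + s2 * (Bx - p.1)) by rewrite X2
    -XZ; ring.
  have hy : uy * (zX - t2) = w0 * Ay + w1 * p.2 + w2 * By - (p.2 + s2 * (By - p.2)) by rewrite Y2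
    -YZ; ring.
  by rewrite mulrBl -!mulrA hx hy W; ring.
have hx : ux * (t1 - t2) = (Ax + s1 * (Bx - Ax)) - (p.1 + s2 * (Bx - p.1)) by rewrite X1 X2; ring.
have hy : uy * (t1 - t2) = (Ay + s1 * (By - Ay)) - (p.2 + s2 * (By - p.2)) by rewrite Y1 Y2; ring.
by rewrite mulrBl -!mulrA hx hy; ring.
Qed.

(** An affine function from [u] to [v] that vanishes at [s] has the sign of [u] exactly before
    [s]. *)
Lemma order_on_edge (u v s r : R) : u * v < 0 -> 0 < s < 1 -> (1 - s) * u + s * v = 0 ->
  (r < s) = (0 < u * ((1 - r) * u + r * v)).
Proof.
move=> uv /andP[s0 s1] E; rewrite -(pmulr_rgt0 _ s0).
have u0 : 0 < u * u by rewrite -expr2 exprn_even_gt0 //; apply/eqP => u0; move: uv;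
  rewrite u0 mul0r ltxx.
have -> : s * (u * ((1 - r) * u + r * v)) = u * u * (s - r).
  have sv : s * v = - ((1 - s) * u) by lra.
  by transitivity (u * (s * (1 - r) * u + r * (s * v))); [ring|rewrite sv; ring].
by rewrite pmulr_rgt0 // subr_gt0.
Qed.

Lemma xor_of_products (u v u' v' : R) : u * v = u' * v' -> u * v != 0 ->
  (0 < u) (+) (0 < v) = (0 < u') (+) (0 < v').
Proof.
move=> E n0; have n1 := n0; rewrite E in n1.
move: n0 n1; rewrite !mulf_eq0 !negb_or => /andP[u0 v0] /andP[u0' v0'].
have h (k m : R) : k != 0 -> m != 0 -> (0 < k) (+) (0 < m) = (k * m < 0).
  by case: (ltrgt0P k) => // k0 _; case: (ltrgt0P m) => // m0 _;
    rewrite ?(pmulr_rlt0 _ k0) ?(nmulr_rlt0 _ k0) ?m0 //= ?(lt_gtF m0).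
by rewrite !h // E.
Qed.

End TriangleGeometry.

Section ShortStrands.
Variables (R : realType) (P : polygon R) (a : vtx P).
Local Notation strand l := (vtx (insert a l)).

Lemma short_strand_simple (l : seq (R * R)) (z w : strand l) (s t : R) : (size l <= 1)%N ->
  generic (insert a l) -> on_strand z -> on_strand w -> ~ meet_at z s w t.
Proof.
move=> l1 gJ zs ws mt; have := rk_le z; have := rk_le w.
by have := strand_self_meet gJ zs ws mt; lia.
Qed.

Lemma segment_crossing_unique x (z w : strand [::]) (s s' t t' : R) : generic (insert a [::]) ->
  on_strand z -> on_strand w -> meet_at z s (inl x) t -> meet_at w s' (inl x) t' -> z = w /\ s = s'.
Proof.
move=> gJ /segment_edge[-> _ _] /segment_edge[-> _ _] m m'.
by have [-> _] := meet_param gJ m m'.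
Qed.

Lemma segment_sides x (z : strand [::]) (s t : R) : generic (insert a [::]) -> x != a ->
  on_strand z ->
  meet_at z s (inl x) t -> side x (pos a) * side x (pos (nextv a)) < 0.
Proof.
move=> gJ xa zs mt; have [zE A B] := segment_edge zs.
by have [] := opposite_sides gJ xa mt; rewrite A B.
Qed.

Lemma segment_sign x (z : strand [::]) (s t : R) : generic (insert a [::]) -> x != a ->
  on_strand z ->
  meet_at z s (inl x) t ->
  (0 < det2 (dir z) (dir (inl x : strand [::]))) = (0 < side x (pos a)).
Proof.
move=> gJ xa zs mt; have [zE A B] := segment_edge zs.
by have [_ ->] := opposite_sides gJ xa mt; rewrite A.
Qed.

Lemma segment_order x (z w : strand [::]) (s t r : R) : generic (insert a [::]) -> x != a ->
  on_strand z -> on_strand w -> meet_at z s (inl x) t ->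
  (spos w r < spos z s) = (0 < side x (pos a) * side x (pt w r)).
Proof.
move=> gJ xa zs ws mt; have [zE A B] := segment_edge zs; have [wE A' B'] := segment_edge ws.
have [s01 _ _] := meet_interior gJ mt.
have [_ _ _ E] := mt; rewrite outer_pt // in E.
have E0 := side_edge x z s; rewrite E side_pt A B in E0.
rewrite side_edge A' B' -(order_on_edge r (segment_sides gJ xa zs mt) s01 (esym E0)).
by rewrite /spos zE wE /= ltrD2l.
Qed.

Section Triangle.
Variables (p : R * R) (x : vtx P).
Hypotheses (gJ : generic (insert a [:: p])) (xa : x != a).
Hypothesis AB : side x (pos a) * side x (pos (nextv a)) < 0.

Let same_sign (k m n : R) : k * m < 0 -> n * m < 0 -> (0 < k) = (0 < n).
Proof.
case: (ltrgt0P m) => [m0|m0|->]; last by rewrite mulr0 ltxx.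
  by rewrite !(pmulr_llt0 _ m0) => k0 n0; rewrite (lt_gtF k0) (lt_gtF n0).
by rewrite !(nmulr_llt0 _ m0) => -> ->.
Qed.

(** The line of [x] separates [pos a] from [pos (nextv a)], so it cannot separate [p] from both and
    crosses only one of the two new edges. *)
Lemma triangle_crossing_unique (z w : strand [:: p]) (s s' t t' : R) :
  on_strand z -> on_strand w -> meet_at z s (inl x) t -> meet_at w s' (inl x) t' -> z = w /\ s = s'.
Proof.
move=> zs ws m m'; have [pz _] := opposite_sides gJ xa m; have [pw _] := opposite_sides gJ xa m'.
suff E : z = w by subst w; have [-> _] := meet_param gJ m m'.
have no (k m0 n : R) : k * n < 0 -> k * m0 < 0 -> m0 * n < 0 -> False.
  move=> h1 h2 h3; have := nmulr_rgt0 (k * n) h1; move: (h2) => /nmulr_rgt0.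
  have h4 : 0 < (k * m0) * (m0 * n) by rewrite nmulr_rgt0.
  have : (k * m0) * (m0 * n) = (k * n) * (m0 * m0) by ring.
  have := sqr_ge0 m0; rewrite expr2 => h5 h6.
  have : (k * n) * (m0 * m0) <= 0 by rewrite mulr_le0_ge0 // ltW.
  by rewrite -h6 leNgt h4.
case: (triangle_edge zs) => -[_ zE A B]; case: (triangle_edge ws) => -[_ wE A' B'];
  rewrite zE wE //;
  rewrite A B in pz; rewrite A' B' in pw; exfalso.
- exact: no AB pz pw.
- exact: no AB pw pz.
Qed.

Lemma triangle_sign (z : strand [:: p]) (s t : R) : on_strand z -> meet_at z s (inl x) t ->
  (0 < det2 (dir z) (dir (inl x : strand [:: p]))) = (0 < side x (pos a)).
Proof.
move=> zs mt; have [pz ->] := opposite_sides gJ xa mt.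
case: (triangle_edge zs) => -[_ _ A B]; rewrite A B in pz *; first by [].
exact: same_sign pz AB.
Qed.

(** A broken strand that crosses the line of [x] once is on the side of [pos a] exactly before that
    crossing, so positions along the strand can be read from [side x]. *)
Lemma triangle_order (z w : strand [:: p]) (s t r : R) : 0 < r < 1 ->
  on_strand z -> on_strand w -> meet_at z s (inl x) t ->
  (spos w r < spos z s) = (0 < side x (pos a) * side x (pt w r)).
Proof.
move=> /andP[r0 r1] zs ws mt.
have [/andP[s0 s1] _ _] := meet_interior gJ mt.
have [_ _ _ E] := mt; rewrite outer_pt // in E.
have E0 := side_edge x z s; rewrite E side_pt in E0.
have [pz _] := opposite_sides gJ xa mt.
have sq (k m : R) : k * m < 0 -> 0 < k * k.
  by move=> km; rewrite -expr2 exprn_even_gt0 //; apply/eqP => k0; move: km; rewrite k0 mul0r ltxx.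
have lc (k m : R) : 0 < k -> 0 < m -> 0 < (1 - r) * k + r * m.
  by move=> k0 m0; rewrite addr_gt0 // mulr_gt0 // subr_gt0.
rewrite side_edge.
case: (triangle_edge zs) => -[zr zE A B]; case: (triangle_edge ws) => -[wr wE A' B'];
  rewrite A B in pz E0; rewrite A' B'.
- rewrite -(order_on_edge r pz _ (esym E0)) ?s0 // /spos zr wr ltrD2l //.
- have -> : (spos w r < spos z s) = false by rewrite /spos zr wr; apply/lt_gtF; lra.
  apply/esym/lt_gtF; rewrite -oppr_gt0.
  rewrite (_ : - _ = (1 - r) * - (side x (pos a) * side x p) + r * - (side x (pos a) * side x (pos
    (nextv a)))).
    by apply: lc; rewrite oppr_gt0.
  by ring.
- have -> : (spos w r < spos z s) by rewrite /spos zr wr; lra.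
  have ap : 0 < side x (pos a) * side x p.
    case: (ltrgt0P (side x (pos (nextv a)))) AB pz => [b0|b0|->]; last by rewrite mulr0 ltxx.
      by rewrite !(pmulr_llt0 _ b0) => a0 p0; rewrite nmulr_rgt0.
    by rewrite !(nmulr_llt0 _ b0) => a0 p0; rewrite pmulr_rgt0.
  rewrite (_ : side x (pos a) * _ = (1 - r) * (side x (pos a) * side x (pos a)) + r * (side x (pos
    a) * side x p)); last by ring.
  by rewrite lc // (sq _ _ AB).
have ap : (0 < side x p) = (0 < side x (pos a)) by exact: same_sign pz AB.
transitivity (0 < side x p * ((1 - r) * side x p + r * side x (pos (nextv a)))).
  by rewrite -(order_on_edge r pz _ (esym E0)) ?s0 // /spos zr wr ltrD2l.
case: (ltrgt0P (side x p)) ap pz => [p0|p0|->]; last by rewrite mul0r ltxx.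
  by move=> /esym a0 _; rewrite !pmulr_rgt0.
move=> _; rewrite nmulr_rlt0 // => b0.
have a0 : side x (pos a) < 0 by move: AB; rewrite pmulr_llt0.
by rewrite !nmulr_rgt0.
Qed.

End Triangle.

Lemma side_line (x y : vtx P) (zX zY t : R) : meet_at x zX y zY ->
  side x (pt y t) = det2 (dir x) (dir y) * (t - zY).
Proof.
move=> [_ _ _ E]; have : side x (pt y zY) = 0 by rewrite -E side_pt.
by rewrite /side !ptE /det2 /= => h; rewrite -[LHS]subr0 -h; ring.
Qed.

Lemma between_flip (z t1 t2 : R) : 0 < (z - t1) * (t2 - t1) -> 0 < (z - t2) * (t1 - t2) ->
  [/\ (t2 < z) = ~~ (t1 < z), Num.min t1 t2 <= z <= Num.max t1 t2 & t1 != t2].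
Proof.
have [t12|t12|->] := ltrgtP t1 t2; last by rewrite subrr mulr0 ltxx.
  rewrite pmulr_lgt0 ?subr_gt0 // nmulr_lgt0 ?subr_lt0 // => h1 h2.
  by rewrite h1 (lt_gtF h2) !ltW.
rewrite nmulr_lgt0 ?subr_lt0 // pmulr_lgt0 ?subr_gt0 // => h1 h2.
by rewrite h2 (lt_gtF h1) !ltW.
Qed.

Lemma line_hull (L : seq (R * R)) (x : vtx P) (t1 t2 r : R) : hull L (pt x t1) ->
  hull L (pt x t2) -> t1 != t2 ->
  Num.min t1 t2 <= r <= Num.max t1 t2 -> hull L (pt x r).
Proof.
move=> h1 h2 t12 rw.
have -> : pt x r = pt x t1 + ((r - t1) / (t2 - t1)) *: (pt x t2 - pt x t1).
  have t21n : t2 - t1 != 0 by rewrite subr_eq0 eq_sym.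
  by apply/pair_eqP; rewrite !ptE /=; split; rewrite -[_ *: _]/(_ * _); field.
apply: hull_conv => //; move: rw; have [lt|lt|E] := ltrgtP t1 t2; last by rewrite E eqxx in t12.
  by move=> rw; rewrite divr_ge0 ?ler_pdivrMr ?subr_gt0 //; lra.
by move=> rw; rewrite -mulrNN -invrN divr_ge0 ?ler_pdivrMr ?oppr_gt0 ?subr_lt0 //; lra.
Qed.

Lemma triangle_window (L : seq (R * R)) xs (x y : vtx P) (zX zY t1 t2 : R) : generic (insert a
  [::]) -> x != a -> y != a ->
  only_meets a (hull L) xs -> (forall f, f \in xs -> f = x \/ f = y) -> meet_at x zX y zY ->
  hull L (pt x t1) -> hull L (pt x t2) -> 0 < t1 < 1 -> 0 < t2 < 1 -> t1 != t2 ->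
  Num.min t1 t2 <= zX <= Num.max t1 t2 -> window a x y (Num.min t1 t2) (Num.max t1 t2) zX.
Proof.
move=> gJ xa ya om xsP mXY h1 h2 /andP[t10 t11] /andP[t20 t21] t12 zw.
split=> //; first by rewrite lt_min t10.
  by rewrite gt_max t11.
move=> r f t rw fa mf.
have hr := line_hull h1 h2 t12 rw.
have [m0 [_ t01 E]] : meet_at x r f t /\ [/\ 0 <= r < 1, 0 <= t < 1 & pt x r = pt f t] by case: mf.
have := om f t fa t01; rewrite -E => /(_ hr)[/xsP[fx|fy]|[fn t0]].
- by case: mf; rewrite fx eqxx.
- subst f; by have [] := meet_param gJ (iffRL (outer_meet _ _ _ xa ya) mf) (iffRL (outer_meet _ _ _
    xa ya) mXY).
- have [_ + _] := meet_interior gJ (iffRL (outer_meet _ _ _ xa fa) mf); lra.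
Qed.

End ShortStrands.

Section ThirdMoveCard.
Variables (R : realType) (T : Type) (Q : operator_quandle T) (P : polygon R) (a : vtx P).

Lemma short_two_crossing_strand (l L : seq (R * R)) (lb : labelling T a l) (x y : vtx P)
    (zx zy : vtx (insert a l)) (sx tx sy ty : R) :
  is_diagram lb -> (size l <= 1)%N -> only_meets a (hull L) [:: x; y] ->
  {subset pos a :: rcons l (pos (nextv a)) <= L} -> x != a -> y != a ->
  on_strand zx -> on_strand zy -> meet_at zx sx (inl x) tx -> meet_at zy sy (inl y) ty ->
  (forall w, w \in [:: x; y] -> forall (z z' : vtx (insert a l)) s s' t t', on_strand z ->
    on_strand z' ->
     meet_at z s (inl w) t -> meet_at z' s' (inl w) t' -> z = z' /\ s = s') ->
  (forall w, w \in [:: x; y] -> forall (z : vtx (insert a l)) s t, on_strand z ->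
    meet_at z s (inl w) t ->
     (0 < det2 (dir z) (dir (inl w : vtx (insert a l)))) = (0 < side w (pos a))) ->
  two_crossing_strand lb x y zx zy sx tx sy ty (lb zx (inl x)) (lb zy (inl y))
    (0 < side x (pos a)) (0 < side y (pos a)).
Proof.
move=> ok l1 om lL xa ya zxs zys mx my uniq sgn.
have xx : x \in [:: x; y] by rewrite mem_head.
have yy : y \in [:: x; y] by rewrite !inE eqxx orbT.
split=> //.
- move=> z s f t zs mt; have [fs|[w wa E]] := strandVouter f.
    by case: (short_strand_simple l1 ok.1 zs fs mt).
  subst f; have := only_meets_strand ok.1 om lL zs wa mt.
  by rewrite !inE => /orP[] /eqP ->; [left|right].
- move=> z s t zs mt; exact: uniq xx _ _ _ _ _ _ zs zxs mt mx.
- move=> z s t zs mt; exact: uniq yy _ _ _ _ _ _ zs zys mt my.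
- exact: sgn xx _ _ _ zxs mx.
- exact: sgn yy _ _ _ zys my.
Qed.

Variables (p : R * R) (lab1 : labelling T a [::]) (lab2 : labelling T a [:: p]).
Hypotheses (ok1 : is_diagram lab1) (ok2 : is_diagram lab2) (so : same_outside lab1 lab2).
Local Notation triangle := [:: pos a; p; pos (nextv a)].

Let L1 : {subset pos a :: rcons [::] (pos (nextv a)) <= triangle}.
Proof. by move=> q; rewrite !inE => /orP[] ->; rewrite ?orbT. Qed.

Let L2 : {subset pos a :: rcons [:: p] (pos (nextv a)) <= triangle}.
Proof. by []. Qed.

(** On either strand the crossing with [y] comes before or after that with [x] according to the side
    of [x] on which it lies. The two crossings on [y] are on different sides of [zY], hence of
    [x]. *)
Lemma order_flips (x y : vtx P) (z1x z1y : vtx (insert a [::])) (z2x z2y : vtx (insert a [:: p]))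
    (s1x t1x s1y t1y s2x t2x s2y t2y zX zY : R) :
  x != a -> y != a -> meet_at x zX y zY ->
  on_strand z1x -> on_strand z1y -> on_strand z2x -> on_strand z2y ->
  meet_at z1x s1x (inl x) t1x -> meet_at z1y s1y (inl y) t1y ->
  meet_at z2x s2x (inl x) t2x -> meet_at z2y s2y (inl y) t2y ->
  t1y != zY -> t2y != zY -> (t2y < zY) = ~~ (t1y < zY) ->
  (spos z2x s2x < spos z2y s2y) = ~~ (spos z1x s1x < spos z1y s1y).
Proof.
move=> xa ya mXY o1x o1y o2x o2y m1x m1y m2x m2y n1 n2 flip.
have AB := segment_sides ok1.1 xa o1x m1x.
have [s2y01 _ _] := meet_interior ok2.1 m2y.
have E1 := segment_order s1y ok1.1 xa o1x o1y m1x.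
have E2 := triangle_order ok2.1 xa AB s2y01 o2x o2y m2x.
have [_ _ _ P1] := m1y; have [_ _ _ P2] := m2y; rewrite !outer_pt // in P1 P2.
rewrite P1 (side_line _ mXY) mulrA in E1; rewrite P2 (side_line _ mXY) mulrA in E2.
have k0 : side x (pos a) * det2 (dir x) (dir y) != 0.
  have [_ _] := meet_interior ok1.1 (iffRL (outer_meet _ _ _ xa ya) mXY);
    rewrite !outer_dir // => d0.
  by rewrite mulf_neq0 //; apply/eqP => A0; rewrite A0 mul0r ltxx in AB.
have np1 : spos z1x s1x != spos z1y s1y.
  apply/eqP => E; have [_ h1 _ _] := m1x; have [_ h2 _ _] := m1y.
  have [zE sE] := spos_inj o1x o1y h1 h2 E; subst z1y s1y.
  have [[yx] _] := meet_edge ok1.1 m1x m1y.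
  by case: mXY; rewrite yx eqxx.
have np2 : spos z2x s2x != spos z2y s2y.
  apply/eqP => E; have [_ h1 _ _] := m2x; have [_ h2 _ _] := m2y.
  have [zE sE] := spos_inj o2x o2y h1 h2 E; subst z2y s2y.
  have [[yx] _] := meet_edge ok2.1 m2x m2y.
  by case: mXY; rewrite yx eqxx.
have neg (k m : R) : k != m -> (k < m) = ~~ (m < k) by case: ltgtP.
rewrite neg // [in RHS]neg // E1 E2; congr (~~ _).
case: (ltrgt0P (side x (pos a) * det2 (dir x) (dir y))) k0 => // k0 _.
  by rewrite !(pmulr_rgt0 _ k0) !subr_gt0; move: flip n1 n2; case: (ltgtP t1y zY);
    case: (ltgtP t2y zY).
by rewrite !(nmulr_rgt0 _ k0) !subr_lt0.
Qed.

(** The three crossing points span a triangle with sides along the three edges, and its side vectors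
    add up to zero: [h1] and [h2] are the coordinates of this. Determinants with one direction at a
    time give the products [p1] and [p2], whose signs are the parities. *)
Lemma three_edges_parity (x y : vtx P) (z1x z1y : vtx (insert a [::])) (s1x t1x s1y t1y zX zY : R) :
  x != a -> y != a -> meet_at x zX y zY ->
  on_strand z1x -> on_strand z1y ->
  meet_at z1x s1x (inl x) t1x -> meet_at z1y s1y (inl y) t1y -> t1x != zX -> t1y != zY ->
  (0 < side x (pos a)) (+) (t1x < zX) = (0 < side y (pos a)) (+) (t1y < zY) /\
  (0 < side x (pos a)) (+) (spos z1x s1x < spos z1y s1y) = (0 < det2 (dir x) (dir y)) (+) (t1y <
    zY).
Proof.
move=> xa ya mXY ox oy mx my nx ny.
rewrite -(segment_sign ok1.1 xa ox mx) -(segment_sign ok1.1 ya oy my).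
have zE : z1y = z1x by have [-> _ _] := segment_edge ox; have [-> _ _] := segment_edge oy.
subst z1y.
have [_ _ dx] := meet_interior ok1.1 mx; have [_ _ dy] := meet_interior ok1.1 my.
have [_ _ dxy] := meet_interior ok1.1 (iffRL (outer_meet _ _ _ xa ya) mXY).
rewrite !outer_dir // in dx dy dxy *.
rewrite /spos ltrD2l -(subr_gt0 t1x) -(subr_gt0 t1y) -(subr_gt0 s1x).
have [_ _ _ Ex] := mx; have [_ _ _ Ey] := my; have [_ _ _ Exy] := mXY.
rewrite !outer_pt // in Ex Ey.
rewrite -subr_eq0 in nx; rewrite -subr_eq0 in ny.
move: Ex Ey Exy; rewrite !ptE.
move: (dir z1x) (dir x) (dir y) dx dy dxy => d e f dx dy dxy [X1 X2] [Y1 Y2] [Z1 Z2].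
have h1 : (zX - t1x) * e.1 = (s1y - s1x) * d.1 + (zY - t1y) * f.1 by rewrite !mulrBl; lra.
have h2 : (zX - t1x) * e.2 = (s1y - s1x) * d.2 + (zY - t1y) * f.2 by rewrite !mulrBl; lra.
have p1 : det2 d e * (zX - t1x) = det2 d f * (zY - t1y).
  rewrite /det2 [LHS](_ : _ = d.1 * ((zX - t1x) * e.2) - d.2 * ((zX - t1x) * e.1)); last by ring.
  by rewrite h1 h2; ring.
have p2 : det2 d e * (s1y - s1x) = det2 e f * (zY - t1y).
  have e1 : (s1y - s1x) * d.1 = (zX - t1x) * e.1 - (zY - t1y) * f.1 by rewrite h1; ring.
  have e2 : (s1y - s1x) * d.2 = (zX - t1x) * e.2 - (zY - t1y) * f.2 by rewrite h2; ring.
  rewrite /det2 [LHS](_ : _ = ((s1y - s1x) * d.1) * e.2 - ((s1y - s1x) * d.2) * e.1); last by ring.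
  by rewrite e1 e2; ring.
have q0 : zX - t1x != 0 by rewrite -opprB oppr_eq0.
have q1 : zY - t1y != 0 by rewrite -opprB oppr_eq0.
split; apply: xor_of_products => //; first by rewrite mulf_neq0.
by rewrite p2 mulf_neq0.
Qed.

Lemma crossing_off_vertex (l : seq (R * R)) (x y : vtx P) (z : vtx (insert a l)) (s t zX zY : R) :
  generic (insert a l) -> x != a -> y != a -> meet_at x zX y zY -> on_strand z ->
    meet_at z s (inl x) t -> t != zX.
Proof.
move=> gJ xa ya mXY zs mt; apply/eqP => E; subst t.
have [zE _] := meet_edge gJ (meet_sym mt) (iffRL (outer_meet _ _ _ xa ya) mXY).
by move: zs; rewrite zE /= (negbTE ya).
Qed.

Lemma reidemeister3_card : reidemeister3 lab1 lab2 ->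
  (Col (Diagram ok1) Q #= Col (Diagram ok2) Q)%card.
Proof.
move=> [x [y [[xa ya om] [zX [zY [mXY hZ]]] cr [cX cXY cY] ac]]].
have xx : x \in [:: x; y] by rewrite mem_head.
have yy : y \in [:: x; y] by rewrite !inE eqxx orbT.
have [[s1x [t1x m1x]] [z2x o2x [s2x [t2x m2x]]] spx] := cr _ xx.
have [[s1y [t1y m1y]] [z2y o2y [s2y [t2y m2y]]] spy] := cr _ yy.
have o1 : on_strand (inl a : vtx (insert a [::])) by rewrite /=.
have ABx := segment_sides ok1.1 xa o1 m1x; have ABy := segment_sides ok1.1 ya o1 m1y.
have tc1 : two_crossing_strand lab1 x y (inl a) (inl a) s1x t1x s1y t1y (lab1 (inl a) (inl x))
    (lab1 (inl a) (inl y)) (0 < side x (pos a)) (0 < side y (pos a)).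
  apply: (short_two_crossing_strand ok1 _ om L1 xa ya o1 o1 m1x m1y) => // w wxy z.
    by move=> z' s s' t t'; exact: segment_crossing_unique ok1.1.
  have wa : w != a by move: wxy; rewrite !inE => /orP[] /eqP ->.
  by move=> s t; exact: segment_sign ok1.1 wa.
have tc2 : two_crossing_strand lab2 x y z2x z2y s2x t2x s2y t2y (lab2 z2x (inl x))
    (lab2 z2y (inl y)) (0 < side x (pos a)) (0 < side y (pos a)).
  apply: (short_two_crossing_strand ok2 _ om L2 xa ya o2x o2y m2x m2y) => // w wxy z.
    move=> z' s s' t t'; move: wxy; rewrite !inE => /orP[] /eqP ->.
      exact: (triangle_crossing_unique ok2.1 xa ABx).
    exact: (triangle_crossing_unique ok2.1 ya ABy).
  move=> s t; move: wxy; rewrite !inE => /orP[] /eqP ->.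
    exact: (triangle_sign ok2.1 xa ABx).
  exact: (triangle_sign ok2.1 ya ABy).
have lx : lab1 (inl a) (inl x) = lab2 z2x (inl x).
  by apply: spx => //; [exists s1x, t1x|exists s2x, t2x].
have ly : lab1 (inl a) (inl y) = lab2 z2y (inl y).
  by apply: spy => //; [exists s1y, t1y|exists s2y, t2y].
rewrite -lx -ly in tc2.
have hZ' := hZ; have [_ _ _ EZ] := mXY; rewrite EZ in hZ'.
have mYX := meet_sym mXY.
have n1x := crossing_off_vertex ok1.1 xa ya mXY o1 m1x; have n2x :=
  crossing_off_vertex ok2.1 xa ya mXY o2x m2x.
have n1y := crossing_off_vertex ok1.1 ya xa mYX o1 m1y; have n2y :=
  crossing_off_vertex ok2.1 ya xa mYX o2y m2y.
have [b1 b2] : 0 < (zX - t1x) * (t2x - t1x) /\ 0 < (zX - t2x) * (t1x - t2x).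
  by apply: triangle_between ok1.1 ok2.1 xa o1 o2x m1x m2x hZ _ _; rewrite eq_sym.
have [c1 c2] : 0 < (zY - t1y) * (t2y - t1y) /\ 0 < (zY - t2y) * (t1y - t2y).
  by apply: triangle_between ok1.1 ok2.1 ya o1 o2y m1y m2y hZ' _ _; rewrite eq_sym.
have [fX wXz tX] := between_flip b1 b2; have [fY wYz tY] := between_flip c1 c2.
have hull1 w z s t : w != a -> on_strand z -> @meet_at _ (insert a [::]) z s (inl w) t ->
  hull triangle (pt w t) /\ 0 < t < 1.
  move=> wa zs mt; have [s01 t01 _] := meet_interior ok1.1 mt; split=> //.
  by have [_ _ _] := mt; rewrite outer_pt // => <-; apply: strand_hull => //; lra.
have hull2 w z s t : w != a -> on_strand z -> @meet_at _ (insert a [:: p]) z s (inl w) t ->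
  hull triangle (pt w t) /\ 0 < t < 1.
  move=> wa zs mt; have [s01 t01 _] := meet_interior ok2.1 mt; split=> //.
  by have [_ _ _] := mt; rewrite outer_pt // => <-; apply: strand_hull => //; lra.
have [h1x i1x] := hull1 _ _ _ _ xa o1 m1x; have [h2x i2x] := hull2 _ _ _ _ xa o2x m2x.
have [h1y i1y] := hull1 _ _ _ _ ya o1 m1y; have [h2y i2y] := hull2 _ _ _ _ ya o2y m2y.
have wX : window a x y (Num.min t1x t2x) (Num.max t1x t2x) zX.
  apply: triangle_window ok1.1 xa ya om _ mXY h1x h2x i1x i2x tX wXz => f.
  by rewrite !inE => /orP[] /eqP; [left|right].
have wY : window a y x (Num.min t1y t2y) (Num.max t1y t2y) zY.
  apply: triangle_window ok1.1 ya xa om _ mYX h1y h2y i1y i2y tY wYz => f.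
  by rewrite !inE => /orP[] /eqP; [right|left].
have fe := order_flips xa ya mXY o1 o1 o2x o2y m1x m1y m2x m2y n1y n2y fY.
have [par1 par2] := three_edges_parity xa ya mXY o1 o1 m1x m1y n1x n1y.
have lXY : lab2 (inl x) (inl y) = lab1 (inl x) (inl y) by rewrite so //; exists zX, zY.
have mirrorY : lab1 (inl y) (inl a) = mirror (lab1 (inl a) (inl y)) by apply: ok1.2; exists s1y,
  t1y.
have cY' : classical (lab1 (inl a) (inl y)) by move: cY; rewrite mirrorY; case: lab1.
rewrite mirrorY in ac.
have so' : same_outside lab2 lab1 by move=> u v ua va uv; rewrite so.
have inx1 : Num.min t1x t2x <= t1x <= Num.max t1x t2x by rewrite ge_min le_max lexx.
have inx2 : Num.min t1x t2x <= t2x <= Num.max t1x t2x by rewrite ge_min le_max lexx !orbT.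
have iny1 : Num.min t1y t2y <= t1y <= Num.max t1y t2y by rewrite ge_min le_max lexx.
have iny2 : Num.min t1y t2y <= t2y <= Num.max t1y t2y by rewrite ge_min le_max lexx !orbT.
have inv (b c : bool) : b = ~~ c -> c = ~~ b by move=> ->; rewrite negbK.
pose M := @third_move_related R T Q P x y (Num.min t1x t2x) (Num.max t1x t2x) (Num.min t1y t2y)
  (Num.max t1y t2y).
apply: (@strand_card_eq _ _ _ _ _ _ _ _ _ ok1 ok2 M) => [u F sc|u F sc|].
- have := third_move_transfer wX wY mXY ok1 ok2 so tc1 tc2 inx1 inx2 iny1 iny2 lXY fe fX fY par1
    par2 cX cY' cXY ac sc.
  by move=> [u' [F' [sc' h]]]; exists u', F'.
- have [||u' [F' [sc' [h1 h2]]]] :=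
    third_move_transfer wX wY mXY ok2 ok1 so' tc2 tc1 inx2 inx1 iny2 iny1
     erefl (inv _ _ fe) (inv _ _ fX) (inv _ _ fY) _ _ cX cY' cXY ac sc.
  (* The move reverses all three orders, so the parity conditions also hold for the new strand. *)
  + by rewrite fX fY !addbN par1.
  + by rewrite fe fY !addbN par2.
  by exists u', F'; split=> //; split=> // v s sX sY; rewrite h1.
move=> u F u' F' v G v' G' s1 s2 t1 t2 [m m0] [n n0].
split=> -[E1 E2].
  apply: (third_move_determined wX wY mXY ok2 so' tc2 inx2 iny2 erefl cX cY' cXY ac s2 t2).
    by move=> w s wa s01 sX sY; rewrite -m // -n // E1.
  by rewrite -m0 -n0 E2 // lexx ler0n.
apply: (third_move_determined wX wY mXY ok1 so tc1 inx1 iny1 lXY cX cY' cXY ac s1 t1).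
  by move=> w s wa s01 sX sY; rewrite m // n // E1.
by rewrite m0 n0 E2 // lexx ler0n.
Qed.

End ThirdMoveCard.

(** * The second Reidemeister move *)

Section SecondMove.
Variables (R : realType) (T : Type) (Q : operator_quandle T) (P : polygon R) (a : vtx P).

Section Rebuild.
Variables (x : vtx P) (lo hi : R).
Hypotheses (xa : x != a) (lo0 : 0 < lo) (hi1 : hi < 1).
Hypothesis clear : forall r f t, lo <= r <= hi -> f != a -> ~ meet_at x r f t.
Variables (l1 l2 : seq (R * R)) (lab1 : labelling T a l1) (lab2 : labelling T a l2).
Hypothesis so : same_outside lab1 lab2.
Hypothesis c1 : forall (z : vtx (insert a l1)) s f t, on_strand z -> meet_at z s f t ->
  f = inl x /\ lo <= t <= hi.
Hypothesis c2 : forall (z : vtx (insert a l2)) s f t, on_strand z -> meet_at z s f t ->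
  f = inl x /\ lo <= t <= hi.

(** Only the strand and one window of [x], met by nothing but the strand, are recoloured; all other
    crossings keep their rule. It serves for creating and for removing the two crossings. *)
Lemma window_rebuild u (F : R -> Q) (f F' : R -> Q) : strand_coloring lab1 u F ->
  let ux := splice lo hi f (u x) in
  (forall s, \forall r \near s^'-, f r = f s) ->
  (forall s, lo <= s <= hi -> (forall z t, on_strand z ->
    ~ @meet_at _ (insert a l2) (inl x) s z t) ->
     \forall r \near s^'+, ux r = ux s) ->
  (forall s z t, on_strand z -> @meet_at _ (insert a l2) (inl x) s z t ->
     \forall r \near s^'+, ux r =
       act (lab2 (inl x) z) (0 < det2 (dir (inl x : vtx (insert a l2))) (dir z)) (ux s) (F' (spos z
         t))) ->
  (forall c, \forall r \near c^'-, F' r = F' c) ->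
  (forall (z : vtx (insert a l2)) s, on_strand z -> 0 <= s < 1 -> (forall g t, ~ meet_at z s g t) ->
     \forall r \near (spos z s)^'+, F' r = F' (spos z s)) ->
  (forall (z : vtx (insert a l2)) s t, on_strand z -> meet_at z s (inl x) t ->
     \forall r \near (spos z s)^'+, F' r =
       act (lab2 z (inl x)) (0 < det2 (dir z) (dir (inl x : vtx (insert a l2)))) (F' (spos z s))
         (ux t)) ->
  F' 0 = F 0 -> F' (size l2).+1%:R = F (size l1).+1%:R ->
  strand_coloring lab2 (fun w => if w == x then ux else u w) F'.
Proof.
move=> sc ux fl xfree xmeet Fl Ffree Fmeet F0 Fm; pose u' w := if w == x then ux else u w.
rewrite -/u'.
have u'o w : w != x -> u' w = u w by rewrite /u' => /negbTE ->.
have u'x : u' x = splice lo hi f (u x) by rewrite /u' eqxx.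
rewrite /ux -u'x in xfree xmeet Fmeet.
have off s v : ~~ (lo <= s <= hi) -> (\forall r \near s^'+, u x r = v) -> \forall r \near s^'+,
  u' x r = v.
  move=> ns uv; rewrite u'x; apply: splice_right; rewrite ifF //.
  by apply: contraNF ns => /andP[-> /ltW ->].
have offv s : ~~ (lo <= s <= hi) -> u' x s = u x s.
  by move=> ns; rewrite u'x /splice ifF //; apply: contraNF ns => /andP[/ltW -> ->].
have end0 w : u' w 0 = u w 0.
  by have [->|wx] := eqVneq w x; [rewrite u'x /splice (lt_gtF lo0)|rewrite u'o].
have end1 w : u' w 1 = u w 1.
  by have [->|wx] := eqVneq w x; [rewrite u'x /splice [1 <= hi]leNgt hi1 andbF|rewrite u'o].
have transfer w s y t : w != a -> y != a -> @meet_at _ (insert a l2) (inl w) s (inl y) t ->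
    \forall r \near s^'+, u w r =
      act (lab2 (inl w) (inl y)) (0 < det2 (dir (inl w : vtx (insert a l2))) (dir (inl y : vtx
        (insert a l2)))) (u w s) (u y t).
  move=> wa ya mt; have mP := iffLR (outer_meet l2 _ _ wa ya) mt.
  have m1 := iffRL (outer_meet l1 _ _ wa ya) mP.
  by have := sc_meet_outer sc wa m1; rewrite !glue_outer // !outer_dir // (so wa ya) //; exists s,
    t.
split.
- move=> w s wa s01; have [->|wx] := eqVneq w x; last by rewrite u'o //;
    exact: (sc_left_outer sc wa s01).
  by rewrite u'x; apply: splice_left; [exact: fl|exact: (sc_left_outer sc xa s01)].
- by move=> c _; exact: Fl.
- move=> w s wa s01 nm.
  have free1 : ~~ (w == x) || ~~ (lo <= s <= hi) -> \forall r \near s^'+, u w r = u w s.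
    move=> h; apply: (sc_free_outer sc wa s01) => e t mt.
    have [es|[y ya E]] := strandVouter e; last first.
      subst e; apply: (nm (inl y) t); apply: (iffRL (outer_meet l2 _ _ wa ya)).
      exact: (iffLR (outer_meet l1 _ _ wa ya) mt).
    have [[wx] sw] := c1 es (meet_sym mt); by rewrite wx eqxx sw in h.
  have [wx|wx] := eqVneq w x; last by rewrite u'o //; apply: free1; rewrite wx.
  subst w; have [sw|sw] := boolP (lo <= s <= hi); first by apply: xfree => // z t _; exact: nm.
  by rewrite offv //; apply: off => //; apply: free1; rewrite sw orbT.
- exact: Ffree.
- move=> w s e t wa mt; have [es|[y ya E]] := strandVouter e.
    have [[wx] sw] := c2 es (meet_sym mt); subst w; rewrite glue_strand //; exact: xmeet.
  subst e; have mP := iffLR (outer_meet l2 _ _ wa ya) mt; rewrite glue_outer //.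
  have u'y : u' y t = u y t.
    have [yx|yx] := eqVneq y x; last by rewrite u'o.
    subst y; apply: offv; apply/negP => tw; exact: (clear tw wa (meet_sym mP)).
  rewrite u'y; have [wx|wx] := eqVneq w x; last by rewrite u'o //; exact: transfer.
  subst w; have ns : ~~ (lo <= s <= hi) by apply/negP => sw; exact: (clear sw ya mP).
  by rewrite offv //; apply: off => //; exact: transfer.
- move=> z s e t zs mt; have [E _] := c2 zs mt; subst e; rewrite glue_outer //; exact: Fmeet.
- by move=> w wa nw; rewrite end0 end1 (sc_next sc).
- by move=> w wa nw; rewrite end1 F0 (sc_start sc wa nw).
- by move=> na; rewrite end0 Fm (sc_end sc na).
- by move=> na; rewrite F0 Fm (sc_loop sc na).
Qed.

End Rebuild.

End SecondMove.

Section SecondMoveCard.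
Variables (R : realType) (T : Type) (Q : operator_quandle T) (P : polygon R) (a : vtx P).

(** Both crossings have the same passage and opposite signs, so the second undoes the first. The
    colour [c] in [mx] is right even when [x] reaches the second crossing first: the strand is over
    and still has [c], or [x] is over and ignores it. *)
Lemma second_move_colors (L : passage T) b o (c v : Q) : classical L ->
  let mc := act L b c v in let mx := act (mirror L) (if o then ~~ b else b) v c in
  [/\ mc = act L b c (bef o v mx), c = act L (~~ b) mc (bef (~~ o) v mx),
      bef o mx v = act (mirror L) (~~ b) (bef o v mx) c &
      bef (~~ o) mx v = act (mirror L) b (bef (~~ o) v mx) mc].
Proof. by case: L => // _; case: b; case: o => /=; rewrite ?qdivK ?qopK. Qed.

(** The two actions on the lower strand are inverse to each other and the upper strand is constant,
    whatever the middle colours. *)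
Lemma second_move_outgoing (L : passage T) b o (c mc oc v mx ox : Q) : classical L ->
  mc = act L b c (bef o v mx) -> oc = act L (~~ b) mc (bef (~~ o) v mx) ->
  bef o mx ox = act (mirror L) (~~ b) (bef o v mx) c ->
  bef (~~ o) mx ox = act (mirror L) b (bef (~~ o) v mx) mc -> oc = c /\ ox = v.
Proof.
case: L => // _; case: b; case: o => /= E1 E2 E3 E4; subst; by rewrite ?qdivK ?qopK.
Qed.

Variables (p : R * R) (lab1 : labelling T a [::]) (lab2 : labelling T a [:: p]).
Hypotheses (ok1 : is_diagram lab1) (ok2 : is_diagram lab2) (so : same_outside lab1 lab2).
Local Notation triangle := [:: pos a; p; pos (nextv a)].
Local Notation m := ((size [:: p]).+1%:R : R).

Section Bigon.
Variables (x : vtx P) (e1 e2 : vtx (insert a [:: p])) (s1 t1 s2 t2 lo hi : R) (L : passage T) (b :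
  bool).
Hypotheses (xa : x != a) (lo0 : 0 < lo) (hi1 : hi < 1) (cL : classical L).
Hypotheses (o1 : on_strand e1) (o2 : on_strand e2).
Hypotheses (m1 : meet_at e1 s1 (inl x) t1) (m2 : meet_at e2 s2 (inl x) t2).
Hypotheses (in1 : lo <= t1 <= hi) (in2 : lo <= t2 <= hi) (t12 : t1 != t2).
Hypothesis clear : forall r f t, lo <= r <= hi -> f != a -> ~ meet_at x r f t.
Hypothesis idle : forall (z : vtx (insert a [::])) s f t, on_strand z -> ~ meet_at z s f t.
Hypothesis only : forall (z : vtx (insert a [:: p])) s f t, on_strand z -> meet_at z s f t ->
  f = inl x /\ ([/\ z = e1, s = s1 & t = t1] \/ [/\ z = e2, s = s2 & t = t2]).
Hypotheses (L1 : lab2 e1 (inl x) = L) (L2 : lab2 e2 (inl x) = L).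
Hypotheses (b1 : (0 < det2 (dir e1) (dir (inl x : vtx (insert a [:: p])))) = b)
  (b2 : (0 < det2 (dir e2) (dir (inl x : vtx (insert a [:: p])))) = ~~ b).
Let p1 := spos e1 s1.
Let p2 := spos e2 s2.
Hypothesis p12 : p1 < p2.

Let np : p1 != p2.
Proof. by rewrite lt_eqF. Qed.

Let x_meets s z t : lo <= s <= hi -> @meet_at _ (insert a [:: p]) (inl x) s z t ->
  [/\ z = e1, t = s1 & s = t1] \/ [/\ z = e2, t = s2 & s = t2].
Proof.
move=> sw mt; have [zs|[y ya E]] := strandVouter z.
  by have [_] := only zs (meet_sym mt).
by subst z; case: (clear sw ya (iffLR (outer_meet _ _ _ xa ya) mt)).
Qed.

Let bounds : [/\ 0 <= p1 < m & 0 <= p2 < m].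
Proof.
have [_ s101 _ _] := m1; have [_ s201 _ _] := m2.
by split; [exact: spos_range_lt|exact: spos_range_lt].
Qed.

Lemma idle_edge u (F : R -> Q) : strand_coloring lab1 u F ->
  (forall s, lo <= s <= hi -> u x s = u x lo) /\ \forall r \near hi^'+, u x r = u x lo.
Proof.
move=> sc; have l0 := lo0; have h0 := hi1.
have free s : lo <= s <= hi -> \forall r \near s^'+, u x r = u x s.
  move=> sw; apply: (sc_free_outer sc xa) => [|f t mt]; first by lra.
  have [fs|[y ya E]] := strandVouter f; first exact: idle fs (meet_sym mt).
  by subst f; exact: (clear sw ya (iffLR (outer_meet _ _ _ xa ya) mt)).
have cst : forall s, lo <= s <= hi -> u x s = u x lo.
  apply: lim_const => s s01; first by apply: (sc_left_outer sc xa); lra.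
  by apply: free; lra.
split=> //; rewrite -(cst hi); last by case/andP: in1 => h1 h2; rewrite lexx (le_trans h1).
by apply: free; case/andP: in1 => h1 h2; rewrite lexx (le_trans h1).
Qed.

Lemma second_move_add u (F : R -> Q) : strand_coloring lab1 u F -> exists u' F',
  [/\ strand_coloring lab2 u' F', forall w s, (w = x -> ~~ (lo < s <= hi)) ->
    u w s = u' w s & F 0 = F' 0].
Proof.
move=> sc; have [cst rgt] := idle_edge sc; set v := u x lo in cst rgt.
have Fc : forall c : R, 0 <= c <= 1%:R -> F c = F 0.
  by apply: (strand_const sc) => // z s f t zs _ mt; case: (idle zs mt).
set c := F 0 in Fc *.
have [] := @second_move_colors L b (t1 < t2) c v cL.
set mc := act L b c v; set mx := act (mirror L) _ v c => E1 E2 E3 E4.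
pose f := tri t1 t2 v mx v; pose F' := tri p1 p2 c mc c.
pose u' w := if w == x then splice lo hi f (u x) else u w.
have [/andP[p10 p1m] /andP[p20 p2m]] := bounds.
have [l1 h1] := andP in1; have [l2 h2] := andP in2.
have u'x : u' x = splice lo hi f (u x) by rewrite /u' eqxx.
have inside s : lo <= s <= hi -> u' x s = f s.
  move=> /andP[ls sh]; rewrite u'x /splice sh andbT; case: ltP => // sl.
  have -> : s = lo by apply/eqP; rewrite eq_le sl ls.
  by rewrite /f tri_first.
have right s : lo <= s <= hi -> \forall r \near s^'+, u' x r = tri_right t1 t2 v mx v s.
  move=> /andP[ls sh]; rewrite u'x; apply: splice_right; rewrite ls /=.
  move: sh; rewrite le_eqVlt => /orP[/eqP ->|sh]; last by rewrite sh; exact: tri_rightP.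
  by rewrite ltxx tri_right_last.
have F1 : F' p1 = c by rewrite /F' tri_at1 // p12.
have F2 : F' p2 = mc by rewrite /F' tri_at2 // p12.
have x1 : u' x t1 = bef (t1 < t2) v mx by rewrite inside // /f tri_at1.
have x2 : u' x t2 = bef (~~ (t1 < t2)) v mx by rewrite inside // /f tri_at2 // /bef; case: (_ < _).
exists u', F'; split.
- apply: (window_rebuild xa lo0 hi1 clear so _ _ sc (f := f)).
  + by move=> z s g t zs mt; case: (idle zs mt).
  + by move=> z s g t zs mt; case: (only zs mt) => -> [] [_ _ ->].
  + by move=> s; exact: tri_left.
  + move=> s sw nm; rewrite -u'x inside // /f -(@tri_right_free _ _ t1 t2); first exact: right.
      by apply/eqP => E; subst s; apply: (nm e1 s1 o1); exact: meet_sym.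
    by apply/eqP => E; subst s; apply: (nm e2 s2 o2); exact: meet_sym.
  + move=> s z t zs mt; have [_ [[E E' E'']|[E E' E'']]] := only zs (meet_sym mt); subst z s t.
      rewrite (strand_mirror ok2 m1) (strand_sign ok2 m1) L1 b1 -u'x x1 F1 -E3 /bef -(@tri_right1 _
        _ _ _ v) //.
      exact: right.
    rewrite (strand_mirror ok2 m2) (strand_sign ok2 m2) L2 b2 negbK -u'x x2 F2 -E4 /bef.
    have -> : (if ~~ (t1 < t2) then mx else v) = tri_right t1 t2 v mx v t2 by rewrite tri_right2
      //; case: (_ < _).
    exact: right.
  + by move=> d; exact: tri_left.
  + move=> z s zs s01 nm; have <- : tri_right p1 p2 c mc c (spos z s) = F' (spos z s);
      last exact: tri_rightP.
    have [_ q1 _ _] := m1; have [_ q2 _ _] := m2.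
    apply: tri_right_free; apply/eqP => E.
      have [E' E''] := spos_inj zs o1 s01 q1 E; subst z s; exact: nm m1.
    have [E' E''] := spos_inj zs o2 s01 q2 E; subst z s; exact: nm m2.
  + move=> z s t zs mt; have [_ [[E E' E'']|[E E' E'']]] := only zs mt; subst z s t.
      rewrite L1 b1 -u'x x1 -/p1 F1 -E1.
      have -> : mc = tri_right p1 p2 c mc c p1 by rewrite tri_right1 // p12.
      exact: tri_rightP.
    rewrite L2 b2 -u'x x2 -/p2 F2 -E2.
    have rc : tri_right p1 p2 c mc c p2 = c by rewrite tri_right2 // p12.
    by have := tri_rightP p1 p2 c mc c p2; rewrite rc.
  + by rewrite /F' tri_first.
  + by rewrite /F' tri_last // Fc // ler01 lexx.
- move=> w s ws; rewrite /u'; case: eqP => // wx; subst w.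
  by rewrite /splice (negbTE (ws erefl)).
- by rewrite /F' tri_first.
Qed.

Lemma second_move_remove u (F : R -> Q) : strand_coloring lab2 u F -> exists u' F',
  [/\ strand_coloring lab1 u' F', forall w s, (w = x -> ~~ (lo < s <= hi)) ->
    u' w s = u w s & F' 0 = F 0].
Proof.
move=> sc; have [/andP[p10 p1m] /andP[p20 p2m]] := bounds.
have l0 := lo0; have h0 := hi1.
have [l1 h1] := andP in1; have [l2 h2] := andP in2.
have w1 := sc_meet sc o1 m1; rewrite glue_outer // L1 b1 -/p1 in w1.
have w2 := sc_meet sc o2 m2; rewrite glue_outer // L2 b2 -/p2 in w2.
have [||||mc [oc [A B C _]]] := two_visits (h := F) (lo := 0) (hi := m) _ _ np _ _ w1 w2.
- by rewrite p10 ltW.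
- by rewrite p20 ltW.
- by move=> c c01; exact: (sc_left sc c01).
- move=> c /andP[c0 _] cx cy cm.
  have [z [s [zs s01 cE]]] : exists (z : vtx (insert a [:: p])) s, [/\ on_strand z,
    0 <= s < 1 & c = spos z s].
    by apply: spos_exists; rewrite c0.
  rewrite cE; apply: (sc_free sc zs s01) => f t mt.
  have [_ [[E E' _]|[E E' _]]] := only zs mt; subst z s; first by rewrite cE eqxx in cx.
  by rewrite cE eqxx in cy.
rewrite p12 in B C.
have v1 := sc_meet_outer sc xa (meet_sym m1); have v2 := sc_meet_outer sc xa (meet_sym m2).
rewrite (strand_mirror ok2 m1) (strand_sign ok2 m1) L1 b1 (glue_strand _ _ _ o1) -/p1 in v1.
rewrite (strand_mirror ok2 m2) (strand_sign ok2 m2) L2 b2 negbK (glue_strand _ _ _ o2) -/p2 in v2.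
have free s : lo <= s <= hi -> s != t1 -> s != t2 -> \forall r \near s^'+, u x r = u x s.
  move=> sw n1 n2; apply: (sc_free_outer sc xa); first by lra.
  by move=> f t /(x_meets sw)[] [_ _ E]; [rewrite E eqxx in n1|rewrite E eqxx in n2].
have [||mx [ox [A' B' C' D']]] := two_visits in1 in2 t12 _ _ v1 v2.
- by move=> s s01; apply: (sc_left_outer sc xa); lra.
- by move=> s s01 n1 n2 _; apply: free.
have {}D' : \forall r \near hi^'+, u x r = ox by apply: D'; apply: free; lra.
have F1 : F p1 = F 0 by rewrite A ?p10 ?ltW // tri_at1 // p12.
have F2 : F p2 = mc by rewrite A ?p20 ?ltW // tri_at2 // p12.
have x1 : u x t1 = bef (t1 < t2) (u x lo) mx by rewrite A' // tri_at1.
have x2 : u x t2 = bef (~~ (t1 < t2)) (u x lo) mx by rewrite A' // tri_at2 // /bef; case: (_ < _).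
rewrite F1 x1 in B; rewrite F2 x2 in C; rewrite F1 x1 in B'; rewrite F2 x2 in C'.
have E4 : bef (~~ (t1 < t2)) mx ox = act (mirror L) b (bef (~~ (t1 < t2)) (u x lo) mx) mc.
  by rewrite C' /bef; case: (t1 < t2).
have [ocE oxE] := second_move_outgoing cL (esym B) (esym C) (esym B') E4.
pose u' w := if w == x then splice lo hi (fun _ => u x lo) (u x) else u w.
exists u', (fun _ => F 0); split=> //.
- apply: (window_rebuild xa lo0 hi1 clear _ _ _ sc (f := fun _ => u x lo)).
  + by move=> y z ya za yz; rewrite so.
  + by move=> z s g t zs mt; case: (only zs mt) => -> [] [_ _ ->].
  + by move=> z s g t zs mt; case: (idle zs mt).
  + by move=> s; near=> r.
  + move=> s /andP[ls sh] _; have -> : splice lo hi (fun _ => u x lo) (u x) s = u x lo.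
      rewrite /splice sh andbT; case: ltP => // sl.
      by congr (u x _); apply/eqP; rewrite eq_le sl ls.
    apply: splice_right; rewrite ls /=; move: sh; rewrite le_eqVlt => /orP[/eqP ->|->];
      last by near=> r.
    by rewrite ltxx -oxE.
  + by move=> s z t zs mt; case: (idle zs (meet_sym mt)).
  + by move=> c; near=> r.
  + by move=> z s _ _ _; near=> r.
  + by move=> z s t zs mt; case: (idle zs mt).
  + by [].
  + by rewrite (A m) ?lexx ?ler0n // tri_last.

- move=> w s ws; rewrite /u'; case: eqP => // wx; subst w.
  by rewrite /splice (negbTE (ws erefl)).
Unshelve. all: by end_near. Qed.

Lemma second_move_determined1 u (F : R -> Q) v G : strand_coloring lab1 u F ->
  strand_coloring lab1 v G ->
  (forall w s, w != a -> 0 <= s <= 1 -> (w = x -> ~~ (lo < s <= hi)) -> u w s = v w s) ->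
  F 0 = G 0 -> same_strand_points a [::] u F v G.
Proof.
move=> su sv out FG; have l0 := lo0; have h0 := hi1; split=> [w s wa s01|c c01].
  have [/andP[/eqP -> sw]|sw] := boolP ((w == x) && (lo < s <= hi)); last first.
    by apply: out => // wx; rewrite wx eqxx in sw.
  have [cu _] := idle_edge su; have [cv _] := idle_edge sv.
  have sw' : lo <= s <= hi by case/andP: sw => /ltW ->.
  rewrite (cu s sw') (cv s sw'); apply: out => //; first by have /andP[k1 k2] := in1; lra.
  by rewrite ltxx.
have h (w : vtx P -> R -> Q) (H : R -> Q) : strand_coloring lab1 w H -> H c = H 0.
  by move=> sw; apply: (strand_const sw) c01 => // z s f t zs _ mt; case: (idle zs mt).
by rewrite (h _ _ su) (h _ _ sv).
Qed.

Lemma second_move_determined2 u (F : R -> Q) v G : strand_coloring lab2 u F ->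
  strand_coloring lab2 v G ->
  (forall w s, w != a -> 0 <= s <= 1 -> (w = x -> ~~ (lo < s <= hi)) -> u w s = v w s) ->
  F 0 = G 0 -> same_strand_points a [:: p] u F v G.
Proof.
move=> su sv out FG; have l0 := lo0; have k0 := hi1.
have pu := strand_coloring_point su; have pv := strand_coloring_point sv.
have h0 : u x lo = v x lo.
  by apply: out => //; [have /andP[k1 k2] := in1; lra|rewrite ltxx].
have claim_e : (L = Under -> forall s, lo <= s <= hi -> u x s = v x s) ->
    forall c : R, 0 <= c <= m -> F c = G c.
  move=> hx; apply: (strand_agree su sv) => // z s f t zs _ mt.
  have [E [[E1 E2 E3]|[E1 E2 E3]]] := only zs mt; subst f z s t; rewrite !glue_outer // ?L1 ?L2;
    by case: (L) hx => [_|h|? _]; [left|right; apply: h|left].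
have claim_x : (mirror L = Under -> F p1 = G p1 /\ F p2 = G p2) -> forall s, lo <= s <= hi ->
  u x s = v x s.
  move=> he s sw; rewrite -(glue_outer [:: p] u F s xa) -(glue_outer [:: p] v G s xa).
  apply: (pc_agree pu pv _ _ _ _ sw); [exact: ltW|exact: ltW|by rewrite !glue_outer|].
  move=> r f t /andP[r1 r2] mt; have rw : lo <= r <= hi by rewrite r1 ltW.
  have [[E1 E2 E3]|[E1 E2 E3]] := x_meets rw mt; subst f t r.
    rewrite (strand_mirror ok2 m1) L1 !(glue_strand _ _ _ o1).
    by case: (L) he => [h|_|? _]; [right; case: h|left|left].
  rewrite (strand_mirror ok2 m2) L2 !(glue_strand _ _ _ o2).
  by case: (L) he => [h|_|? _]; [right; case: h|left|left].
have [/andP[q1 q1'] /andP[q2 q2']] := bounds.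
(* Whichever of the strand and [x] is on top is settled first. *)
have [AX AF] : (forall s, lo <= s <= hi -> u x s = v x s) /\ (forall c : R, 0 <= c <= m ->
  F c = G c).
  move: claim_e claim_x cL; case: (L) => // ce cx _.
    have e := ce ltac:(by []); split=> //; apply: cx => _.
    by split; apply: e; rewrite ?q1 ?q2 ltW.
  have h := cx ltac:(by []); split=> //; exact: ce.
split=> // w s wa s01.
have [/and3P[/eqP -> h1 h2]|sw] := boolP [&& w == x, lo < s & s <= hi].
  by apply: AX; rewrite ltW.
by apply: out => // wx; rewrite wx eqxx in sw.
Qed.

Lemma second_move_card : (Col (Diagram ok1) Q #= Col (Diagram ok2) Q)%card.
Proof.
pose M (u : vtx P -> R -> Q) (F : R -> Q) (u' : vtx P -> R -> Q) (F' : R -> Q) :=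
  (forall w s, (w = x -> ~~ (lo < s <= hi)) -> u w s = u' w s) /\ F 0 = F' 0.
apply: (@strand_card_eq _ _ _ _ _ _ _ _ _ ok1 ok2 M) => [u F sc|u F sc|].
- by have [u' [F' [sc' h h0]]] := second_move_add sc; exists u', F'.
- by have [u' [F' [sc' h h0]]] := second_move_remove sc; exists u', F'.
move=> u F u' F' v G v' G' c1 c2 d1 d2 [n n0] [k k0]; split=> -[E1 E2].
  apply: (second_move_determined2 c2 d2); last by rewrite -n0 -k0 E2 // lexx ler0n.
  by move=> w s wa s01 sX; rewrite -n // -k // E1.
apply: (second_move_determined1 c1 d1); last by rewrite n0 k0 E2 // lexx ler0n.
by move=> w s wa s01 sX; rewrite n // k // E1.
Qed.

End Bigon.

Lemma reidemeister2_card : reidemeister2 lab2 -> (Col (Diagram ok1) Q #= Col (Diagram ok2) Q)%card.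
Proof.
move=> [x [xa om [[s1 [t1 m1]] [s2 [t2 m2]]] cL LE]].
have o1 : on_strand (inl a : vtx (insert a [:: p])) by rewrite /=.
set e1 : vtx (insert a [:: p]) := inl a in o1 m1 m2 cL LE.
have [r2 o2] : rk (nextv e1) = 1%N /\ on_strand (nextv e1) by have [] := rk_next o1.
set e2 := nextv e1 in o2 r2 m2 LE.
have L2 : {subset pos a :: rcons [:: p] (pos (nextv a)) <= triangle} by [].
have L1 : {subset pos a :: rcons [::] (pos (nextv a)) <= triangle}.
  by move=> q; rewrite !inE => /orP[] ->; rewrite ?orbT.
have [Ap b1] := opposite_sides ok2.1 xa m1; have [pB b2] := opposite_sides ok2.1 xa m2.
have [p1 n1] : pos e1 = pos a /\ pos (nextv e1) = p.
  by case: (triangle_edge o1) => -[] // rr; rewrite /rk /= in rr.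
have [p2 n2] : pos e2 = p /\ pos (nextv e2) = pos (nextv a).
  by case: (triangle_edge o2) => -[]; rewrite r2.
rewrite p1 n1 in Ap b1; rewrite p2 n2 in pB b2.
(* The new vertex lies across [x] from both ends of the old edge. This gives the opposite signs here
   and, further on, shows that the old edge does not cross [x]. *)
have b12 : (0 < side x p) = ~~ (0 < side x (pos a)).
  case: (ltrgt0P (side x p)) Ap => [h|h|->]; last by rewrite mulr0 ltxx.
    by rewrite (pmulr_llt0 _ h) => h'; rewrite (lt_gtF h').
  by rewrite (nmulr_llt0 _ h) => ->.
have t12 : t1 != t2.
  apply/eqP => E; rewrite E in m1.
  have [E' _] := meet_edge ok2.1 (meet_sym m1) (meet_sym m2).
  by move: r2; rewrite -E'.
have hull2 z s t : on_strand z -> @meet_at _ (insert a [:: p]) z s (inl x) t ->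
  hull triangle (pt x t) /\ 0 < t < 1.
  move=> zs mt; have [s01 t01 _] := meet_interior ok2.1 mt; split=> //.
  by have [_ _ _] := mt; rewrite outer_pt // => <-; apply: strand_hull => //; lra.
have [h1 /andP[t10 t11]] := hull2 _ _ _ o1 m1; have [h2 /andP[t20 t21]] := hull2 _ _ _ o2 m2.
apply: (@second_move_card x e1 e2 s1 t1 s2 t2 (Num.min t1 t2) (Num.max t1 t2) (lab2 e1 (inl x)) (0
  < side x (pos a))) => //.
- by rewrite lt_min t10.
- by rewrite gt_max t11.
- by rewrite ge_min le_max lexx.
- by rewrite ge_min le_max lexx !orbT.
- move=> r f t rw fa mf; have hr := line_hull h1 h2 t12 rw.
  have [_ _ t01 E] := mf; have := om f t fa t01; rewrite -E => /(_ hr)[|[fn t0]].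
    by rewrite inE => /eqP fx; case: mf; rewrite fx eqxx.
  by have [_ + _] := meet_interior ok1.1 (iffRL (outer_meet _ _ _ xa fa) mf); rewrite t0 ltxx.
- move=> z s f t zs mt; have [fs|[w wa E]] := strandVouter f.
    by case: (short_strand_simple _ ok1.1 zs fs mt).
  subst f; have := only_meets_strand ok1.1 om L1 zs wa mt; rewrite inE => /eqP wx; subst w.
  have AB := segment_sides ok1.1 xa zs mt.
  case: (ltrgt0P (side x p)) Ap pB => [h|h|->]; last by rewrite mulr0 ltxx.
    by rewrite (pmulr_llt0 _ h) (pmulr_rlt0 _ h) => k k'; move: AB;
      rewrite (nmulr_rlt0 _ k) (lt_gtF k').
  by rewrite (nmulr_llt0 _ h) (nmulr_rlt0 _ h) => k k'; move: AB;
    rewrite (pmulr_rlt0 _ k) (lt_gtF k').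
- move=> z s f t zs mt; have [fs|[w wa E]] := strandVouter f.
    by case: (short_strand_simple _ ok2.1 zs fs mt).
  subst f; have := only_meets_strand ok2.1 om L2 zs wa mt; rewrite inE => /eqP wx; subst w;
    split=> //.
  have rr : rk z = 0%N \/ rk z = 1%N by case: (triangle_edge zs) => -[]; [left|right].
  case: rr => rr; [left|right].
    have zE : z = e1 by apply: (rk_inj zs o1); rewrite rr.
    by subst z; have [-> ->] := meet_param ok2.1 mt m1.
  have zE : z = e2 by apply: (rk_inj zs o2); rewrite rr r2.
  by subst z; have [-> ->] := meet_param ok2.1 mt m2.
- by rewrite b2.
- have [_ /andP[_ s11] _ _] := m1; have [_ /andP[s20 _] _ _] := m2.
  by rewrite /spos r2 /=; lra.
Qed.

End SecondMoveCard.

Local Open Scope card_scope.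

Theorem theorem4p1 (R : realType) (T : Type) (D1 D2 : diagram R T)
    (Q : operator_quandle T) (eqD : equivalent D1 D2) :
  Col D1 Q #= Col D2 Q.
Proof.
elim: eqD => {D1 D2} [D1 D2|D|D1 D2 _|D1 D2 D3 _ E12 _ E23].
- case=> {D1 D2} [D1 D2 iso|P a p lab1 lab2 ok1 ok2 so [[s0 s01 pE] sp]
                 |P a p q lab1 lab2 ok1 ok2|P a p lab1 lab2 ok1 ok2
                 |P a p lab1 lab2 ok1 ok2|P a l1 l2 lab1 lab2 ok1 ok2 alpha].
  + by have [phi [psi E]] := isotopic_gauss_equiv iso; exact: gauss_equiv_card E.
  + exact: (subdivision_card Q ok1 ok2 so s01 pE sp).
  + exact: reidemeister1_card.
  + exact: reidemeister2_card.
  + exact: reidemeister3_card.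
  + exact: detour_card.
- exact: card_eqxx.
- by rewrite card_eq_sym.
- exact: card_eq_trans E12 E23.
Qed.
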